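(* Let $\mathcal{K}$ be a field of characteristic $p$ ($p$ a prime) and $q\in\mathcal{K}$. For each given $\eta=(\eta_1,\dots,\eta_n)$ with $\eta_i\in\{0,1\}$, there exists a noncommutative and noncocommutative Hopf algebra $(\mathbf{u}_{t,q}(\mathbf{W}(n;\underline1)),m,\iota,\Delta,S,\varepsilon)$ over $\mathcal{K}[t]_p^{(q)}$ with the algebra structure undeformed, whose coalgebra structure (and antipode) is given, for $0\le\alpha\le\tau$ and $1\le i\le n$, by $$\Delta(x^{(\alpha)}D_i)=x^{(\alpha)}D_i\otimes(1-e(I)t)^{\eta(\alpha-\delta_{iI})}+\sum_{\eta\ell=\underline0}^{\eta\tau}(-1)^{|\eta\ell|}h(I)^{\langle\eta\ell\rangle}\otimes(1-e(I)t)^{-\eta\ell}\cdot d_I^{(\eta\ell)}(x^{(\alpha)}D_i)t^{|\eta\ell|},$$ $$S(x^{(\alpha)}D_i)=-(1-e(I)t)^{-\eta(\alpha-\delta_{iI})}\Bigl(\sum_{\eta\ell=\underline0}^{\eta\tau}d_I^{(\eta\ell)}(x^{(\alpha)}D_i)\,h(I)_1^{\langle\eta\ell\rangle}t^{|\eta\ell|}\Bigr),$$ $$\varepsilon(x^{(\alpha)}D_i)=0.$$ It is finite dimensional and $\dim_{\mathcal{K}}\mathbf{u}_{t,q}(\mathbf{W}(n;\underline1))=p^{1+np^n}$.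
   Context: $\mathcal{O}(n;\underline1)$ is the restricted divided power algebra with $\mathcal{K}$-basis $\{x^{(\alpha)}\mid0\le\alpha\le\tau\}$, $\tau=(p-1,\dots,p-1)$, product $x^{(\alpha)}x^{(\beta)}=\binom{\alpha+\beta}{\alpha}x^{(\alpha+\beta)}$, $\binom{\alpha+\beta}{\alpha}=\prod_i\binom{\alpha_i+\beta_i}{\alpha_i}$, with $x^{(\alpha)}=0$ if some component $\alpha_j<0$ or $\alpha_j\ge p$. $\epsilon_i$ is the $i$-th standard basis vector and $D_j$ is the derivation $D_j(x^{(\alpha)})=x^{(\alpha-\epsilon_j)}$. The Jacobson-Witt algebra $\mathbf{W}(n;\underline1)\cong\mathrm{Der}_{\mathcal{K}}(\mathcal{O}(n;\underline1))$ has basis $\{x^{(\alpha)}D_j\mid1\le j\le n,0\le\alpha\le\tau\}$ and is a restricted Lie algebra with $D^{[p]}=D^p$. Its restricted universal enveloping algebra is $\mathbf{u}(\mathbf{W}(n;\underline1))=U(\mathbf{W}(n;\underline1))/I'$, where $I'$ is the ideal generated by $(x^{(\epsilon_i)}D_i)^p-x^{(\epsilon_i)}D_i$ and $(x^{(\alpha)}D_i)^p$ for $\alpha\ne\epsilon_i$ ($0\le\alpha\le\tau$, $1\le i\le n$); it has dimension $p^{np^n}$. $\mathcal{K}[t]_p^{(q)}$ denotes the $p$-truncated polynomial ring obtained as the quotient $\mathcal{K}[[t]]/(t^p-qt)$, and $\mathbf{u}_{t,q}(\mathbf{W}(n;\underline1))\cong\mathbf{u}(\mathbf{W}(n;\underline1))\otimes_{\mathcal{K}}\mathcal{K}[t]_p^{(q)}$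 as an algebra. For $1\le k\le n$: $h(k):=x^{(\epsilon_k)}D_k$, $e(k):=2x^{(2\epsilon_k)}D_k$ (so $[h(k),e(k)]=e(k)$, and $e(k)^p=0$ in $\mathbf{u}(\mathbf{W}(n;\underline1))$, so $1-e(k)t$ is invertible), $d_k^{(s)}:=\frac1{s!}(\mathrm{ad}\,e(k))^s$ for $0\le s\le p-1$. For an element $x$ of a unital algebra and a scalar $a$, $x_a^{\langle s\rangle}:=(x+a)(x+a+1)\cdots(x+a+s-1)$, $x_a^{\langle0\rangle}=1$, $x^{\langle s\rangle}:=x_0^{\langle s\rangle}$. $I=\{1,\dots,n\}$; for $\ell\in\mathbb{Z}_{\ge0}^n$, $\eta\ell=(\eta_1\ell_1,\dots,\eta_n\ell_n)$ and $|\eta\ell|=\sum_i\eta_i\ell_i$. The sums $\sum_{\eta\ell=\underline0}^{\eta\tau}$ run over the vectors $\eta\ell$ with $\underline0\le\eta\ell\le\eta\tau$, each taken once. Notation: $(1-e(I)t)^{\eta(\alpha-\delta_{iI})}=\prod_{k\in I}(1-e(k)t)^{\eta_k(\alpha_k-\delta_{ik})}$, $(1-e(I)t)^{-\eta\ell}=\prod_{k\in I}(1-e(k)t)^{-\eta_k\ell_k}$, $h(I)^{\langle\eta\ell\rangle}=\prod_{k\in I}h(k)^{\langle\eta_k\ell_k\rangle}$, $h(I)_1^{\langle\eta\ell\rangle}=\prod_{k\in I}h(k)_1^{\langle\eta_k\ell_k\rangle}$, $d_I^{(\eta\ell)}=\prod_{k\in I}d_k^{(\eta_k\ell_k)}$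.
   Formalization: ''Noncocommutative'' is asserted only for p > 2 and η ≠ 0 (for p = 2, where e(k) = 0, or η = 0 all generators are primitive, so it fails); K[t]_p^(q) is K[t]/(t^p − qt), since K[[t]]/(t^p − qt) is just K when q ≠ 0; n ≥ 1 is assumed. *)

(* Defs.v *)
From HB Require Import structures.
From mathcomp Require Import all_boot all_order all_algebra.
From mathcomp Require Import boolp.
From mathcomp Require Import monalg.

Set Implicit Arguments.
Unset Strict Implicit.
Unset Printing Implicit Defensive.

Import GRing.Theory.

Local Open Scope ring_scope.
Local Open Scope quotient_scope.

Reserved Notation "a \ox b" (at level 40, left associativity).

Section TensorType.
Context {R : comNzRingType} (A B : lmodType R).

(* The congruence of bilinearity on formal sums of pairs; the pair (a, b)
   stands for the pure tensor of a and b. *)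
Inductive tens_eq : seq (A * B) -> seq (A * B) -> Prop :=
| tens_eq_refl s : tens_eq s s
| tens_eq_sym s1 s2 : tens_eq s1 s2 -> tens_eq s2 s1
| tens_eq_trans s2 s1 s3 : tens_eq s1 s2 -> tens_eq s2 s3 -> tens_eq s1 s3
| tens_eq_cat s1 s2 s1' s2' :
    tens_eq s1 s1' -> tens_eq s2 s2' -> tens_eq (s1 ++ s2) (s1' ++ s2')
| tens_eq_catC s1 s2 : tens_eq (s1 ++ s2) (s2 ++ s1)
| tens_eq_0 b : tens_eq [:: (0, b)] [::]
| tens_eq_Dl a a' b : tens_eq [:: (a + a', b)] [:: (a, b); (a', b)]
| tens_eq_Dr a b b' : tens_eq [:: (a, b + b')] [:: (a, b); (a, b')]
| tens_eq_Z r a b : tens_eq [:: (r *: a, b)] [:: (a, r *: b)].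

Definition tens_eqb : rel (seq (A * B)) := fun s1 s2 => `[< tens_eq s1 s2 >].

Lemma tens_eqb_equiv : equiv_class_of tens_eqb.
Proof.
split=> [s|s1 s2|s2 s1 s3].
- by apply/asboolP; constructor.
- by apply/asboolP/asboolP; apply: tens_eq_sym.
- by move=> /asboolP h1 /asboolP h2; apply/asboolP; apply: tens_eq_trans h1 h2.
Qed.

Canonical tens_equiv := EquivRelPack tens_eqb_equiv.

Definition tens := {eq_quot tens_eqb}.
HB.instance Definition _ := Choice.on tens.
HB.instance Definition _ := EqQuotient.on tens.

Lemma tens_eqP s1 s2 : tens_eq s1 s2 <-> \pi_tens s1 = \pi_tens s2.
Proof.
by split=> [h|/eqmodP/asboolP//]; apply/eqmodP/asboolP.
Qed.

Definition tens_add (x y : tens) : tens := \pi_tens (repr x ++ repr y).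
Definition tens_opp (x : tens) : tens :=
  \pi_tens [seq (- ab.1, ab.2) | ab <- repr x].

Lemma tens_piW (P : tens -> Prop) : (forall s, P (\pi_tens s)) -> forall x, P x.
Proof. by move=> h x; rewrite -(reprK x). Qed.

Lemma tens_addE s1 s2 :
  tens_add (\pi_tens s1) (\pi_tens s2) = \pi_tens (s1 ++ s2).
Proof.
by apply/tens_eqP; apply: tens_eq_cat; apply/tens_eqP; rewrite reprK.
Qed.

Lemma tens_eq_neg s1 s2 : tens_eq s1 s2 ->
  tens_eq [seq (- ab.1, ab.2) | ab <- s1] [seq (- ab.1, ab.2) | ab <- s2].
Proof.
elim=> {s1 s2} /=.
- by move=> s; apply: tens_eq_refl.
- by move=> s1 s2 _; apply: tens_eq_sym.
- by move=> s2 s1 s3 _ h1 _ h2; apply: tens_eq_trans h1 h2.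
- by move=> s1 s2 s1' s2' _ h1 _ h2; rewrite !map_cat; apply: tens_eq_cat.
- by move=> s1 s2; rewrite !map_cat; apply: tens_eq_catC.
- by move=> b; rewrite oppr0; apply: tens_eq_0.
- by move=> a a' b; rewrite opprD; apply: tens_eq_Dl.
- by move=> a b b'; apply: tens_eq_Dr.
- by move=> r a b; rewrite -scalerN; apply: tens_eq_Z.
Qed.

Lemma tens_oppE s :
  tens_opp (\pi_tens s) = \pi_tens [seq (- ab.1, ab.2) | ab <- s].
Proof.
by apply/tens_eqP; apply: tens_eq_neg; apply/tens_eqP; rewrite reprK.
Qed.

Lemma tens_addA : associative tens_add.
Proof.
move=> x y z; elim/tens_piW: x => x; elim/tens_piW: y => y; elim/tens_piW: z => z.
by rewrite !tens_addE catA.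
Qed.

Lemma tens_addC : commutative tens_add.
Proof.
move=> x y; elim/tens_piW: x => x; elim/tens_piW: y => y; rewrite !tens_addE.
by apply/tens_eqP; apply: tens_eq_catC.
Qed.

Lemma tens_add0 : left_id (\pi_tens [::]) tens_add.
Proof. by move=> x; elim/tens_piW: x => x; rewrite tens_addE. Qed.

Lemma tens_addN : left_inverse (\pi_tens [::]) tens_opp tens_add.
Proof.
move=> x; elim/tens_piW: x; elim=> [|[a b] s IH]; first by rewrite tens_oppE tens_addE.
rewrite tens_oppE /= -cat1s -(cat1s (a, b)) -2!tens_addE.
rewrite -tens_addA [X in tens_add _ X]tens_addA.
rewrite [X in tens_add _ (tens_add X _)]tens_addC -tens_addA -tens_oppE IH.
rewrite [X in tens_add _ X]tens_addC tens_add0 tens_addE /=.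
apply/tens_eqP; apply: tens_eq_trans (tens_eq_0 b).
by rewrite -(addNr a); apply/tens_eq_sym/tens_eq_Dl.
Qed.

HB.instance Definition _ := GRing.isZmodule.Build tens
  tens_addA tens_addC tens_add0 tens_addN.

Definition ptens (a : A) (b : B) : tens := \pi_tens [:: (a, b)].

Lemma tens_piE s : \pi_tens s = \sum_(ab <- s) ptens ab.1 ab.2.
Proof.
elim: s => [|[a b] s IH]; first by rewrite big_nil.
by rewrite big_cons -IH -cat1s -[LHS]tens_addE.
Qed.

Lemma tens_sumE (x : tens) : x = \sum_(ab <- repr x) ptens ab.1 ab.2.
Proof. by rewrite -tens_piE reprK. Qed.

Lemma tens_ind (P : tens -> Prop) :
    P 0 -> (forall a b, P (ptens a b)) ->
    (forall x y, P x -> P y -> P (x + y)) -> forall x, P x.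
Proof. by move=> P0 P1 PD x; rewrite (tens_sumE x); apply: big_ind. Qed.

Lemma ptensDl a a' b : ptens (a + a') b = ptens a b + ptens a' b.
Proof. by rewrite [RHS]tens_addE; apply/tens_eqP/tens_eq_Dl. Qed.

Lemma ptensDr a b b' : ptens a (b + b') = ptens a b + ptens a b'.
Proof. by rewrite [RHS]tens_addE; apply/tens_eqP/tens_eq_Dr. Qed.

Lemma ptensZ r a b : ptens (r *: a) b = ptens a (r *: b).
Proof. exact/tens_eqP/tens_eq_Z. Qed.

Definition balanced (M : zmodType) (f : A -> B -> M) :=
  [/\ forall a a' b, f (a + a') b = f a b + f a' b,
      forall a b b', f a (b + b') = f a b + f a b' &
      forall r a b, f (r *: a) b = f a (r *: b)].

(* The additive map induced by f; only meaningful when f is balanced. *)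
Definition tlift (M : zmodType) (f : A -> B -> M) (x : tens) : M :=
  \sum_(ab <- repr x) f ab.1 ab.2.

Lemma tlift_pi (M : zmodType) (f : A -> B -> M) : balanced f ->
  forall s, tlift f (\pi_tens s) = \sum_(ab <- s) f ab.1 ab.2.
Proof.
move=> [fDl fDr fZ] s; rewrite /tlift.
have : tens_eq (repr (\pi_tens s)) s by apply/tens_eqP; rewrite reprK.
move: (repr _) => s'; elim=> {s s'} //=.
- by move=> s2 s1 s3 _ -> _ ->.
- by move=> s1 s2 s1' s2' _ h1 _ h2; rewrite !big_cat /= h1 h2.
- by move=> s1 s2; rewrite !big_cat /= addrC.
- move=> b; rewrite !unlock /= addr0; apply: (addrI (f 0 b)).
  by rewrite -fDl !addr0.
- by move=> a a' b; rewrite !unlock /= !addr0 fDl.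
- by move=> a b b'; rewrite !unlock /= !addr0 fDr.
- by move=> r a b; rewrite !unlock /= fZ.
Qed.

Lemma tlift_ptens (M : zmodType) (f : A -> B -> M) : balanced f ->
  forall a b, tlift f (ptens a b) = f a b.
Proof. by move=> hf a b; rewrite tlift_pi // big_seq1. Qed.

Lemma tliftD (M : zmodType) (f : A -> B -> M) : balanced f ->
  {morph tlift f : x y / x + y}.
Proof.
move=> hf x y; elim/tens_piW: x => x; elim/tens_piW: y => y.
by rewrite [X in tlift f X]tens_addE !tlift_pi // big_cat.
Qed.

Lemma tlift0 (M : zmodType) (f : A -> B -> M) : balanced f -> tlift f 0 = 0.
Proof. by move=> hf; rewrite [LHS](tlift_pi hf [::]) big_nil. Qed.

Definition tens_scale (r : R) : tens -> tens :=
  tlift (fun a b => ptens (r *: a) b).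

Lemma tens_scale_bal r : balanced (fun a b => ptens (r *: a) b).
Proof.
split=> [a a' b|a b b'|s a b]; rewrite ?scalerDr ?ptensDl ?ptensDr //.
by rewrite scalerA mulrC -scalerA ptensZ.
Qed.

Lemma tens_scaleE r a b : tens_scale r (ptens a b) = ptens (r *: a) b.
Proof. exact/tlift_ptens/tens_scale_bal. Qed.

Lemma tens_scaleDr r : {morph tens_scale r : x y / x + y}.
Proof. exact/tliftD/tens_scale_bal. Qed.

Lemma tens_scale0 r : tens_scale r 0 = 0.
Proof. exact/tlift0/tens_scale_bal. Qed.

Lemma tens_scaleA r s x :
  tens_scale r (tens_scale s x) = tens_scale (r * s) x.
Proof.
elim/tens_ind: x => [|a b|x y IHx IHy]; rewrite ?tens_scale0 //.
  by rewrite !tens_scaleE scalerA.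
by rewrite !tens_scaleDr IHx IHy.
Qed.

Lemma tens_scale1 : left_id 1 tens_scale.
Proof.
elim/tens_ind=> [|a b|x y IHx IHy]; rewrite ?tens_scale0 //.
  by rewrite tens_scaleE scale1r.
by rewrite tens_scaleDr IHx IHy.
Qed.

Lemma tens_scaleDl x : {morph tens_scale^~ x : r s / r + s}.
Proof.
move=> r s /=; elim/tens_ind: x => [|a b|x y IHx IHy].
- by rewrite !tens_scale0 addr0.
- by rewrite !tens_scaleE scalerDl ptensDl.
- by rewrite !tens_scaleDr IHx IHy addrACA.
Qed.

HB.instance Definition _ := GRing.Zmodule_isLmodule.Build R tens
  tens_scaleA tens_scale1 tens_scaleDr tens_scaleDl.

Lemma ptensZl r a b : ptens (r *: a) b = r *: ptens a b.
Proof. by rewrite [RHS]tens_scaleE. Qed.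

Lemma ptensZr r a b : ptens a (r *: b) = r *: ptens a b.
Proof. by rewrite -ptensZl ptensZ. Qed.

End TensorType.

Notation "a \ox b" := (ptens a b) : ring_scope.

Section TensorRing.
Context {R : comNzRingType} (A B : algType R).
Local Notation tens := (@tens R A B).
Local Notation ptens := (@ptens R A B).
Let tind := @tens_ind R A B.

Definition tens_mul (x y : tens) : tens :=
  tlift (fun a b => tlift (fun a' b' => ptens (a * a') (b * b')) y) x.

Lemma tens_mul_bal1 a b : balanced (fun a' b' => ptens (a * a') (b * b')).
Proof.
split=> [a' a'' b'|a' b' b''|r a' b'];
  rewrite ?mulrDr ?ptensDl ?ptensDr //.
by rewrite -!scalerAr ptensZ.
Qed.

Lemma tens_mul_bal2 y :
  balanced (fun a b => tlift (fun a' b' => ptens (a * a') (b * b')) y).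
Proof.
have bal := tens_mul_bal1.
split=> [a a' b|a b b'|r a b]; elim/tind: y => [|c d|x y IHx IHy];
  rewrite ?tlift0 ?addr0 ?tlift_ptens ?mulrDl ?ptensDl ?ptensDr //;
  rewrite ?tliftD // ?IHx ?IHy 1?addrACA //.
by rewrite -!scalerAl ptensZ.
Qed.

Lemma tens_mulE a b a' b' :
  tens_mul (ptens a b) (ptens a' b') = ptens (a * a') (b * b').
Proof.
rewrite /tens_mul tlift_ptens; last exact: tens_mul_bal2.
by rewrite tlift_ptens //; apply: tens_mul_bal1.
Qed.

Lemma tens_mulDl : left_distributive tens_mul +%R.
Proof. by move=> x y z; apply: tliftD; apply: tens_mul_bal2. Qed.

Lemma tens_mul0l y : tens_mul 0 y = 0.
Proof. by apply: tlift0; apply: tens_mul_bal2. Qed.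

Lemma tens_mul0r x : tens_mul x 0 = 0.
Proof.
elim/tind: x => [|a b|x y IHx IHy]; first exact: tens_mul0l.
  rewrite /tens_mul tlift_ptens; last exact: tens_mul_bal2.
  by apply: tlift0; apply: tens_mul_bal1.
by rewrite tens_mulDl IHx IHy addr0.
Qed.

Lemma tens_mulDr : right_distributive tens_mul +%R.
Proof.
move=> x y z; elim/tind: x => [|a b|x x' IHx IHy].
- by rewrite !tens_mul0l addr0.
- rewrite /tens_mul !tlift_ptens; try exact: tens_mul_bal2.
  by apply: tliftD; apply: tens_mul_bal1.
- by rewrite !tens_mulDl IHx IHy addrACA.
Qed.

Lemma tens_mulA : associative tens_mul.
Proof.
move=> x y z; elim/tind: x => [|a b|x x' IHx IHy].
- by rewrite !tens_mul0l.
- elim/tind: y => [|a' b'|y y' IHx IHy].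
  + by rewrite !(tens_mul0l, tens_mul0r).
  + elim/tind: z => [|a'' b''|z z' IHx IHy].
    * by rewrite !tens_mul0r.
    * by rewrite !tens_mulE !mulrA.
    * by rewrite !tens_mulDr IHx IHy.
  + by rewrite !(tens_mulDr, tens_mulDl) IHx IHy.
- by rewrite !tens_mulDl IHx IHy.
Qed.

Lemma tens_mul1l : left_id (ptens 1 1) tens_mul.
Proof.
elim/tind=> [|a b|x y IHx IHy]; first exact: tens_mul0r.
  by rewrite tens_mulE !mul1r.
by rewrite tens_mulDr IHx IHy.
Qed.

Lemma tens_mul1r : right_id (ptens 1 1) tens_mul.
Proof.
elim/tind=> [|a b|x y IHx IHy]; first exact: tens_mul0l.
  by rewrite tens_mulE !mulr1.
by rewrite tens_mulDl IHx IHy.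
Qed.

(* Over a general base ring the tensor product may vanish, so it is only
   declared as a possibly zero ring. *)
HB.instance Definition _ := GRing.Zmodule_isPzRing.Build tens
  tens_mulA tens_mul1l tens_mul1r tens_mulDl tens_mulDr.

Lemma ptensM a b a' b' : ptens a b * ptens a' b' = ptens (a * a') (b * b').
Proof. exact: tens_mulE. Qed.

Lemma tens_scaleAl r (x y : tens) : r *: (x * y) = (r *: x) * y.
Proof.
elim/tind: x => [|a b|x x' IHx IHy].
- by rewrite scaler0 !mul0r scaler0.
- elim/tind: y => [|a' b'|y y' IHx IHy].
  + by rewrite !mulr0 scaler0.
  + by rewrite -ptensZl !ptensM -ptensZl scalerAl.
  + by rewrite !mulrDr scalerDr IHx IHy.
- by rewrite scalerDr !mulrDl scalerDr IHx IHy.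
Qed.

Lemma tens_scaleAr r (x y : tens) : r *: (x * y) = x * (r *: y).
Proof.
elim/tind: x => [|a b|x x' IHx IHy].
- by rewrite !mul0r scaler0.
- elim/tind: y => [|a' b'|y y' IHx IHy].
  + by rewrite scaler0 !mulr0 scaler0.
  + by rewrite -ptensZl !ptensM -ptensZl scalerAr.
  + by rewrite scalerDr !mulrDr scalerDr IHx IHy.
- by rewrite !mulrDl scalerDr IHx IHy.
Qed.

End TensorRing.

Section Hopf.
Context {R : comNzRingType}.

Definition tmap (A A' B B' : lmodType R) (f : A -> A') (g : B -> B') :
  tens A B -> tens A' B' := tlift (fun a b => f a \ox g b).

Definition tswap (A B : lmodType R) : tens A B -> tens B A :=
  tlift (fun a b => b \ox a).

Definition tassoc (A B C : lmodType R) :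
    tens (tens A B) C -> tens A (tens B C) :=
  tlift (fun x c => tlift (fun a b => a \ox (b \ox c)) x).

Record hopf_structure (A : algType R) := HopfStructure {
  coproduct : {lrmorphism A -> tens A A};
  counit : {lrmorphism A -> R^o};
  antipode : {linear A -> A};
  coproductA : forall x,
    tassoc (tmap coproduct id (coproduct x)) = tmap id coproduct (coproduct x);
  counitl : forall x, tlift (fun a b => counit a *: b) (coproduct x) = x;
  counitr : forall x, tlift (fun a b => counit b *: a) (coproduct x) = x;
  antipodel : forall x,
    tlift (fun a b => antipode a * b) (coproduct x) = (counit x)%:A;
  antipoder : forall x,
    tlift (fun a b => a * antipode b) (coproduct x) = (counit x)%:A
}.

Definition cocommutative (A : algType R) (H : hopf_structure A) :=
  forall x, tswap (coproduct H x) = coproduct H x.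

End Hopf.

(* A (x)_K K[t]/(h) as an algebra over K[t]/(h). The type is an alias of tens so
   that it can carry this module structure; the K-module structure is the one
   of tens A {poly %/ h}. *)
Section ExtendScalars.
Context {K : fieldType} (A : algType K) (h : {poly K}).
Local Notation S := {poly %/ h}.

Definition ext_scalars := tens A S.
HB.instance Definition _ := Choice.on ext_scalars.
HB.instance Definition _ := GRing.PzRing.on ext_scalars.

Lemma ext_ind (P : ext_scalars -> Prop) :
    P 0 -> (forall a s, P (a \ox s)) ->
    (forall x y, P x -> P y -> P (x + y)) -> forall x, P x.
Proof. exact: tens_ind. Qed.

Lemma ext_neq0 : (1 : ext_scalars) != 0.
Proof.
pose f (a : A) (s : S) : A := (s : {poly K})`_0 *: a.
have bal : balanced f.
  split=> [a b s|a s s'|r a s]; rewrite /f ?scalerDr ?coefD ?scalerDl //.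
  by rewrite scalerA coefZ mulrC.
apply/eqP=> /(congr1 (tlift f)).
rewrite [1](_ : _ = (1 : A) \ox (1 : S)) // tlift_ptens // tlift0 // /f.
by rewrite [_`_0]coefC scale1r; apply/eqP/oner_neq0.
Qed.

HB.instance Definition _ := GRing.PzSemiRing_isNonZero.Build ext_scalars ext_neq0.

Definition ext_scale (s : S) (x : ext_scalars) : ext_scalars :=
  ((1 : A) \ox s : ext_scalars) * x.

Lemma ext_scaleA s s' x : ext_scale s (ext_scale s' x) = ext_scale (s * s') x.
Proof.
by rewrite /ext_scale mulrA; congr (_ * _); rewrite [LHS]ptensM mulr1.
Qed.

Lemma ext_scale1 : left_id 1 ext_scale.
Proof. exact: mul1r. Qed.

Lemma ext_scaleDr : right_distributive ext_scale +%R.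
Proof. by move=> s x y; apply: mulrDr. Qed.

Lemma ext_scaleDl x : {morph ext_scale^~ x : s s' / s + s'}.
Proof. by move=> s s'; rewrite /ext_scale -mulrDl -ptensDr. Qed.

HB.instance Definition _ := GRing.Zmodule_isLmodule.Build S ext_scalars
  ext_scaleA ext_scale1 ext_scaleDr ext_scaleDl.

Lemma ext_scaleAl (s : S) (x y : ext_scalars) : s *: (x * y) = (s *: x) * y.
Proof. exact: mulrA. Qed.

HB.instance Definition _ := GRing.Lmodule_isLalgebra.Build S ext_scalars
  ext_scaleAl.

Lemma ext_scaleAr (s : S) (x y : ext_scalars) : s *: (x * y) = x * (s *: y).
Proof.
rewrite /GRing.scale /= /ext_scale !mulrA; congr (_ * _).
elim/ext_ind: x => [|a s'|x x' IHx IHx']; first by rewrite mulr0 mul0r.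
  by rewrite [LHS]ptensM [RHS]ptensM mul1r mulr1 mulrC.
by rewrite mulrDr mulrDl IHx IHx'.
Qed.

HB.instance Definition _ := GRing.Lalgebra_isAlgebra.Build S ext_scalars
  ext_scaleAr.

(* Inverses are chosen classically so that the library's integer powers can be
   used. *)
Definition ext_unit : pred ext_scalars :=
  fun x => `[< exists y, y * x = 1 /\ x * y = 1 >].

Definition ext_inv (x : ext_scalars) : ext_scalars :=
  match pselect (exists y, y * x = 1 /\ x * y = 1) with
  | left ex => projT1 (cid ex)
  | right _ => x
  end.

Lemma ext_mulVr : {in ext_unit, left_inverse 1 ext_inv *%R}.
Proof.
move=> x /asboolP ex; rewrite /ext_inv; case: pselect => // ex'.
by case: (projT2 (cid ex')).
Qed.

Lemma ext_mulrV : {in ext_unit, right_inverse 1 ext_inv *%R}.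
Proof.
move=> x /asboolP ex; rewrite /ext_inv; case: pselect => // ex'.
by case: (projT2 (cid ex')).
Qed.

Lemma ext_unitP x y : y * x = 1 /\ x * y = 1 -> ext_unit x.
Proof. by move=> ?; apply/asboolP; exists y. Qed.

Lemma ext_inv_out : {in [predC ext_unit], ext_inv =1 id}.
Proof. by move=> x /asboolP nex; rewrite /ext_inv; case: pselect. Qed.

HB.instance Definition _ := GRing.NzRing_hasMulInverse.Build ext_scalars
  ext_mulVr ext_mulrV ext_unitP ext_inv_out.

End ExtendScalars.

(* The free algebra on B, i.e. the tensor algebra of the vector space with
   basis B. *)
Section FreeAlgebra.
Context (K : comNzRingType) (B : choiceType).

Definition free_algebra : Type := {malg K[{fmonom B}]}.
HB.instance Definition _ := GRing.Lalgebra.on free_algebra.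

Definition free_gen (b : B) : free_algebra := << fmu b >>.

Lemma free_scaleAr (r : K) (x y : free_algebra) : r *: (x * y) = x * (r *: y).
Proof.
apply/malgP=> k; rewrite mcoeffZ mcoeffMl mulr_sumr.
rewrite (mcoeffMlw _ (finmap.fsubset_refl _) (msuppZ_le _ _)).
apply: eq_bigr => k1 _; rewrite mulr_sumr; apply: eq_bigr => k2 _.
by rewrite mcoeffZ mulrnAr mulrCA.
Qed.

HB.instance Definition _ := GRing.Lalgebra_isAlgebra.Build K free_algebra
  free_scaleAr.

Definition free_aug : free_algebra -> K := mcoeff (@mone {fmonom B}).

Lemma free_aug_zmod : zmod_morphism free_aug.
Proof. exact: (rmorphB (mcoeff (@mone {fmonom B}) : {rmorphism _ -> K})). Qed.

Lemma free_aug_monoid : monoid_morphism free_aug.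
Proof.
split; first exact: (rmorph1 (mcoeff (@mone {fmonom B}) : {rmorphism _ -> K})).
exact: (rmorphM (mcoeff (@mone {fmonom B}) : {rmorphism _ -> K})).
Qed.

HB.instance Definition _ :=
  GRing.isZmodMorphism.Build free_algebra K free_aug free_aug_zmod.
HB.instance Definition _ :=
  GRing.isMonoidMorphism.Build free_algebra K free_aug free_aug_monoid.

Lemma free_augZ_gen r b : free_aug (r *: free_gen b) = 0.
Proof.
by rewrite /free_aug [LHS]mcoeffZ mcoeffU1 -fdeg_eq0 fdegU mulr0.
Qed.

End FreeAlgebra.

Section IdealQuotient.
Context {K : comNzRingType} (A : algType K) (G : A -> Prop).

Inductive ideal_gen : A -> Prop :=
| ideal_gen0 : ideal_gen 0
| ideal_genD x y : ideal_gen x -> ideal_gen y -> ideal_gen (x + y)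
| ideal_genM a g b : G g -> ideal_gen (a * g * b).

Lemma ideal_genMl a x : ideal_gen x -> ideal_gen (a * x).
Proof.
elim=> [|{}x y _ hx _ hy|b g c Gg]; rewrite ?mulr0 ?mulrDr ?mulrA.
- exact: ideal_gen0.
- exact: ideal_genD.
- exact: ideal_genM.
Qed.

Lemma ideal_genMr a x : ideal_gen x -> ideal_gen (x * a).
Proof.
elim=> [|{}x y _ hx _ hy|b g c Gg]; rewrite ?mul0r ?mulrDl -?mulrA.
- exact: ideal_gen0.
- exact: ideal_genD.
- by rewrite mulrA; apply: ideal_genM.
Qed.

Lemma ideal_genN x : ideal_gen x -> ideal_gen (- x).
Proof. by rewrite -mulN1r; apply: ideal_genMl. Qed.

Definition ideal_eq : rel A := fun x y => `[< ideal_gen (x - y) >].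

Lemma ideal_eq_equiv : equiv_class_of ideal_eq.
Proof.
split=> [x|x y|y x z].
- by apply/asboolP; rewrite subrr; constructor.
- by apply/asboolP/asboolP => /ideal_genN; rewrite opprB.
- move=> /asboolP hxy /asboolP hyz; apply/asboolP.
  by rewrite -(subrKA y); apply: ideal_genD.
Qed.

Canonical ideal_equiv := EquivRelPack ideal_eq_equiv.

Definition ideal_quot := {eq_quot ideal_eq}.
HB.instance Definition _ := Choice.on ideal_quot.
HB.instance Definition _ := EqQuotient.on ideal_quot.

Definition quot_pi (x : A) : ideal_quot := \pi_ideal_quot x.

Lemma quot_piP x y : quot_pi x = quot_pi y <-> ideal_gen (x - y).
Proof. by split=> [/eqmodP/asboolP|h] //; apply/eqmodP/asboolP. Qed.

Lemma quot_ind (P : ideal_quot -> Prop) :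
  (forall x, P (quot_pi x)) -> forall x, P x.
Proof. by move=> h x; rewrite -(reprK x). Qed.

Lemma repr_quot x : ideal_gen (repr (quot_pi x) - x).
Proof. by apply/quot_piP; rewrite /quot_pi reprK. Qed.

Definition quot_add (x y : ideal_quot) := quot_pi (repr x + repr y).
Definition quot_opp (x : ideal_quot) := quot_pi (- repr x).
Definition quot_mul (x y : ideal_quot) := quot_pi (repr x * repr y).
Definition quot_scale (r : K) (x : ideal_quot) := quot_pi (r *: repr x).

Lemma quot_addE x y : quot_add (quot_pi x) (quot_pi y) = quot_pi (x + y).
Proof.
apply/quot_piP; rewrite opprD addrACA.
by apply: ideal_genD; apply: repr_quot.
Qed.

Lemma quot_oppE x : quot_opp (quot_pi x) = quot_pi (- x).
Proof. by apply/quot_piP; rewrite -opprD; apply/ideal_genN/repr_quot. Qed.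

Lemma quot_mulE x y : quot_mul (quot_pi x) (quot_pi y) = quot_pi (x * y).
Proof.
apply/quot_piP; rewrite -(subrKA (x * repr (quot_pi y))) -mulrBl -mulrBr.
apply: ideal_genD; first exact/ideal_genMr/repr_quot.
exact/ideal_genMl/repr_quot.
Qed.

Lemma quot_scaleE r x : quot_scale r (quot_pi x) = quot_pi (r *: x).
Proof.
apply/quot_piP; rewrite -scalerBr -[_ - _]mul1r scalerAl.
exact/ideal_genMl/repr_quot.
Qed.

Lemma quot_addA : associative quot_add.
Proof.
move=> x y z; elim/quot_ind: x => x; elim/quot_ind: y => y.
by elim/quot_ind: z => z; rewrite !quot_addE addrA.
Qed.

Lemma quot_addC : commutative quot_add.
Proof.
move=> x y; elim/quot_ind: x => x; elim/quot_ind: y => y.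
by rewrite !quot_addE addrC.
Qed.

Lemma quot_add0 : left_id (quot_pi 0) quot_add.
Proof. by move=> x; elim/quot_ind: x => x; rewrite quot_addE add0r. Qed.

Lemma quot_addN : left_inverse (quot_pi 0) quot_opp quot_add.
Proof.
by move=> x; elim/quot_ind: x => x; rewrite quot_oppE quot_addE addNr.
Qed.

HB.instance Definition _ := GRing.isZmodule.Build ideal_quot
  quot_addA quot_addC quot_add0 quot_addN.

Lemma quot_mulA : associative quot_mul.
Proof.
move=> x y z; elim/quot_ind: x => x; elim/quot_ind: y => y.
by elim/quot_ind: z => z; rewrite !quot_mulE mulrA.
Qed.

Lemma quot_mul1l : left_id (quot_pi 1) quot_mul.
Proof. by move=> x; elim/quot_ind: x => x; rewrite quot_mulE mul1r. Qed.

Lemma quot_mul1r : right_id (quot_pi 1) quot_mul.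
Proof. by move=> x; elim/quot_ind: x => x; rewrite quot_mulE mulr1. Qed.

Lemma quot_mulDl : left_distributive quot_mul quot_add.
Proof.
move=> x y z; elim/quot_ind: x => x; elim/quot_ind: y => y.
by elim/quot_ind: z => z; rewrite !(quot_addE, quot_mulE) mulrDl.
Qed.

Lemma quot_mulDr : right_distributive quot_mul quot_add.
Proof.
move=> x y z; elim/quot_ind: x => x; elim/quot_ind: y => y.
by elim/quot_ind: z => z; rewrite !(quot_addE, quot_mulE) mulrDr.
Qed.

(* The ideal may be the whole of A. *)
HB.instance Definition _ := GRing.Zmodule_isPzRing.Build ideal_quot
  quot_mulA quot_mul1l quot_mul1r quot_mulDl quot_mulDr.

Lemma quot_scaleA r s x :
  quot_scale r (quot_scale s x) = quot_scale (r * s) x.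
Proof. by elim/quot_ind: x => x; rewrite !quot_scaleE scalerA. Qed.

Lemma quot_scale1 : left_id 1 quot_scale.
Proof. by move=> x; elim/quot_ind: x => x; rewrite quot_scaleE scale1r. Qed.

Lemma quot_scaleDr : right_distributive quot_scale +%R.
Proof.
move=> r x y; elim/quot_ind: x => x; elim/quot_ind: y => y.
rewrite [quot_pi x + quot_pi y]quot_addE !quot_scaleE scalerDr.
by rewrite [RHS]quot_addE.
Qed.

Lemma quot_scaleDl x : {morph quot_scale^~ x : r s / r + s}.
Proof.
move=> r s; elim/quot_ind: x => x.
by rewrite !quot_scaleE scalerDl [RHS]quot_addE.
Qed.

HB.instance Definition _ := GRing.Zmodule_isLmodule.Build K ideal_quot
  quot_scaleA quot_scale1 quot_scaleDr quot_scaleDl.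

Lemma quot_scaleAl (r : K) (x y : ideal_quot) : r *: (x * y) = (r *: x) * y.
Proof.
elim/quot_ind: x => x; elim/quot_ind: y => y.
rewrite [quot_pi x * _]quot_mulE [LHS]quot_scaleE.
by rewrite [r *: quot_pi x]quot_scaleE [RHS]quot_mulE scalerAl.
Qed.

Lemma quot_scaleAr (r : K) (x y : ideal_quot) : r *: (x * y) = x * (r *: y).
Proof.
elim/quot_ind: x => x; elim/quot_ind: y => y.
rewrite [quot_pi x * _]quot_mulE [LHS]quot_scaleE.
by rewrite [r *: quot_pi y]quot_scaleE [RHS]quot_mulE scalerAr.
Qed.

End IdealQuotient.

Section JacobsonWitt.
Context (K : fieldType) (p n : nat).

(* The multi-indices 0 <= alpha <= tau, and all exponent vectors in Z^n. *)
Definition midx := {ffun 'I_n -> 'I_p}.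
Definition mexp := {ffun 'I_n -> int}.
Definition expo (alpha : midx) : mexp := [ffun i => (alpha i)%:Z].
Definition eps (i : 'I_n) : mexp := [ffun k => (k == i)%:Z].

(* O(n; 1) in coordinates with respect to the basis x^(alpha). *)
Definition div_pow := {ffun midx -> K^o}.

(* x^(a) vanishes unless 0 <= a <= tau. *)
Definition xpow (a : mexp) : div_pow := [ffun beta => (expo beta == a)%:R].

Definition omul (f g : div_pow) : div_pow :=
  \sum_(alpha : midx) \sum_(beta : midx)
    (f alpha * g beta * (\prod_(i < n) 'C(alpha i + beta i, alpha i))%:R)
      *: xpow (expo alpha + expo beta).

Definition oder (j : 'I_n) (f : div_pow) : div_pow :=
  \sum_(alpha : midx) f alpha *: xpow (expo alpha - eps j).

(* W(n; 1), the derivation \sum_j f_j D_j being represented by j |-> f_j. *)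
Definition witt := {ffun 'I_n -> div_pow}.

Definition wmon (a : mexp) (i : 'I_n) : witt :=
  [ffun j => if j == i then xpow a else 0].

Definition wact (w : witt) (f : div_pow) : div_pow :=
  \sum_(i < n) omul (w i) (oder i f).

Definition wbrk (w w' : witt) : witt :=
  [ffun j => wact w (w' j) - wact w' (w j)].

Definition hW (k : 'I_n) : witt := wmon (eps k) k.
Definition eW (k : 'I_n) : witt := 2%:R *: wmon (eps k *+ 2) k.

Definition divad (k : 'I_n) (s : nat) (w : witt) : witt :=
  (s`!%:R)^-1 *: iter s (wbrk (eW k)) w.

Definition divadI (m : midx) : witt -> witt :=
  \big[comp/id]_(k < n) divad k (m k).

Let T := free_algebra K (midx * 'I_n)%type.

Definition tens_witt (w : witt) : T :=
  \sum_(i < n) \sum_(alpha : midx) w i alpha *: free_gen K (alpha, i).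

(* u(W(n; 1)) as a quotient of the tensor algebra: restr_brk generates the
   kernel of T(W) -> U(W), the other two families generate I'. *)
Inductive restr_rel : T -> Prop :=
| restr_brk w w' : restr_rel
    (tens_witt w * tens_witt w' - tens_witt w' * tens_witt w
     - tens_witt (wbrk w w'))
| restr_toral alpha i : expo alpha = eps i -> restr_rel
    (tens_witt (wmon (expo alpha) i) ^+ p - tens_witt (wmon (expo alpha) i))
| restr_nil alpha i : expo alpha <> eps i -> restr_rel
    (tens_witt (wmon (expo alpha) i) ^+ p).

Definition restr_env := ideal_quot restr_rel.
HB.instance Definition _ := GRing.PzRing.on restr_env.
HB.instance Definition _ := GRing.Lmodule.on restr_env.

Lemma restr_env_neq0 : (1 : restr_env) != 0.
Proof.
pose c : {rmorphism T -> K} := @free_aug K (midx * 'I_n)%type.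
have cw w : c (tens_witt w) = 0.
  rewrite rmorph_sum big1 // => i _; rewrite rmorph_sum big1 // => alpha _.
  exact: free_augZ_gen.
have cp (alpha : midx) (i : 'I_n) w : c (tens_witt w ^+ p) = 0.
  have p_gt0 : (0 < p)%N by apply: leq_ltn_trans (ltn_ord (alpha i)).
  by rewrite rmorphXn cw expr0n eqn0Ngt p_gt0.
have brk0 (x y z : T) : c x = 0 -> c y = 0 -> c z = 0 ->
  c (x * y - y * x - z) = 0.
  by move=> x0 y0 z0; rewrite !rmorphB !rmorphM x0 y0 z0 mul0r !subr0.
have toral0 (x y : T) : c x = 0 -> c y = 0 -> c (x - y) = 0.
  by move=> x0 y0; rewrite rmorphB x0 y0 subr0.
apply/eqP => /quot_piP; rewrite subr0 => h1.
suff : c 1 = 0 by rewrite rmorph1; apply/eqP/oner_neq0.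
elim: h1 => [|x y _ hx _ hy|a g b Gg]; first exact: rmorph0.
  by rewrite rmorphD hx hy addr0.
rewrite !rmorphM; suff -> : c g = 0 by rewrite mulr0 mul0r.
case: Gg => [w w'|alpha i _|alpha i _]; last exact: cp.
  by apply: brk0; apply: cw.
by apply: toral0; [apply: cp | apply: cw].
Qed.

HB.instance Definition _ :=
  GRing.PzSemiRing_isNonZero.Build restr_env restr_env_neq0.
HB.instance Definition _ := GRing.Lmodule_isLalgebra.Build K restr_env
  (@quot_scaleAl _ _ restr_rel).
HB.instance Definition _ := GRing.Lalgebra_isAlgebra.Build K restr_env
  (@quot_scaleAr _ _ restr_rel).

Definition uwitt (w : witt) : restr_env := quot_pi restr_rel (tens_witt w).

End JacobsonWitt.

Section Deformation.
Context (K : fieldType) (p n : nat) (q : K).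

(* K[t]_p^(q) is {poly %/ tpoly}, with t the class 'qX. The quotient is taken in
   K[t]: in K[[t]] the factor t^(p-1) - q is a unit when q <> 0, so that
   K[[t]]/(t^p - q t) would be K. *)
Definition tpoly : {poly K} := 'X^p - q *: 'X.

Definition utq : Type := ext_scalars (restr_env K p n) tpoly.
HB.instance Definition _ := GRing.UnitRing.on utq.
HB.instance Definition _ := GRing.Algebra.on utq.

Definition wu (w : witt K p n) : utq := uwitt w \ox (1 : {poly %/ tpoly}).
Definition tq : {poly %/ tpoly} := 'qX.

Definition rising (x : utq) (a s : nat) : utq := \prod_(j < s) (x + (a + j)%:R).

(* (1 - e(I) t)^a; each factor is a unit because e(k)^p = 0. *)
Definition one_sub_et (a : mexp n) : utq :=
  \prod_(k < n) (1 - tq *: wu (eW K p k)) ^ a k.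

Definition hI (a : nat) (m : midx p n) : utq :=
  \prod_(k < n) rising (wu (hW K p k)) a (m k).

Variable eta : {ffun 'I_n -> bool}.

Definition eta_mul (a : mexp n) : mexp n := [ffun k => (eta k : nat)%:Z * a k].

(* The vectors of the form eta l with 0 <= eta l <= eta tau. *)
Definition eta_below (m : midx p n) : bool :=
  [forall k, (m k <= eta k * p.-1)%N].

Definition mnorm (m : midx p n) : nat := \sum_(k < n) m k.

Definition coproduct_formula (alpha : midx p n) (i : 'I_n) : tens utq utq :=
  let x := wmon K p (expo alpha) i in
  wu x \ox one_sub_et (eta_mul (expo alpha - eps i))
  + \sum_(m : midx p n | eta_below m)
      (-1) ^+ mnorm m *:
        (hI 0 m \ox (tq ^+ mnorm m *:
                       (one_sub_et (- expo m) * wu (divadI m x)))).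

Definition antipode_formula (alpha : midx p n) (i : 'I_n) : utq :=
  let x := wmon K p (expo alpha) i in
  - (one_sub_et (- eta_mul (expo alpha - eps i))
     * \sum_(m : midx p n | eta_below m)
         tq ^+ mnorm m *: (wu (divadI m x) * hI 1 m)).

End Deformation.

Definition has_dim (K : fieldType) (V : lmodType K) (d : nat) :=
  exists f : {linear V -> 'rV[K]_d}, bijective f.

(* Main.v *)
Require Import Defs.
From HB Require Import structures.
From mathcomp Require Import all_boot all_order all_algebra ring.
From mathcomp Require monalg boolp.

Set Implicit Arguments.
Unset Strict Implicit.
Unset Printing Implicit Defensive.

Import Order.TTheory GRing.Theory Num.Theory.
Local Open Scope ring_scope.

(** The deformation is a Drinfeld twist. Write A for utq and S for the ring
    {poly %/ tpoly p q}. Since A is presented by generators and relations, it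
    is a Hopf algebra in which W(n;1) is primitive (utq_hopf). A twist by an
    invertible F in A (x) A changes the coproduct to F D F^-1 and the antipode
    to v S v^-1, and it keeps the multiplication and the counit; the cocycle
    identity for F is the essential condition (drinfeld_twist).

    The elements h_k = x^(eps_k) D_k are toral: h_k ^+ p = h_k. Hence
    P_j = prod_k (1 - (h_k - j_k) ^+ p.-1), for j in F_p^n, are orthogonal
    idempotents with sum 1. The elements g_k = 1 - t eta_k e_k satisfy
    g_k ^+ p = 1, because e_k ^+ p = 0, so that G_j = prod_k g_k ^+ j_k depends only on j
    modulo p. The twist is F = sum_j P_j (x) G_j. For such an F the cocycle
    identity reduces to the fact that the G_j become group-like for the
    twisted coproduct (group_twist), and this holds since [h_k, e_k] = e_k
    (grouplike_gfac). Taking eta_k e_k instead of e_k treats all 2^n twists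
    at once: the terms of the formulas with eta_k = 0 and l_k > 0 contain a
    commutator with 0.

    The formulas come from one computation: right multiplication by g_k is the
    sum of two commuting operators, left multiplication by g_k and t ad e_k, so
    that x G_m has a binomial expansion (expand_right). For m = - j the
    coefficients are, up to sign and factorials, rising factorials of j, and on
    the range of P_j these are the values of the rising factorials of the h_k
    (twisted_coproduct). For the antipode the inverse of v is rewritten as
    sum_j S(G_(- j - 1)) P_j, where the shift by 1 turns h^<l> into h_1^<l>
    (twisted_antipode).

    The dimension is a Poincare-Birkhoff-Witt theorem. Reordering shows that
    the ordered monomials with exponents below p span. They are independent
    because (phi (x) id) D, for a functional phi dual to a generator, acts on
    words as a partial derivative up to shorter words (slice_dual_word,
    mon_free); these functionals are matrix entries of the natural action on the
    divided power algebra (utq_functional). The same functionals show that D_1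
    does not vanish, hence that A is not commutative, and that the skew term
    t h_k (x) e_k g_k^-1 of the twisted coproduct of h_k is not symmetric when p > 2 and eta_k = 1. *)

(** * Maps out of tensor products *)

Section LinearFunctions.
Context (R : pzRingType) (U V : lmodType R) (f : U -> V).
Hypothesis flin : linear f.

Lemma linear_fun0 : f 0 = 0.
Proof. by have := flin (-1) 0 0; rewrite addr0 scaler0 scaleN1r addNr. Qed.

Lemma linear_funZ r x : f (r *: x) = r *: f x.
Proof. by have := flin r x 0; rewrite linear_fun0 !addr0. Qed.

Lemma linear_funD x y : f (x + y) = f x + f y.
Proof. by have := flin 1 x y; rewrite !scale1r. Qed.

Lemma linear_fun_sum (I : Type) (r : seq I) (P : pred I) (F : I -> U) :
  f (\sum_(i <- r | P i) F i) = \sum_(i <- r | P i) f (F i).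
Proof. exact: (big_morph f linear_funD linear_fun0). Qed.

End LinearFunctions.

Section TensorMaps.
Context {R : comNzRingType}.

Definition bilinear_map (A B M : lmodType R) (f : A -> B -> M) :=
  (forall b, linear (f^~ b)) /\ (forall a, linear (f a)).

Section Lift.
Context (A B : lmodType R).

Lemma bilinear_balanced (M : lmodType R) (f : A -> B -> M) :
  bilinear_map f -> balanced f.
Proof.
move=> [fl fr]; split=> [a a' b|a b b'|r a b].
- exact: (linear_funD (fl b)).
- exact: (linear_funD (fr a)).
- by rewrite (linear_funZ (fl b)) (linear_funZ (fr a)).
Qed.

Lemma tlift_sum (M : zmodType) (f : A -> B -> M) (I : Type) (r : seq I)
    (P : pred I) (F : I -> tens A B) : balanced f ->
  tlift f (\sum_(i <- r | P i) F i) = \sum_(i <- r | P i) tlift f (F i).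
Proof. by move=> bf; apply: (big_morph _ (tliftD bf) (tlift0 bf)). Qed.

Lemma tlift_linear (M : lmodType R) (f : A -> B -> M) :
  bilinear_map f -> linear (tlift f).
Proof.
move=> bf; have hf := bilinear_balanced bf; case: bf => fl _ r.
suff fZ (x : tens A B) : tlift f (r *: x) = r *: tlift f x.
  by move=> x y; rewrite tliftD // fZ.
elim/(@tens_ind R A B): x => [|a b|x x' IHx IHx'].
- by rewrite scaler0 tlift0 // scaler0.
- by rewrite -ptensZl !tlift_ptens // (linear_funZ (fl b)).
- by rewrite scalerDr !tliftD // IHx IHx' scalerDr.
Qed.

Lemma tens_eq_additive (M : zmodType) (f g : tens A B -> M) :
  {morph f : x y / x + y} -> {morph g : x y / x + y} ->
  (forall a b, f (a \ox b) = g (a \ox b)) -> f =1 g.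
Proof.
have z (h : tens A B -> M) : {morph h : x y / x + y} -> h 0 = 0.
  by move=> hD; apply: (addrI (h 0)); rewrite -hD !addr0.
move=> fD gD fg x; elim/(@tens_ind R A B): x => [|//|x y IHx IHy]; first by rewrite !z.
by rewrite fD gD IHx IHy.
Qed.

Lemma ptens0l (b : B) : (0 : A) \ox b = 0.
Proof. by rewrite -(scale0r 0) ptensZl scale0r. Qed.

Lemma ptens0r (a : A) : a \ox (0 : B) = 0.
Proof. by rewrite -(scale0r 0) ptensZr scale0r. Qed.

Lemma ptens_suml (I : Type) (r : seq I) (P : pred I) (F : I -> A) (b : B) :
  (\sum_(i <- r | P i) F i) \ox b = \sum_(i <- r | P i) (F i \ox b).
Proof.
by apply: (big_morph (fun a => a \ox b)) => [x y|]; rewrite ?ptensDl ?ptens0l.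
Qed.

Lemma ptens_sumr (I : Type) (r : seq I) (P : pred I) (F : I -> B) (a : A) :
  a \ox (\sum_(i <- r | P i) F i) = \sum_(i <- r | P i) (a \ox F i).
Proof.
by apply: (big_morph (fun b => a \ox b)) => [x y|]; rewrite ?ptensDr ?ptens0r.
Qed.

Lemma ptensNr (a : A) (b : B) : a \ox (- b) = - (a \ox b).
Proof. by rewrite -scaleN1r ptensZr scaleN1r. Qed.

Lemma ptensNl (a : A) (b : B) : (- a) \ox b = - (a \ox b).
Proof. by rewrite -scaleN1r ptensZl scaleN1r. Qed.

Lemma ptensBl (a a' : A) (b : B) : (a - a') \ox b = a \ox b - a' \ox b.
Proof. by rewrite ptensDl ptensNl. Qed.

Lemma ptensBr (a : A) (b b' : B) : a \ox (b - b') = a \ox b - a \ox b'.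
Proof. by rewrite ptensDr ptensNr. Qed.

End Lift.

Section LiftRing.
Context (A B : algType R).

Lemma tlift_monoid_morphism (C : pzRingType) (f : A -> B -> C) :
  balanced f -> f 1 1 = 1 ->
  (forall a b a' b', f (a * a') (b * b') = f a b * f a' b') ->
  monoid_morphism (tlift f).
Proof.
move=> bf f1 fM; split; first by rewrite tlift_ptens.
move=> x y; elim/(@tens_ind R A B): x => [|a b|x x' IHx IHx'].
- by rewrite mul0r tlift0 // mul0r.
- elim/(@tens_ind R A B): y => [|a' b'|y y' IHy IHy'].
  + by rewrite mulr0 tlift0 // mulr0.
  + by rewrite ptensM !tlift_ptens.
  + by rewrite mulrDr !tliftD // IHy IHy' mulrDr.
- by rewrite mulrDl !tliftD // IHx IHx' mulrDl.
Qed.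

Lemma additive_monoid_morphism (C : pzRingType) (f : tens A B -> C) :
  {morph f : x y / x + y} -> f (1 \ox 1) = 1 ->
  (forall a b a' b', f ((a * a') \ox (b * b')) = f (a \ox b) * f (a' \ox b')) ->
  monoid_morphism f.
Proof.
move=> fD f1 fM; split=> // x y.
have f0 : f 0 = 0 by apply: (addrI (f 0)); rewrite -fD !addr0.
elim/(@tens_ind R A B): x => [|a b|x x' IHx IHx'].
- by rewrite mul0r f0 mul0r.
- elim/(@tens_ind R A B): y => [|a' b'|y y' IHy IHy'].
  + by rewrite mulr0 f0 mulr0.
  + by rewrite ptensM fM.
  + by rewrite mulrDr !fD IHy IHy' mulrDr.
- by rewrite mulrDl !fD IHx IHx' mulrDl.
Qed.

Lemma ptensX (a : A) (b : B) k : (a \ox b) ^+ k = (a ^+ k) \ox (b ^+ k).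
Proof. by elim: k => // k IH; rewrite !exprS IH ptensM. Qed.

End LiftRing.

Section Tmap.
Context (A A' B B' : lmodType R) (f : {linear A -> A'}) (g : {linear B -> B'}).

Lemma tmap_bilinear : bilinear_map (fun a b => f a \ox g b).
Proof.
by split=> [b r a a'|a r b b'];
  rewrite linearP ?ptensDl ?ptensZl ?ptensDr ?ptensZr.
Qed.

Lemma tmapE a b : tmap f g (a \ox b) = f a \ox g b.
Proof. exact/tlift_ptens/bilinear_balanced/tmap_bilinear. Qed.

Lemma tmap_linear : linear (tmap f g).
Proof. exact/tlift_linear/tmap_bilinear. Qed.

HB.instance Definition _ :=
  GRing.isLinear.Build R (tens A B) (tens A' B') _ (tmap f g) tmap_linear.

End Tmap.

Section Tassoc.
Context (A B C : lmodType R).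

Lemma tassoc_bilinear1 (c : C) : 
  bilinear_map (fun (a : A) (b : B) => a \ox (b \ox c)).
Proof.
split=> [b r a a'|a r b b']; first by rewrite ptensDl ptensZl.
by rewrite ptensDl ptensZl ptensDr ptensZr.
Qed.

Lemma tassoc_bilinear2 :
  bilinear_map (fun (x : tens A B) (c : C) => tlift (fun a b => a \ox (b \ox c)) x).
Proof.
have bal c := bilinear_balanced (tassoc_bilinear1 c).
split=> [c|x r c c']; first exact/tlift_linear/tassoc_bilinear1.
elim/(@tens_ind R A B): x => [|a b|x x' IHx IHx'].
- by rewrite !tlift0 // scaler0 addr0.
- by rewrite !tlift_ptens // !ptensDr !ptensZr.
- by rewrite !tliftD // IHx IHx' scalerDr addrACA.
Qed.

Lemma tassocE (a : A) (b : B) (c : C) :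
  tassoc ((a \ox b) \ox c) = a \ox (b \ox c).
Proof.
rewrite /tassoc tlift_ptens; last exact/bilinear_balanced/tassoc_bilinear2.
by rewrite tlift_ptens //; apply/bilinear_balanced/tassoc_bilinear1.
Qed.

Lemma tassoc_linear : linear (@tassoc R A B C).
Proof. exact/tlift_linear/tassoc_bilinear2. Qed.

HB.instance Definition _ := GRing.isLinear.Build R
  (tens (tens A B) C) (tens A (tens B C)) _ (@tassoc R A B C) tassoc_linear.

End Tassoc.

Section Tswap.
Context (A B : lmodType R).

Lemma tswapE (a : A) (b : B) : tswap (a \ox b) = b \ox a.
Proof.
rewrite /tswap tlift_ptens //; apply/bilinear_balanced.
by split=> [b' r a' a''|a' r b' b''];
  rewrite ?ptensDl ?ptensZl ?ptensDr ?ptensZr.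
Qed.

Lemma tswapD : {morph @tswap R A B : x y / x + y}.
Proof.
apply/tliftD/bilinear_balanced.
by split=> [b' r a' a''|a' r b' b''];
  rewrite ?ptensDl ?ptensZl ?ptensDr ?ptensZr.
Qed.

End Tswap.

End TensorMaps.

(** * Twisting a Hopf algebra *)

(** The tensor square of an augmented algebra is nonzero, which is what makes
    it an algebra in its own right; the augmentation is recorded in the type. *)
Section TensorSquare.
Context {R : comNzRingType} (A : algType R).

Definition tsquare of {lrmorphism A -> R^o} := tens A A.

Variable eps : {lrmorphism A -> R^o}.

HB.instance Definition _ := GRing.PzRing.on (tsquare eps).
HB.instance Definition _ := GRing.Lmodule.on (tsquare eps).

Lemma aug_bilinear :
  @bilinear_map R A A R^o (fun a b => (eps a : R) * (eps b : R)).
Proof.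
split=> [b r a a'|a r b b']; rewrite linearP /=.
  by rewrite mulrDl scalerAl.
by rewrite mulrDr /GRing.scale /= mulrCA.
Qed.

Lemma tsquare_neq0 : (1 : tsquare eps) != 0.
Proof.
have bal := bilinear_balanced aug_bilinear.
apply/eqP => /(congr1 (tlift (fun a b => (eps a : R) * (eps b : R)))).
rewrite [1](_ : _ = (1 : A) \ox (1 : A)) // tlift_ptens // [RHS]tlift0 //.
by rewrite rmorph1 mulr1; apply/eqP/oner_neq0.
Qed.

HB.instance Definition _ := GRing.PzSemiRing_isNonZero.Build (tsquare eps) tsquare_neq0.
HB.instance Definition _ := GRing.Lmodule_isLalgebra.Build R (tsquare eps)
  (@tens_scaleAl R A A).
HB.instance Definition _ := GRing.Lalgebra_isAlgebra.Build R (tsquare eps)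
  (@tens_scaleAr R A A).

End TensorSquare.

(** ** The triple tensor product *)

Section TripleProduct.
Context {R : comNzRingType} (A : algType R) (eps : {lrmorphism A -> R^o}).
Local Notation A3 := (tens A (tsquare eps)).

Definition leg12 (z : tens A A) : A3 := tassoc (z \ox (1 : A)).
Definition leg23 (z : tens A A) : A3 := (1 : A) \ox (z : tsquare eps).

(** The two extensions take values in the same triple product, where they are
    multiplied with the legs of a twist. *)
Definition lext (f : A -> tens A A) (z : tens A A) : A3 := tassoc (tmap f id z).
Definition rext (f : A -> tens A A) (z : tens A A) : A3 := tmap id f z.

Lemma tassoc_mul (u u' : tens A A) (c c' : A) :
  (tassoc ((u * u') \ox (c * c')) : A3) =
  (tassoc (u \ox c) : A3) * (tassoc (u' \ox c') : A3).
Proof.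
elim/(@tens_ind R A A): u => [|a b|x x' IHx IHx'].
- by rewrite mul0r !ptens0l !raddf0 mul0r.
- elim/(@tens_ind R A A): u' => [|a' b'|y y' IHy IHy'].
  + by rewrite mulr0 !ptens0l !raddf0 mulr0.
  + by rewrite ptensM !tassocE [RHS]ptensM [X in _ = _ \ox X]ptensM.
  + by rewrite mulrDr !ptensDl !raddfD /= IHy IHy' mulrDr.
- by rewrite mulrDl !ptensDl !raddfD /= IHx IHx' mulrDl.
Qed.

Lemma leg23M : {morph leg23 : z z' / z * z'}.
Proof. by move=> z z'; rewrite /leg23 [RHS]ptensM mulr1. Qed.

Section Extensions.
Variable f : {linear A -> tens A A}.

Lemma lextE a b : lext f (a \ox b) = tassoc (f a \ox b).
Proof. by rewrite /lext (tmapE f idfun). Qed.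

Lemma rextE a b : rext f (a \ox b) = a \ox (f b : tsquare eps).
Proof. by rewrite /rext (tmapE idfun f). Qed.

Lemma lextD : {morph lext f : x y / x + y}.
Proof. by move=> x y; rewrite /lext (raddfD (tmap f idfun)) raddfD. Qed.

Lemma rextD : {morph rext f : x y / x + y}.
Proof. by move=> x y; rewrite /rext (raddfD (tmap idfun f)). Qed.

Lemma lextZ r z : lext f (r *: z) = r *: (lext f z : tens A (tens A A)).
Proof.
rewrite /lext (linear_funZ (@tmap_linear R _ _ _ _ f idfun)).
exact: (linear_funZ (@tassoc_linear R A A A)).
Qed.

Lemma rextZ r z : rext f (r *: z) = r *: (rext f z : tens A (tens A A)).
Proof. exact: (linear_funZ (@tmap_linear R _ _ _ _ idfun f)). Qed.

End Extensions.

Lemma lextM (f : {lrmorphism A -> tens A A}) : monoid_morphism (lext f).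
Proof.
apply: additive_monoid_morphism; first exact: lextD.
  by rewrite lextE rmorph1 tassocE.
by move=> a b a' b'; rewrite !lextE rmorphM tassoc_mul.
Qed.

Lemma rextM (f : {lrmorphism A -> tens A A}) : monoid_morphism (rext f).
Proof.
apply: additive_monoid_morphism; first exact: rextD.
  by rewrite rextE rmorph1.
by move=> a b a' b'; rewrite !rextE rmorphM [RHS]ptensM.
Qed.

Lemma counitl_bilinear : @bilinear_map R A A A (fun a b => eps a *: b).
Proof.
split=> [b r a a'|a r b b']; first by rewrite linearP /= scalerDl scalerA.
by rewrite scalerDr !scalerA mulrC.
Qed.

Lemma counitr_bilinear : @bilinear_map R A A A (fun a b => eps b *: a).
Proof.
split=> [b r a a'|a r b b']; first by rewrite scalerDr !scalerA mulrC.
by rewrite linearP /= scalerDl scalerA.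
Qed.

Definition counitl_balanced := bilinear_balanced counitl_bilinear.
Definition counitr_balanced := bilinear_balanced counitr_bilinear.

Lemma counitl_monoid_morphism : monoid_morphism (tlift (fun a b : A => eps a *: b)).
Proof.
apply: (tlift_monoid_morphism counitl_balanced) => [|a b a' b'].
  by rewrite rmorph1 scale1r.
by rewrite rmorphM -scalerAl -scalerAr scalerA.
Qed.

Lemma counitr_monoid_morphism : monoid_morphism (tlift (fun a b : A => eps b *: a)).
Proof.
apply: (tlift_monoid_morphism counitr_balanced) => [|a b a' b'].
  by rewrite rmorph1 scale1r.
by rewrite rmorphM -scalerAl -scalerAr scalerA.
Qed.

End TripleProduct.

Section Twist.
Context {R : comNzRingType} (A : algType R) (H : hopf_structure A).
Local Notation D := (coproduct H).
Local Notation eps := (counit H).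
Local Notation S := (antipode H).
Local Notation A3 := (tens A (tsquare eps)).
Local Notation leg12 := (leg12 eps).
Local Notation leg23 := (leg23 eps).
Local Notation lext := (lext eps).
Local Notation rext := (rext eps).

Hypothesis S1 : S 1 = 1.
Hypothesis SM : forall x y : A, S (x * y) = S y * S x.

(** For y = 1 these are the convolution products S * id and id * S, evaluated at
    a tensor; at a twist they give the elements that conjugate the antipode. *)
Definition lconv (y : A) : tens A A -> A := tlift (fun a b => S a * y * b).
Definition rconv (y : A) : tens A A -> A := tlift (fun a b => a * y * S b).

Lemma lconv_bilinear y : bilinear_map (fun a b : A => S a * y * b).
Proof.
split=> [b r a a'|a r b b'].
  by rewrite linearP /= !mulrDl -!scalerAl.
by rewrite mulrDr -!scalerAr.
Qed.

Lemma rconv_bilinear y : bilinear_map (fun a b : A => a * y * S b).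
Proof.
split=> [b r a a'|a r b b'].
  by rewrite !mulrDl -!scalerAl.
by rewrite linearP /= mulrDr -!scalerAr.
Qed.

Let lbal y := bilinear_balanced (lconv_bilinear y).
Let rbal y := bilinear_balanced (rconv_bilinear y).

Lemma lconvE y a b : lconv y (a \ox b) = S a * y * b.
Proof. exact: tlift_ptens. Qed.

Lemma rconvE y a b : rconv y (a \ox b) = a * y * S b.
Proof. exact: tlift_ptens. Qed.

HB.instance Definition _ y := GRing.isLinear.Build R (tens A A) A _ (lconv y)
  (tlift_linear (lconv_bilinear y)).
HB.instance Definition _ y := GRing.isLinear.Build R (tens A A) A _ (rconv y)
  (tlift_linear (rconv_bilinear y)).

Lemma lconvD y y' z : lconv (y + y') z = lconv y z + lconv y' z.
Proof.
elim/(@tens_ind R A A): z => [|a b|z z' IH IH']; rewrite ?raddf0 ?addr0 //.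
  by rewrite !lconvE mulrDr mulrDl.
by rewrite !raddfD /= IH IH' addrACA.
Qed.

Lemma rconvD y y' z : rconv (y + y') z = rconv y z + rconv y' z.
Proof.
elim/(@tens_ind R A A): z => [|a b|z z' IH IH']; rewrite ?raddf0 ?addr0 //.
  by rewrite !rconvE mulrDr mulrDl.
by rewrite !raddfD /= IH IH' addrACA.
Qed.

Lemma lconv0 z : lconv 0 z = 0.
Proof. by apply: (addrI (lconv 0 z)); rewrite -lconvD !addr0. Qed.

Lemma rconv0 z : rconv 0 z = 0.
Proof. by apply: (addrI (rconv 0 z)); rewrite -rconvD !addr0. Qed.

(** Because the antipode reverses products, the two convolutions turn the
    product of the tensor square into composition. *)
Lemma lconvM y z z' : lconv y (z * z') = lconv (lconv y z) z'.
Proof.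
elim/(@tens_ind R A A): z => [|a b|z1 z2 IH1 IH2].
- by rewrite mul0r !raddf0 lconv0.
- elim/(@tens_ind R A A): z' => [|a' b'|z1 z2 IH1 IH2].
  + by rewrite mulr0 !raddf0.
  + by rewrite ptensM !lconvE SM !mulrA.
  + by rewrite mulrDr !raddfD /= IH1 IH2.
- by rewrite mulrDl !raddfD /= IH1 IH2 /= lconvD.
Qed.

Lemma rconvM y z z' : rconv y (z * z') = rconv (rconv y z') z.
Proof.
elim/(@tens_ind R A A): z => [|a b|z1 z2 IH1 IH2].
- by rewrite mul0r !raddf0.
- elim/(@tens_ind R A A): z' => [|a' b'|z1 z2 IH1 IH2].
  + by rewrite mulr0 !raddf0 rconv0.
  + by rewrite ptensM !rconvE SM !mulrA.
  + by rewrite mulrDr !raddfD /= IH1 IH2 rconvD.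
- by rewrite mulrDl !raddfD /= IH1 IH2.
Qed.

Lemma lconvZ r y z : lconv (r *: y) z = r *: lconv y z.
Proof.
elim/(@tens_ind R A A): z => [|a b|z z' IH IH']; rewrite ?raddf0 ?scaler0 //.
  by rewrite !lconvE -scalerAr -scalerAl.
by rewrite !raddfD /= IH IH'.
Qed.

Lemma rconvZ r y z : rconv (r *: y) z = r *: rconv y z.
Proof.
elim/(@tens_ind R A A): z => [|a b|z z' IH IH']; rewrite ?raddf0 ?scaler0 //.
  by rewrite !rconvE -scalerAr -scalerAl.
by rewrite !raddfD /= IH IH'.
Qed.

Lemma lconv1_coproduct x : lconv 1 (D x) = (eps x)%:A.
Proof.
have bal : balanced (fun a b : A => S a * b).
  split=> [a a' b|a b b'|r a b].
  - by rewrite raddfD mulrDl.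
  - by rewrite mulrDr.
  - by rewrite linearZ /= -scalerAl -scalerAr.
rewrite -(antipodel H).
apply: (@tens_eq_additive R A A A (lconv 1) _ (raddfD _) (tliftD bal)) => a b.
by rewrite lconvE mulr1 tlift_ptens.
Qed.

Lemma rconv1_coproduct x : rconv 1 (D x) = (eps x)%:A.
Proof.
have bal : balanced (fun a b : A => a * S b).
  split=> [a a' b|a b b'|r a b].
  - by rewrite mulrDl.
  - by rewrite raddfD mulrDr.
  - by rewrite linearZ /= -scalerAl -scalerAr.
rewrite -(antipoder H).
apply: (@tens_eq_additive R A A A (rconv 1) _ (raddfD _) (tliftD bal)) => a b.
by rewrite rconvE mulr1 tlift_ptens.
Qed.

Lemma coproduct_lext_rext x : lext D (D x) = rext D (D x).
Proof. exact: coproductA. Qed.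

(** Both sides of the new coassociativity law are conjugates of the iterated
    coproduct, by the two sides of the cocycle identity. The new antipode axioms
    follow from the old ones by lconvM and rconvM, which absorb F and Fi into the
    elements that conjugate the antipode. *)
Theorem drinfeld_twist (F Fi : tens A A) :
  F * Fi = 1 -> Fi * F = 1 ->
  leg12 F * lext D F = leg23 F * rext D F ->
  tlift (fun a b => eps a *: b) F = 1 ->
  tlift (fun a b => eps b *: a) F = 1 ->
  rconv 1 F * lconv 1 Fi = 1 ->
  exists H' : hopf_structure A,
    [/\ forall x, coproduct H' x = F * D x * Fi,
        forall x, antipode H' x = rconv 1 F * S x * lconv 1 Fi &
        forall x, counit H' x = eps x].
Proof.
move=> FFi FiF cocycle Fl Fr vv.
pose D' (x : A) : tens A A := F * D x * Fi.
have D'lin : linear D'.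
  move=> r x y; rewrite /D' linearP mulrDr mulrDl.
  by rewrite -tens_scaleAr -tens_scaleAl.
have D'mon : monoid_morphism D'.
  split=> [|x y]; first by rewrite /D' rmorph1 mulr1.
  by rewrite /D' rmorphM !mulrA -(mulrA (F * D x) Fi F) FiF mulr1.
pose D'lr : {lrmorphism A -> tens A A} := HB.pack D'
  (GRing.isLinear.Build R A (tens A A) _ D' D'lin)
  (GRing.isMonoidMorphism.Build A (tens A A) D' D'mon).
pose S' (x : A) : A := rconv 1 F * S x * lconv 1 Fi.
have S'lin : linear S'.
  by move=> r x y; rewrite /S' linearP mulrDr mulrDl -scalerAr -scalerAl.
pose S'l : {linear A -> A} := HB.pack S' (GRing.isLinear.Build R A A _ S' S'lin).
have lextD' z : lext D' z * leg12 F = leg12 F * lext D z.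
  have [D'1 D'M] := lextM eps D'lr; have [D1 DM] := lextM eps D.
  elim/(@tens_ind R A A): z => [|a b|z z' IHz IHz'].
  - rewrite /lext; rewrite (raddf0 (tmap D'lr idfun)) (raddf0 (tmap D idfun)).
    by rewrite !raddf0 mul0r mulr0.
  - rewrite (lextE eps D'lr) (lextE eps D) /leg12 -!tassoc_mul /D'.
    by rewrite /= mulr1 mul1r -!mulrA FiF mulr1.
  - by rewrite (lextD eps D'lr) (lextD eps D) mulrDl mulrDr IHz IHz'.
have rextD' z : rext D' z * leg23 F = leg23 F * rext D z.
  elim/(@tens_ind R A A): z => [|a b|z z' IHz IHz'].
  - rewrite /rext; rewrite (raddf0 (tmap idfun D'lr)) (raddf0 (tmap idfun D)).
    by rewrite mul0r mulr0.
  - rewrite (rextE eps D'lr) (rextE eps D) /leg23 [LHS]ptensM [RHS]ptensM.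
    by rewrite /D' /= mulr1 mul1r -!mulrA FiF mulr1.
  - by rewrite (rextD eps D'lr) (rextD eps D) mulrDl mulrDr IHz IHz'.
have FiF3 : (rext D Fi * leg23 Fi) * (leg23 F * rext D F) = 1.
  have [D1 DM] := rextM eps D.
  rewrite mulrA -(mulrA (rext D Fi)) -leg23M FiF [leg23 1]/(1 : A3) mulr1.
  by rewrite -DM FiF.
have coass x : lext D' (D' x) = rext D' (D' x).
  have [D1 DM] := rextM eps D; have [E1 EM] := lextM eps D.
  have [D'1 D'M] := rextM eps D'lr; have [E'1 E'M] := lextM eps D'lr.
  (* Moving F across D' on both levels turns D' into D. *)
  have L : lext D' (D' x) * (leg12 F * lext D F)
    = (leg12 F * lext D F) * lext D (D x).
    rewrite mulrA lextD' -!mulrA -!EM; congr (_ * lext D _).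
    by rewrite /D' -!mulrA FiF mulr1.
  have Rr : rext D' (D' x) * (leg23 F * rext D F)
    = (leg23 F * rext D F) * rext D (D x).
    rewrite mulrA rextD' -!mulrA -!DM; congr (_ * rext D _).
    by rewrite /D' -!mulrA FiF mulr1.
  have FFi3 : (leg23 F * rext D F) * (rext D Fi * leg23 Fi) = 1.
    by rewrite mulrA -(mulrA (leg23 F)) -DM FFi D1 mulr1 -leg23M FFi.
  have eqF : lext D' (D' x) * (leg23 F * rext D F)
    = rext D' (D' x) * (leg23 F * rext D F).
    by rewrite Rr -cocycle L coproduct_lext_rext.
  by rewrite -[LHS]mulr1 -FFi3 mulrA eqF -mulrA FFi3 mulr1.
have bl := counitl_balanced eps; have br := counitr_balanced eps.
have cl x : tlift (fun a b => eps a *: b) (D' x) = x.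
  have [_ mM] := counitl_monoid_morphism eps.
  have FiE : tlift (fun a b : A => eps a *: b) Fi = 1.
    rewrite -[LHS]mul1r -[X in X * _]Fl -mM FFi tlift_ptens //.
    by rewrite rmorph1 scale1r.
  by rewrite /D' !mM Fl FiE mulr1 mul1r (counitl H).
have cr x : tlift (fun a b => eps b *: a) (D' x) = x.
  have [_ mM] := counitr_monoid_morphism eps.
  have FiE : tlift (fun a b : A => eps b *: a) Fi = 1.
    rewrite -[LHS]mul1r -[X in X * _]Fr -mM FFi tlift_ptens //.
    by rewrite rmorph1 scale1r.
  by rewrite /D' !mM Fr FiE mulr1 mul1r (counitr H).
have bSl : balanced (fun a b : A => S' a * b).
  apply: bilinear_balanced; split=> [b r a a'|a r b b'].
    by rewrite S'lin mulrDl -scalerAl.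
  by rewrite mulrDr -scalerAr.
have bSr : balanced (fun a b : A => a * S' b).
  apply: bilinear_balanced; split=> [b r a a'|a r b b'].
    by rewrite mulrDl -scalerAl.
  by rewrite S'lin mulrDr -scalerAr.
have al x : tlift (fun a b => S' a * b) (D' x) = (eps x)%:A.
  have -> z : tlift (fun a b => S' a * b) z
      = rconv 1 F * lconv (lconv 1 Fi) z.
    apply: (@tens_eq_additive R A A A _ (fun z => rconv 1 F * lconv _ z)).
    - exact: tliftD.
    - by move=> x1 x2; rewrite raddfD mulrDr.
    - by move=> a b; rewrite tlift_ptens // lconvE /S' !mulrA.
  rewrite /D' !lconvM -(lconvM 1 Fi F) FiF [lconv 1 1]lconvE S1 !mulr1.
  by rewrite lconv1_coproduct lconvZ -scalerAr vv.
have ar x : tlift (fun a b => a * S' b) (D' x) = (eps x)%:A.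
  have -> z : tlift (fun a b => a * S' b) z
      = rconv (rconv 1 F) z * lconv 1 Fi.
    apply: (@tens_eq_additive R A A A _ (fun z => rconv _ z * _)).
    - exact: tliftD.
    - by move=> x1 x2; rewrite raddfD mulrDl.
    - by move=> a b; rewrite tlift_ptens // rconvE /S' !mulrA.
  rewrite /D' !rconvM -(rconvM 1 Fi F) FiF [rconv 1 1]rconvE S1 !mulr1.
  by rewrite rconv1_coproduct rconvZ -scalerAl vv.
by exists (@HopfStructure R A D'lr eps S'l coass cl cr al ar).
Qed.

(** ** Twists of group type *)

(** Orthogonal idempotents P with sum 1, indexed by a finite group, and units G
    indexed by the same group give the twist F = sum of P j (x) G j. The comultiplication
    of P turns the cocycle identity into the group-likeness of the G j for
    the twisted coproduct, and the same property gives the invertibility of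
    the element conjugating the antipode. *)
Section GroupTwist.
Context (Gam : finZmodType) (P G : Gam -> A).
Hypothesis PP : forall i j, P i * P j = (i == j)%:R *: P j.
Hypothesis P1 : \sum_j P j = 1.
Hypothesis DP : forall j, D (P j) = \sum_i (P i \ox P (j - i)).
Hypothesis epsP : forall j, eps (P j) = (j == 0)%:R.
Hypothesis SP : forall j, S (P j) = P (- j).
Hypothesis GD : forall i j, G (i + j) = G i * G j.
Hypothesis G0 : G 0 = 1.
Hypothesis epsG : forall j, eps (G j) = 1.

Definition twist : tens A A := \sum_j (P j \ox G j).
Definition twist_inv : tens A A := \sum_j (P j \ox G (- j)).

Hypothesis grouplike : forall j, twist * D (G j) = (G j \ox G j) * twist.

Lemma sum_PP (V : lmodType R) (f : Gam -> Gam -> A -> V) :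
  (forall i j, linear (f i j)) ->
  \sum_i \sum_j f i j (P i * P j) = \sum_j f j j (P j).
Proof.
move=> flin; apply: eq_bigr => i _; rewrite (bigD1 i) //= PP eqxx scale1r.
rewrite big1 ?addr0 // => j; rewrite eq_sym PP => /negPf->; rewrite scale0r.
exact: (linear_fun0 (flin i j)).
Qed.

Lemma twistK : twist * twist_inv = 1.
Proof.
rewrite /twist /twist_inv mulr_suml.
under eq_bigr => i _ do rewrite mulr_sumr.
under eq_bigr => i _ do under eq_bigr => j _ do rewrite ptensM.
rewrite (sum_PP (f := fun i j y => y \ox (G i * G (- j)))).
  under eq_bigr => i _ do rewrite -GD subrr G0.
  by rewrite -ptens_suml P1.
by move=> i j r x y; rewrite ptensDl ptensZl.
Qed.

Lemma twist_invK : twist_inv * twist = 1.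
Proof.
rewrite /twist /twist_inv mulr_suml.
under eq_bigr => i _ do rewrite mulr_sumr.
under eq_bigr => i _ do under eq_bigr => j _ do rewrite ptensM.
rewrite (sum_PP (f := fun i j y => y \ox (G (- i) * G j))).
  under eq_bigr => i _ do rewrite -GD addNr G0.
  by rewrite -ptens_suml P1.
by move=> i j r x y; rewrite ptensDl ptensZl.
Qed.

Lemma rconv_twist : rconv 1 twist = \sum_j P j * S (G j).
Proof.
rewrite /twist raddf_sum /=; apply: eq_bigr => j _.
by rewrite rconvE mulr1.
Qed.

Lemma lconv_twist_inv : lconv 1 twist_inv = \sum_j P j * G j.
Proof.
rewrite /twist_inv raddf_sum /= [RHS](reindex_inj oppr_inj) /=.
by apply: eq_bigr => j _; rewrite lconvE mulr1 SP.
Qed.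

(** The relation D (G j) ~ G j (x) G j, seen through the convolution S * id. *)
Lemma SG_lconv j : S (G j) * lconv 1 twist_inv = lconv 1 twist_inv * G (- j).
Proof.
have E : twist_inv * (G j \ox G j) = D (G j) * twist_inv.
  rewrite -[LHS]mulr1 -twistK -!mulrA (mulrA (_ \ox _)) -grouplike.
  by rewrite !mulrA twist_invK mul1r.
have := congr1 (lconv 1) E; rewrite !lconvM lconvE lconv1_coproduct epsG scale1r.
by move=> E1; rewrite -[in RHS]E1 -!mulrA -GD subrr G0 mulr1.
Qed.

Lemma G_rconv j : G j * rconv 1 twist = rconv 1 twist * S (G (- j)).
Proof.
have := congr1 (rconv 1) (grouplike j).
rewrite !rconvM rconvE rconv1_coproduct epsG scale1r => E1.
by rewrite [in RHS]E1 -!mulrA -SM -GD addNr G0 S1 mulr1.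
Qed.

Lemma P_rconv_lconv i : P i * rconv 1 twist = P i * S (G i).
Proof.
rewrite rconv_twist mulr_sumr (bigD1 i) //= mulrA PP eqxx scale1r.
rewrite big1 ?addr0 // => j; rewrite eq_sym mulrA PP => /negPf->.
by rewrite scale0r mul0r.
Qed.

Lemma P_lconv i : P i * lconv 1 twist_inv = P i * G i.
Proof.
rewrite lconv_twist_inv mulr_sumr (bigD1 i) //= mulrA PP eqxx scale1r.
rewrite big1 ?addr0 // => j; rewrite eq_sym mulrA PP => /negPf->.
by rewrite scale0r mul0r.
Qed.

Lemma rconv_lconv : rconv 1 twist * lconv 1 twist_inv = 1.
Proof.
rewrite rconv_twist mulr_suml -[RHS]P1; apply: eq_bigr => i _.
by rewrite -mulrA SG_lconv mulrA P_lconv -mulrA -GD subrr G0 mulr1.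
Qed.

Lemma lconv_rconv : lconv 1 twist_inv * rconv 1 twist = 1.
Proof.
rewrite lconv_twist_inv mulr_suml -[RHS]P1; apply: eq_bigr => i _.
rewrite -mulrA G_rconv mulrA P_rconv_lconv -mulrA -SM -GD addNr G0 S1.
by rewrite mulr1.
Qed.

Lemma twist_cocycle : leg12 twist * lext D twist = leg23 twist * rext D twist.
Proof.
pose pure a b c : A3 := a \ox (b \ox c : tsquare eps).
have pureM a b c a' b' c' :
    pure a b c * pure a' b' c' = pure (a * a') (b * b') (c * c').
  by rewrite /pure [LHS]ptensM [X in _ \ox X]ptensM.
have -> : leg12 twist = \sum_i pure (P i) (G i) 1.
  rewrite /leg12 /twist ptens_suml raddf_sum.
  by apply: eq_bigr => i _; rewrite /= tassocE.
have -> : lext D twist = \sum_i \sum_j pure (P i) (P j) (G (i + j)).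
  have -> : lext D twist = \sum_j lext D (P j \ox G j).
    apply: (big_morph (lext D)); first exact: (lextD eps D).
    by rewrite /lext (raddf0 (tmap D idfun)) raddf0.
  under eq_bigr => j _ do rewrite lextE /= DP ptens_suml (raddf_sum (@tassoc R A A A)) /=.
  under eq_bigr => j _ do under eq_bigr => i _ do rewrite tassocE.
  rewrite exchange_big; apply: eq_bigr => i _ /=.
  rewrite (reindex_inj (addrI i)); apply: eq_bigr => j _ /=.
  by rewrite addrAC subrr add0r.
have -> : rext D twist = \sum_i ((P i \ox (D (G i) : tsquare eps)) : A3).
  have -> : rext D twist = \sum_j rext D (P j \ox G j).
    apply: (big_morph (rext D)); first exact: (rextD eps D).
    by rewrite /rext (raddf0 (tmap idfun D)).
  by under eq_bigr => i _ do rewrite rextE.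
transitivity (\sum_i \sum_j pure (P i) (G i * P j) (G i * G j)).
  rewrite mulr_suml; under eq_bigr => i _ do rewrite mulr_sumr.
  under eq_bigr => i _ do under eq_bigr => k _ do
    (rewrite mulr_sumr; under eq_bigr => j _ do rewrite pureM mul1r GD).
  rewrite (sum_PP (f := fun i k y => \sum_j pure y (G i * P j) (G k * G j))) //.
  move=> i k r x y; rewrite scaler_sumr -big_split /=; apply: eq_bigr => j _.
  by rewrite /pure ptensDl ptensZl.
rewrite mulr_sumr; apply: eq_bigr => i _.
rewrite [RHS]ptensM mul1r [X in _ \ox X]grouplike /twist.
rewrite [X in _ \ox X]mulr_sumr ptens_sumr; apply: eq_bigr => j _.
by rewrite [X in _ = _ \ox X]ptensM.
Qed.

Theorem group_twist :
  exists H' : hopf_structure A,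
    [/\ forall x, coproduct H' x = twist * D x * twist_inv,
        forall x, antipode H' x = rconv 1 twist * S x * lconv 1 twist_inv &
        forall x, counit H' x = eps x].
Proof.
apply: drinfeld_twist.
- exact: twistK.
- exact: twist_invK.
- exact: twist_cocycle.
- rewrite /twist (tlift_sum _ _ _ (counitl_balanced eps)) (bigD1 0) //=.
  rewrite tlift_ptens; last exact: (counitl_balanced eps).
  rewrite epsP eqxx G0 scale1r big1 ?addr0 // => j /negPf j0.
  by rewrite tlift_ptens ?epsP ?j0 ?scale0r //; apply: (counitl_balanced eps).
- rewrite /twist (tlift_sum _ _ _ (counitr_balanced eps)) -[RHS]P1.
  apply: eq_bigr => j _; rewrite tlift_ptens ?epsG ?scale1r //.
  exact: (counitr_balanced eps).
- exact: rconv_lconv.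
Qed.

End GroupTwist.
End Twist.

(** * Presentation of the restricted enveloping algebra *)

Section FreeAlgebraTheory.
Import monalg.

Lemma free_algebra_lift_nz (K : comNzRingType) (X : choiceType) (B : nzRingType)
    (c : {rmorphism K -> B}) (f : X -> B) :
  (forall k b, c k * b = b * c k) ->
  exists phi : {rmorphism free_algebra K X -> B},
    (forall x, phi (free_gen K x) = f x) /\
    forall k a, phi (k *: a) = c k * phi a.
Proof.
move=> cC.
pose h (m : monalg.fmonom X) : B := \prod_(x <- fmonom_val m) f x.
have hM : monalg.mmorphism h.
  split=> [m m'|]; first by rewrite /h monalg.fmM big_cat.
  by rewrite /h monalg.fm1 big_nil.
pose h' : {mmorphism monalg.fmonom X -> B} :=
  HB.pack h (monalg.isMultiplicative.Build (monalg.fmonom X) B h hM).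
have comm (g : {malg K[{fmonom X}]}) m m' : GRing.comm (c (monalg.mcoeff m g)) (h' m') by apply: cC.
have phiM := monalg.commr_mmap_is_multiplicative (f := c) (h := h') comm.
pose phi (a : free_algebra K X) : B := monalg.mmap c h' a.
have phiB : zmod_morphism phi by exact: (monalg.mmapB (f := c) (h := h')).
have phiM' : monoid_morphism phi by case: phiM.
pose phi' : {rmorphism free_algebra K X -> B} := HB.pack phi
  (GRing.isZmodMorphism.Build (free_algebra K X) B phi phiB)
  (GRing.isMonoidMorphism.Build (free_algebra K X) B phi phiM').
exists phi'; split=> [x|k a]; last first.
  exact: (monalg.mmapZ (f := c) (h := h')).
rewrite /= /phi /free_gen (monalg.mmapU (f := c)) /= rmorph1 mul1r /h.
by rewrite monalg.fmU big_seq1.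
Qed.

(** A possibly zero target is allowed, since tensor products over a general ring
    may vanish. *)
Lemma free_algebra_lift (K : comNzRingType) (X : choiceType) (B : pzRingType)
    (c : {rmorphism K -> B}) (f : X -> B) :
  (forall k b, c k * b = b * c k) ->
  exists phi : {rmorphism free_algebra K X -> B},
    (forall x, phi (free_gen K x) = f x) /\
    forall k a, phi (k *: a) = c k * phi a.
Proof.
move=> cC; have [B0|B1] := eqVneq (1 : B) 0; last first.
  pose B' : nzRingType := HB.pack B (GRing.PzSemiRing_isNonZero.Build B B1).
  exact: (@free_algebra_lift_nz K X B' c f cC).
have all0 (b : B) : b = 0 by rewrite -[b]mul1r B0 mul0r.
pose phi (a : free_algebra K X) : B := 0.
have phiB : zmod_morphism phi by move=> a b; rewrite /phi subr0.
have phiM : monoid_morphism phi.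
  by split=> [|a b]; rewrite [LHS]all0 [RHS]all0.
pose phi' : {rmorphism free_algebra K X -> B} := HB.pack phi
  (GRing.isZmodMorphism.Build (free_algebra K X) B phi phiB)
  (GRing.isMonoidMorphism.Build (free_algebra K X) B phi phiM).
by exists phi'; split=> *; rewrite [LHS]all0 [RHS]all0.
Qed.

Lemma free_algebra_ind (K : comNzRingType) (X : choiceType)
    (P : free_algebra K X -> Prop) :
  P 1 -> (forall a b, P a -> P b -> P (a + b)) ->
  (forall k a, P a -> P (k *: a)) ->
  (forall x a, P a -> P (free_gen K x * a)) -> forall a, P a.
Proof.
move=> P1 PD PZ PM a; rewrite (monalgE a).
have P0 : P 0 by rewrite -(scale0r 1); apply: PZ.
elim/big_rec: _ => // m b _ Pb; apply: PD => //.
have -> : mkmalgU m (mcoeff m a) = mcoeff m a *: (mkmalgU m 1 : free_algebra K X).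
  by apply/malgP=> k; rewrite mcoeffZ !mcoeffU mulrnAr mulr1.
apply: PZ; case: m => s; elim: s => [|x s IH].
  by rewrite -fmoneE; exact: P1.
have -> : (mkmalgU (FMonom (x :: s)) 1 : free_algebra K X) =
    free_gen K x * (mkmalgU (FMonom s) 1 : free_algebra K X).
  rewrite [RHS]malgM_def fgmulUU mulr1; congr (mkmalgU _ _).
  by rewrite fmuE [RHS]fmmulE.
exact: PM.
Qed.

End FreeAlgebraTheory.

Lemma rmorph_brk (A B : pzRingType) (f : {rmorphism A -> B}) x y z :
  f (x * y - y * x - z) = f x * f y - f y * f x - f z.
Proof. by rewrite !rmorphB !rmorphM. Qed.

Lemma rmorph_pow_sub (A B : pzRingType) (f : {rmorphism A -> B}) x y k :
  f (x ^+ k - y) = f x ^+ k - f y.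
Proof. by rewrite rmorphB rmorphXn. Qed.

Lemma sum_delta (K : pzRingType) (V : lmodType K) (I J : finType)
    (g : I -> J -> V) i0 j0 :
  \sum_i \sum_j ((i0 == i) && (j0 == j))%:R *: g i j = g i0 j0.
Proof.
rewrite (bigD1 i0) //= (bigD1 j0) //= !eqxx scale1r.
rewrite big1 => [|j]; last by rewrite eq_sym => /negPf->; rewrite scale0r.
rewrite addr0 big1 ?addr0 // => i; rewrite eq_sym => /negPf-> /=.
by rewrite big1 // => j _; rewrite scale0r.
Qed.

Section Lift.
Context (K : fieldType) (p n : nat).
Local Notation T := (free_algebra K (midx p n * 'I_n)%type).

Lemma tens_witt_is_linear : linear (@tens_witt K p n).
Proof.
move=> k w w'; rewrite /tens_witt scaler_sumr -big_split; apply: eq_bigr => i _.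
rewrite /= scaler_sumr -big_split; apply: eq_bigr => al _ /=.
by rewrite !ffunE scalerDl scalerA.
Qed.

HB.instance Definition _ := GRing.isLinear.Build K (witt K p n) T *:%R
  (@tens_witt K p n) tens_witt_is_linear.

Lemma expo_inj : injective (@expo p n).
Proof.
move=> a b /ffunP ab; apply/ffunP => i; apply: val_inj.
by have := ab i; rewrite !ffunE => -[].
Qed.

Lemma wmonE (al be : midx p n) i j :
  wmon K p (expo al) i j be = ((i == j) && (al == be))%:R.
Proof.
rewrite ffunE eq_sym; case: eqP => _; last by rewrite ffunE.
by rewrite ffunE (inj_eq expo_inj) eq_sym.
Qed.

Lemma tens_witt_wmon (al : midx p n) i :
  tens_witt (wmon K p (expo al) i) = free_gen K (al, i).
Proof.
rewrite -(sum_delta (fun i al => free_gen K (al, i)) i al).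
by apply: eq_bigr => j _; apply: eq_bigr => be _; rewrite wmonE.
Qed.

Lemma witt_decomp (w : witt K p n) :
  w = \sum_i \sum_al w i al *: wmon K p (expo al) i.
Proof.
apply/ffunP => j; apply/ffunP => be; rewrite sum_ffunE sum_ffunE.
rewrite (bigD1 j) //= sum_ffunE sum_ffunE (bigD1 be) //= !ffunE eqxx !ffunE eqxx.
rewrite [X in _ + X + _]big1 => [|al /negPf ne]; last first.
  by rewrite !ffunE eqxx ffunE (inj_eq expo_inj) eq_sym ne [LHS]mulr0.
rewrite addr0 big1 ?addr0 => [|i /negPf ne]; first by rewrite [RHS]mulr1.
rewrite sum_ffunE sum_ffunE big1 // => al _.
by rewrite !ffunE eq_sym ne ffunE [LHS]mulr0.
Qed.

#[local] Opaque tens_witt wbrk.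

(** The defining relations, read in an algebra B over which K acts through a
    central homomorphism c, are all that is needed to map out of u(W). *)
Section Universal.
Context (B : pzRingType) (c : {rmorphism K -> B}) (L : witt K p n -> B).
Hypothesis cC : forall k b, c k * b = b * c k.
Hypothesis LP : forall k w w', L (k *: w + w') = c k * L w + L w'.
Hypothesis Lbrk : forall w w', L w * L w' - L w' * L w = L (wbrk w w').
Hypothesis Ltoral : forall (al : midx p n) i, expo al = eps i ->
  L (wmon K p (expo al) i) ^+ p = L (wmon K p (expo al) i).
Hypothesis Lnil : forall (al : midx p n) i, expo al <> eps i ->
  L (wmon K p (expo al) i) ^+ p = 0.

Lemma universal_L0 : L 0 = 0.
Proof. 
have := LP 1 0 0; rewrite rmorph1 mul1r scale1r addr0 => E.
by apply: (addrI (L 0)); rewrite -E addr0.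
Qed.

Lemma universal_L_decomp w :
  L w = \sum_i \sum_al c (w i al) * L (wmon K p (expo al) i).
Proof.
have LD x y : L (x + y) = L x + L y.
  by rewrite -{1}[x]scale1r LP rmorph1 mul1r.
rewrite {1}(witt_decomp w) (big_morph L LD universal_L0).
apply: eq_bigr => i _; rewrite (big_morph L LD universal_L0).
by apply: eq_bigr => al _; rewrite -[X in L X]addr0 LP universal_L0 addr0.
Qed.

Lemma restr_env_lift : exists phi : {rmorphism restr_env K p n -> B},
  (forall w, phi (uwitt w) = L w) /\ forall k a, phi (k *: a) = c k * phi a.
Proof.
pose f (x : midx p n * 'I_n) := L (wmon K p (expo x.1) x.2).
have [psi [psif psiZ]] := free_algebra_lift f cC.
have psiw w : psi (tens_witt w) = L w.
  rewrite universal_L_decomp rmorph_sum; apply: eq_bigr => i _.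
  by rewrite rmorph_sum; apply: eq_bigr => al _; rewrite /= psiZ psif.
have psi0 a : ideal_gen (@restr_rel K p n) a -> psi a = 0.
  elim=> [|x y _ hx _ hy|a' g b']; first exact: rmorph0.
    by rewrite rmorphD hx hy addr0.
  move=> hg; rewrite !rmorphM; suff -> : psi g = 0 by rewrite mulr0 mul0r.
  case: hg => [w w'|al i E|al i E].
  - have key (u v z : T) : psi u = L w -> psi v = L w' ->
        psi z = L (wbrk w w') -> psi (u * v - v * u - z) = 0.
      by move=> Eu Ev Ez; rewrite rmorph_brk Eu Ev Ez Lbrk subrr.
    by apply: key; apply: psiw.
  - by rewrite rmorph_pow_sub psiw Ltoral ?subrr.
  - by rewrite rmorphXn psiw Lnil.
pose phi (a : restr_env K p n) : B := psi (repr a).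
have phiE x : phi (quot_pi (@restr_rel K p n) x) = psi x.
  apply/eqP; rewrite -subr_eq0 -rmorphB; apply/eqP/psi0/repr_quot.
have qind := @quot_ind K _ (@restr_rel K p n).
have phiB : zmod_morphism phi.
  move=> a b; elim/qind: a => a; elim/qind: b => b.
  have -> : quot_pi (@restr_rel K p n) a - quot_pi (@restr_rel K p n) b
     = quot_pi (@restr_rel K p n) (a - b).
    by rewrite [X in _ + X]quot_oppE [LHS]quot_addE.
  by rewrite !phiE rmorphB.
have phiM : monoid_morphism phi.
  split=> [|a b]; first by rewrite [LHS]phiE rmorph1.
  elim/qind: a => a; elim/qind: b => b.
  by rewrite [X in phi X]quot_mulE !phiE rmorphM.
pose phi' : {rmorphism restr_env K p n -> B} := HB.pack phi
  (GRing.isZmodMorphism.Build (restr_env K p n) B phi phiB)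
  (GRing.isMonoidMorphism.Build (restr_env K p n) B phi phiM).
exists phi'; split=> [w|k a]; first by rewrite /= phiE.
by elim/qind: a => a; rewrite /= [X in phi X]quot_scaleE !phiE psiZ.
Qed.

End Universal.

Lemma uwitt_is_linear : linear (@uwitt K p n).
Proof.
move=> k w w'; rewrite /uwitt linearP [in RHS]/GRing.scale /= quot_scaleE.
by rewrite [RHS]quot_addE.
Qed.

Lemma uwitt_brk (w w' : witt K p n) :
  uwitt w * uwitt w' - uwitt w' * uwitt w = uwitt (wbrk w w').
Proof.
rewrite /uwitt [X in X - _]quot_mulE [X in _ - X]quot_mulE.
rewrite [X in _ + X]quot_oppE [LHS]quot_addE.
apply/quot_piP; rewrite -[X in ideal_gen _ X]mul1r -[X in ideal_gen _ X]mulr1.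
exact/ideal_genM/restr_brk.
Qed.

Lemma quot_piX (x : T) k :
  (quot_pi (@restr_rel K p n) x : restr_env K p n) ^+ k = quot_pi _ (x ^+ k).
Proof. by elim: k => // k IH; rewrite !exprS IH [LHS]quot_mulE. Qed.

Lemma uwitt_toral (al : midx p n) i : expo al = eps i ->
  uwitt (wmon K p (expo al) i) ^+ p = uwitt (wmon K p (expo al) i).
Proof.
move=> E; rewrite quot_piX; apply/quot_piP.
rewrite -[X in ideal_gen _ X]mul1r -[X in ideal_gen _ X]mulr1.
exact/ideal_genM/restr_toral.
Qed.

Lemma uwitt_nil (al : midx p n) i : expo al <> eps i ->
  uwitt (wmon K p (expo al) i) ^+ p = 0.
Proof.
move=> E; rewrite quot_piX; apply/quot_piP; rewrite subr0.
rewrite -[X in ideal_gen _ X]mul1r -[X in ideal_gen _ X]mulr1.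
exact/ideal_genM/restr_nil.
Qed.

Lemma restr_env_ind (P : restr_env K p n -> Prop) :
  P 1 -> (forall a b, P a -> P b -> P (a + b)) ->
  (forall k a, P a -> P (k *: a)) ->
  (forall (al : midx p n) i a, P a -> P (uwitt (wmon K p (expo al) i) * a)) ->
  forall a, P a.
Proof.
move=> P1 PD PZ PM a; elim/(@quot_ind K _ (@restr_rel K p n)): a => a.
elim/(@free_algebra_ind K (midx p n * 'I_n)%type): a => // [a b Pa Pb|k a Pa|[al i] a Pa].
- by rewrite -quot_addE; apply: PD.
- by rewrite -quot_scaleE; apply: PZ.
- by rewrite -quot_mulE -tens_witt_wmon; apply: PM.
Qed.

End Lift.

(** * Extension of scalars *)

Section ExtLift.
Context (K : fieldType) (A : algType K) (h : {poly K}).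
Local Notation S := {poly %/ h}.
Local Notation AS := (ext_scalars A h).

Definition ext_in (a : A) : AS := a \ox (1 : S).

Lemma ext_inP k a b : ext_in (k *: a + b) = (k%:A : S) *: ext_in a + ext_in b.
Proof.
rewrite /ext_in ptensDl ptensZ; congr (_ + _).
by rewrite /GRing.scale /= /ext_scale [RHS]ptensM mul1r mulr1.
Qed.

Lemma ext_in0 : ext_in 0 = 0.
Proof. exact: ptens0l. Qed.

Lemma ext_inZ k a : ext_in (k *: a) = (k%:A : S) *: ext_in a.
Proof. by have := ext_inP k a 0; rewrite ext_in0 !addr0. Qed.

Lemma ext_inD a b : ext_in (a + b) = ext_in a + ext_in b.
Proof. exact: ptensDl. Qed.

Lemma ext_inB a b : ext_in (a - b) = ext_in a - ext_in b.
Proof. by apply: (addIr (ext_in b)); rewrite subrK -ext_inD subrK. Qed.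

Lemma ext_inM a b : ext_in (a * b) = ext_in a * ext_in b.
Proof. by rewrite /ext_in [RHS]ptensM mulr1. Qed.

Lemma ext_in_brk a b d : a * b - b * a = d ->
  ext_in a * ext_in b - ext_in b * ext_in a = ext_in d.
Proof. by move=> <-; rewrite ext_inB !ext_inM. Qed.

Lemma ext_inX a k : ext_in (a ^+ k) = ext_in a ^+ k.
Proof. by elim: k => // k IH; rewrite !exprS ext_inM IH. Qed.

Lemma ext_pureE a s : (a \ox s : AS) = s *: ext_in a.
Proof. by rewrite /ext_in /GRing.scale /= /ext_scale [RHS]ptensM mul1r mulr1. Qed.

Lemma ext_lift (B : pzRingType) (c : {rmorphism S -> B}) (phi : {rmorphism A -> B}) :
  (forall s b, c s * b = b * c s) ->
  (forall k a, phi (k *: a) = c k%:A * phi a) ->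
  exists Phi : {rmorphism AS -> B},
    (forall a, Phi (ext_in a) = phi a) /\
    forall s x, Phi (s *: x) = c s * Phi x.
Proof.
move=> cC phiZ.
have bal : balanced (fun (a : A) (s : S) => phi a * c s).
  split=> [a a' s|a s s'|k a s].
  - by rewrite rmorphD mulrDl.
  - by rewrite rmorphD mulrDr.
  - by rewrite phiZ cC -mulrA -rmorphM -scalerAl mul1r.
pose f : AS -> B := tlift (fun (a : A) (s : S) => phi a * c s).
have fD : {morph f : x y / x + y} by apply: tliftD.
have fB : zmod_morphism f.
  have f0 : f 0 = 0 by apply: tlift0.
  have fN x : f (- x) = - f x.
    by apply: (addrI (f x)); rewrite -fD !subrr.
  by move=> x y; rewrite fD fN.
have fM : monoid_morphism f.
  apply: (tlift_monoid_morphism bal); first by rewrite !rmorph1 mulr1.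
  by move=> a s a' s'; rewrite !rmorphM -!mulrA; congr (_ * _);
    rewrite !mulrA cC.
pose Phi : {rmorphism AS -> B} := HB.pack f
  (GRing.isZmodMorphism.Build AS B f fB)
  (GRing.isMonoidMorphism.Build AS B f fM).
exists Phi; split=> [a|s x].
  by rewrite /= /f /ext_in tlift_ptens // rmorph1 mulr1.
rewrite rmorphM /=; congr (_ * _).
by rewrite /f tlift_ptens // rmorph1 mul1r.
Qed.

End ExtLift.

Section Utq.
Context (K : fieldType) (p n : nat) (q : K).
Local Notation S := {poly %/ tpoly p q}.
Local Notation U := (utq p n q).

Lemma wuE (w : witt K p n) : wu q w = ext_in (tpoly p q) (uwitt w).
Proof. by []. Qed.

Lemma wuP k (w w' : witt K p n) :
  wu q (k *: w + w') = (k%:A : S) *: wu q w + wu q w'.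
Proof. by rewrite /wu uwitt_is_linear [LHS]ext_inP. Qed.

Lemma wu_brk (w w' : witt K p n) :
  wu q w * wu q w' - wu q w' * wu q w = wu q (wbrk w w').
Proof.
exact: (@ext_in_brk K _ (tpoly p q) _ _ _ (uwitt_brk w w')).
Qed.

Lemma wu_toral (al : midx p n) i : expo al = eps i ->
  wu q (wmon K p (expo al) i) ^+ p = wu q (wmon K p (expo al) i).
Proof. by move=> E; rewrite !wuE -ext_inX uwitt_toral. Qed.

Lemma wu_nil (al : midx p n) i : expo al <> eps i ->
  wu q (wmon K p (expo al) i) ^+ p = 0.
Proof.
move=> E; rewrite !wuE -ext_inX uwitt_nil //.
exact: (@ptens0l K _ _ (1 : S)).
Qed.

Lemma utq_ind (P : U -> Prop) :
  P 1 -> (forall a b, P a -> P b -> P (a + b)) ->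
  (forall (s : S) a, P a -> P (s *: a)) ->
  (forall (al : midx p n) i a, P a -> P (wu q (wmon K p (expo al) i) * a)) ->
  forall a, P a.
Proof.
move=> P1 PD PZ PM a; elim/(@ext_ind K (restr_env K p n) (tpoly p q)): a.
- by rewrite -(scale0r 1); apply: PZ.
- move=> a s; rewrite ext_pureE; apply/PZ.
  elim/(@restr_env_ind K p n): a => [|a b Pa Pb|k a Pa|al i a Pa].
  + exact: P1.
  + by rewrite ext_inD; apply: PD.
  + by rewrite ext_inZ; apply: PZ.
  + by rewrite ext_inM; apply: PM.
- exact: PD.
Qed.

Lemma utq_lift (B : pzRingType) (c : {rmorphism S -> B}) (L : witt K p n -> B) :
  (forall s b, c s * b = b * c s) ->
  (forall k w w', L (k *: w + w') = c k%:A * L w + L w') ->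
  (forall w w', L w * L w' - L w' * L w = L (wbrk w w')) ->
  (forall (al : midx p n) i, expo al = eps i ->
    L (wmon K p (expo al) i) ^+ p = L (wmon K p (expo al) i)) ->
  (forall (al : midx p n) i, expo al <> eps i ->
    L (wmon K p (expo al) i) ^+ p = 0) ->
  exists Phi : {rmorphism U -> B},
    (forall w, Phi (wu q w) = L w) /\
    forall s x, Phi (s *: x) = c s * Phi x.
Proof.
move=> cC LP Lbrk Ltor Lnil.
pose cK (k : K) : B := c k%:A.
have cKB : zmod_morphism cK by move=> k l; rewrite /cK scalerBl rmorphB.
have cKM : monoid_morphism cK.
  split=> [|k l]; first by rewrite /cK scale1r rmorph1.
  by rewrite /cK -rmorphM -scalerAl mul1r scalerA.
pose cK' : {rmorphism K -> B} := HB.pack cK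
  (GRing.isZmodMorphism.Build K B cK cKB) (GRing.isMonoidMorphism.Build K B cK cKM).
have [|phi [phiw phiZ]] := @restr_env_lift K p n B cK' L _ LP Lbrk Ltor Lnil.
  by move=> k b; apply: cC.
have [Phi [Phiin PhiZ]] := ext_lift cC phiZ.
by exists Phi; split=> // w; rewrite wuE Phiin phiw.
Qed.

End Utq.

(** * The divided power algebra and its derivations *)

Section DividedPowers.
Context (K : fieldType) (p n : nat).
Hypothesis hp : p \in [pchar K].
Local Notation O := (div_pow K p n).
Local Notation vec := {ffun 'I_n -> nat}.

Lemma pchar_pr : prime p. Proof. exact: pcharf_prime hp. Qed.

Definition zvec (a : vec) : mexp n := [ffun k => (a k)%:Z].
Definition xn (a : vec) : O := xpow K p (zvec a).
Definition nvec (al : midx p n) : vec := [ffun k => nat_of_ord (al k)].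
Definition vbin (a b : vec) : nat := \prod_k 'C(a k + b k, a k).
Definition vdec (j : 'I_n) (a : vec) : vec := [ffun k => a k - (k == j)]%N.

Lemma vaddE (a b : vec) k : (a + b) k = (a k + b k)%N.
Proof. by rewrite ffunE. Qed.

Lemma expoE (al : midx p n) : expo al = zvec (nvec al).
Proof. by apply/ffunP => k; rewrite !ffunE. Qed.

Lemma zvec_inj : injective zvec.
Proof. by move=> a b /ffunP ab; apply/ffunP => k; have := ab k; rewrite !ffunE => -[]. Qed.

Lemma zvecD a b : zvec (a + b) = zvec a + zvec b.
Proof. by apply/ffunP => k; rewrite !ffunE PoszD. Qed.

Lemma xpowE a (be : midx p n) : xpow K p a be = (expo be == a)%:R.
Proof. by rewrite ffunE. Qed.

Lemma xpow_out (a : mexp n) k : (a k < 0) || (p%:Z <= a k) -> xpow K p a = 0.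
Proof.
move=> hk; apply/ffunP => be; rewrite !ffunE; case: eqP => // E.
by move: hk; rewrite -E ffunE ltNge le0z_nat lez_nat leqNgt ltn_ord.
Qed.

Lemma xpow_in (a : mexp n) : (exists al : midx p n, a = expo al) \/ xpow K p a = 0.
Proof.
have [/forallP h|] := boolP [forall k, (0 <= a k) && (a k < p%:Z)]; last first.
  rewrite negb_forall => /existsP[k]; rewrite negb_and -ltNge -leNgt => hk.
  by right; apply: xpow_out hk.
left; have hk k : (absz (a k) < p)%N.
  by have /andP[a0 ap] := h k; rewrite -ltz_nat gez0_abs.
exists [ffun k => Ordinal (hk k)]; apply/ffunP => k; rewrite !ffunE /=.
by have /andP[a0 _] := h k; rewrite gez0_abs.
Qed.

Lemma xn_in (a : vec) : (exists al : midx p n, a = nvec al) \/ xn a = 0.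
Proof.
case: (xpow_in (zvec a)) => [[al E]|E]; last by right.
by left; exists al; apply: zvec_inj; rewrite E expoE.
Qed.

Lemma div_pow_basis (f : O) : f = \sum_al f al *: xpow K p (expo al).
Proof.
apply/ffunP => be; rewrite sum_ffunE (bigD1 be) //= !ffunE eqxx [X in _ = X + _]mulr1.
rewrite big1 ?addr0 // => al /negPf ne.
by rewrite !ffunE (inj_eq (@expo_inj p n)) eq_sym ne [LHS]mulr0.
Qed.

Lemma div_pow_ind (P : O -> Prop) :
  (forall k f g, P f -> P g -> P (k *: f + g)) -> P 0 ->
  (forall al : midx p n, P (xn (nvec al))) -> forall f, P f.
Proof.
move=> PP P0 Px f; rewrite (div_pow_basis f); elim/big_rec: _ => // al g _ Pg.
by apply: PP => //; rewrite expoE; apply: Px.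
Qed.

Lemma omul_linearl (g : O) : linear (fun f : O => omul f g).
Proof.
move=> k f f'; rewrite /omul scaler_sumr -big_split; apply: eq_bigr => al _.
rewrite /= scaler_sumr -big_split; apply: eq_bigr => be _ /=.
by rewrite !ffunE scalerA -scalerDl !mulrDl !mulrA.
Qed.

Lemma omul_linearr (f : O) : linear (omul f).
Proof.
move=> k g g'; rewrite /omul scaler_sumr -big_split; apply: eq_bigr => al _.
rewrite /= scaler_sumr -big_split; apply: eq_bigr => be _ /=.
rewrite !ffunE scalerA -scalerDl mulrDr !mulrDl !mulrA.
by congr ((_ * _ * _ + _) *: _); rewrite mulrC.
Qed.

Lemma oder_linear j : linear (@oder K p n j).
Proof.
move=> k f f'; rewrite /oder scaler_sumr -big_split; apply: eq_bigr => al _.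
by rewrite /= !ffunE scalerA -scalerDl.
Qed.

HB.instance Definition _ f :=
  GRing.isLinear.Build K O O *:%R (omul f) (omul_linearr f).
HB.instance Definition _ j :=
  GRing.isLinear.Build K O O *:%R (@oder K p n j) (oder_linear j).

Lemma omul0l g : omul (0 : O) g = 0.
Proof. exact: (linear_fun0 (omul_linearl g)). Qed.

Lemma omulDl (f f' g : O) : omul (f + f') g = omul f g + omul f' g.
Proof. exact: (linear_funD (omul_linearl g)). Qed.

Lemma omulZl k (f g : O) : omul (k *: f) g = k *: omul f g.
Proof. exact: (linear_funZ (omul_linearl g)). Qed.

Lemma omulBl (f f' g : O) : omul (f - f') g = omul f g - omul f' g.
Proof. by rewrite omulDl -scaleN1r omulZl scaleN1r. Qed.

Lemma xnE (al be : midx p n) : xn (nvec al) be = (be == al)%:R.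
Proof. by rewrite /xn -expoE xpowE (inj_eq (@expo_inj p n)). Qed.

Lemma xn_mul a b : omul (xn a) (xn b) = (vbin a b)%:R *: xn (a + b).
Proof.
have out (c d : vec) : xn c = 0 -> xn (c + d) = 0.
  case: (xn_in (c + d)) => // -[al E] /ffunP c0.
  have hk k : (c k < p)%N.
    have := congr1 (fun f : vec => f k) E; rewrite vaddE [X in _ = X]ffunE => Ek.
    by apply: leq_ltn_trans (ltn_ord (al k)); rewrite -Ek leq_addr.
  have := c0 [ffun k => Ordinal (hk k)]; rewrite !ffunE.
  suff -> : expo [ffun k => Ordinal (hk k)] = zvec c.
    by rewrite eqxx => /eqP; rewrite oner_eq0.
  by apply/ffunP => k; rewrite !ffunE.
case: (xn_in a) => [[al ->]|a0]; last by rewrite a0 omul0l out ?scaler0.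
case: (xn_in b) => [[be ->]|b0]; last by rewrite b0 linear0 addrC out ?scaler0.
rewrite /omul (bigD1 al) //= [X in _ + X]big1 => [|ga ne]; last first.
  by rewrite big1 // => de _; rewrite !xnE (negPf ne) !mul0r scale0r.
rewrite addr0 (bigD1 be) //= [X in _ + X]big1 => [|ga ne]; last first.
  by rewrite [xn (nvec be) _]xnE (negPf ne) mulr0 mul0r scale0r.
rewrite addr0 !xnE !eqxx mul1r mul1r /xn zvecD -!expoE; congr (_%:R *: _).
by apply: eq_bigr => k _; rewrite !ffunE.
Qed.

Lemma xn_der j (al : midx p n) :
  oder j (xn (nvec al)) = if al j == 0%N :> nat then 0 else xn (vdec j (nvec al)).
Proof.
rewrite /oder (bigD1 al) //= xnE eqxx scale1r.
rewrite big1 => [|be ne]; last by rewrite xnE (negPf ne) scale0r.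
rewrite addr0; case: eqP => [a0|/eqP a0].
  by apply: (@xpow_out _ j); rewrite !ffunE a0 eqxx.
congr (xpow _ _ _); apply/ffunP => k; rewrite !ffunE.
by case: eqP => [->|_]; rewrite ?subr0 ?subn0 // -subzn ?lt0n.
Qed.

Lemma vbinC a b : vbin a b = vbin b a.
Proof.
by apply: eq_bigr => k _; rewrite -bin_sub ?leq_addr // addKn addnC.
Qed.

Lemma vbinA a b c :
  (vbin b c * vbin a (b + c)%R = vbin a b * vbin (a + b)%R c)%N.
Proof.
rewrite /vbin -!big_split; apply: eq_bigr => k _ /=; rewrite !vaddE.
move: (a k) (b k) (c k) => x y z.
have h u v : ('C(u + v, u) * (u`! * v`!) = (u + v)`!)%N.
  by rewrite -[in RHS](bin_fact (leq_addr v u)) addKn.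
apply/eqP; rewrite -(eqn_pmul2r (fact_gt0 x)) -(eqn_pmul2r (fact_gt0 y)).
rewrite -(eqn_pmul2r (fact_gt0 z)); apply/eqP.
transitivity (x + y + z)`!.
  rewrite -addnA -(h x (y + z)%N) -(h y z); ring.
by rewrite -(h (x + y)%N z) -(h x y); ring.
Qed.

Lemma omulC (f g : O) : omul f g = omul g f.
Proof.
elim/div_pow_ind: f => [k f f' IH IH'||al].
- by rewrite omulDl omulZl IH IH' linearP.
- by rewrite omul0l linear0.
elim/div_pow_ind: g => [k f f' IH IH'||be].
- by rewrite omulDl omulZl -IH -IH' linearP.
- by rewrite omul0l linear0.
by rewrite !xn_mul vbinC addrC.
Qed.

Lemma omulA (f g h : O) : omul f (omul g h) = omul (omul f g) h.
Proof.
elim/div_pow_ind: f => [k f f' IH IH'||al].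
- by rewrite !(omulDl, omulZl) IH IH'.
- by rewrite !omul0l.
elim/div_pow_ind: g => [k f f' IH IH'||be].
- by rewrite !(omulDl, omulZl, linearP) /= ?(omulDl, omulZl) IH IH'.
- by rewrite !(omul0l, linear0).
elim/div_pow_ind: h => [k f f' IH IH'||ga].
- by rewrite !linearP /= IH IH'.
- by rewrite !linear0.
rewrite !xn_mul linearZ /= omulZl !xn_mul !scalerA addrA -!natrM.
by rewrite vbinA.
Qed.

Lemma xn_out (c : vec) : xn c = 0 -> exists k, (p <= c k)%N.
Proof.
move=> /ffunP c0; apply/existsP; rewrite -[X in is_true X]negbK negb_exists.
apply/negP => /forallP hk; have {}hk k : (c k < p)%N by rewrite ltnNge.
pose ga : midx p n := [ffun k => Ordinal (hk k)].
have E : c = nvec ga by apply/ffunP => k; rewrite !ffunE.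
by have := c0 ga; rewrite E xnE eqxx ffunE => /eqP; rewrite oner_eq0.
Qed.

Lemma vbin_pascal j (a b : vec) : (0 < a j + b j)%N ->
  ((if a j == 0 then 0 else vbin (vdec j a) b)
   + (if b j == 0 then 0 else vbin a (vdec j b)))%N = vbin a b.
Proof.
have vdecE c k : vdec j c k = if k == j then (c k).-1 else c k.
  by rewrite ffunE; case: eqP; rewrite ?subn0 ?subn1.
have E c d : vbin c d = ('C(c j + d j, c j) * \prod_(k | k != j) 'C(c k + d k, c k))%N.
  by rewrite /vbin (bigD1 j).
have -> : vbin (vdec j a) b
    = ('C((a j).-1 + b j, (a j).-1) * \prod_(k | k != j) 'C(a k + b k, a k))%N.
  rewrite E vdecE eqxx; congr (_ * _)%N; apply: eq_bigr => k /negPf kj.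
  by rewrite vdecE kj.
have -> : vbin a (vdec j b)
    = ('C(a j + (b j).-1, a j) * \prod_(k | k != j) 'C(a k + b k, a k))%N.
  rewrite E vdecE eqxx; congr (_ * _)%N; apply: eq_bigr => k /negPf kj.
  by rewrite vdecE kj.
rewrite E.
case: (a j) (b j) => [|x] [|y] //= _.
- by rewrite !bin0.
- by rewrite !addn0 !binn.
by rewrite -mulnDl addnC addSnnS [in RHS]addSn binS.
Qed.

Lemma vdec_addl j (a b : vec) : a j != 0%N -> vdec j a + b = vdec j (a + b).
Proof.
move=> a0; apply/ffunP => k; rewrite vaddE !(vaddE, ffunE).
by case: eqP => [->|_]; rewrite ?subn0 // addnC addnBA ?lt0n // addnC.
Qed.

(** The Leibniz rule on divided powers is Pascal's rule; the products that
    leave the range 0..p-1 are multiples of p, so that truncation is harmless. *)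
Lemma omul_der j (f g : O) :
  oder j (omul f g) = omul (oder j f) g + omul f (oder j g).
Proof.
elim/div_pow_ind: f => [k f f' IH IH'||al].
- by rewrite !(omulDl, omulZl, linearP) /= IH IH' ?(omulDl, omulZl) scalerDr addrACA.
- by rewrite !(omul0l, linear0) addr0.
elim/div_pow_ind: g => [k f f' IH IH'||be].
- by rewrite !linearP /= ?linearP /= IH IH' scalerDr addrACA.
- by rewrite !linear0 addr0.
rewrite xn_mul linearZ /= !xn_der.
set a := nvec al; set b := nvec be.
have aj : al j = a j :> nat by rewrite ffunE.
have bj : be j = b j :> nat by rewrite ffunE.
have R1 : omul (if al j == 0 :> nat then 0 else xn (vdec j a)) (xn b)
  = (if a j == 0 then 0 else vbin (vdec j a) b)%:R *: xn (vdec j (a + b)).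
  rewrite aj; case: eqP => [_|/eqP a0]; first by rewrite omul0l scale0r.
  by rewrite xn_mul vdec_addl.
have R2 : omul (xn a) (if be j == 0 :> nat then 0 else xn (vdec j b))
  = (if b j == 0 then 0 else vbin a (vdec j b))%:R *: xn (vdec j (a + b)).
  rewrite bj; case: eqP => [_|/eqP b0]; first by rewrite linear0 scale0r.
  by rewrite xn_mul addrC vdec_addl // addrC.
rewrite R1 R2 -scalerDl -natrD.
have [c0|cgt0] := posnP (a j + b j).
  have [a0 b0] : a j = 0%N /\ b j = 0%N.
    by move/eqP: c0; rewrite addn_eq0 => /andP[/eqP ? /eqP ?].
  rewrite a0 b0 eqxx scale0r.
  case: (xn_in (a + b)) => [[ga E]|->]; last by rewrite linear0 scaler0.
  rewrite E xn_der; have := congr1 (fun f : vec => f j) E.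
  by rewrite vaddE a0 b0 [X in _ = X]ffunE => <-; rewrite eqxx scaler0.
rewrite vbin_pascal //.
case: (xn_in (a + b)) => [[ga E]|c0].
  rewrite E xn_der; have := congr1 (fun f : vec => f j) E.
  rewrite vaddE [X in _ = X]ffunE => <-.
  by rewrite -[_ == _]negbK -lt0n cgt0.
rewrite c0 linear0 scaler0.
case: (xn_in (vdec j (a + b))) => [[ga E]|->]; last by rewrite scaler0.
suff -> : (vbin a b)%:R = 0 :> K by rewrite scale0r.
have cE k : ((a + b)%R k - (k == j) < p)%N.
  have := congr1 (fun f : vec => f k) E; rewrite [X in X = _]ffunE => ->.
  by rewrite ffunE.
have [k hk] := xn_out c0.
have kj : k = j.
  apply/eqP; have := cE k; case: eqP => // _; rewrite subn0.
  by rewrite ltnNge hk.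
rewrite {k}kj in hk; have := cE j; rewrite eqxx subn1 => hk'.
have cp : (a j + b j)%N = p.
  have {}hk : (p <= a j + b j)%N by move: hk; rewrite vaddE.
  apply/eqP; rewrite eqn_leq hk andbT.
  by move: hk'; rewrite vaddE -ltnS prednK.
have bl : (b j < p)%N by rewrite -bj.
apply/eqP; rewrite -(dvdn_pcharf hp) /vbin (bigD1 j) //= cp.
apply: dvdn_mulr; apply: prime_dvd_bin; first exact: pchar_pr.
rewrite -aj ltn_ord andbT aj lt0n; apply: contraTneq bl => a0.
by rewrite -leqNgt -cp a0.
Qed.

End DividedPowers.

Section WittAction.
Context (K : fieldType) (p n : nat).
Hypothesis hp : p \in [pchar K].
Local Notation O := (div_pow K p n).
Local Notation W := (witt K p n).
Local Notation vec := {ffun 'I_n -> nat}.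

Lemma vdec_in (j : 'I_n) (al : midx p n) :
  exists be : midx p n, vdec j (nvec al) = nvec be.
Proof.
have h k : (al k - (k == j) < p)%N by apply: leq_ltn_trans (leq_subr _ _) (ltn_ord _).
by exists [ffun k => Ordinal (h k)]; apply/ffunP => k; rewrite !ffunE.
Qed.

Lemma oder_comm i j (f : O) : oder i (oder j f) = oder j (oder i f).
Proof.
have [->//|ij] := eqVneq i j.
have half i' j' (al : midx p n) : i' != j' -> oder i' (oder j' (xn K p (nvec al)))
  = if (al i' == 0%N :> nat) || (al j' == 0%N :> nat) then 0
    else xn K p (vdec i' (vdec j' (nvec al))).
  move=> ij'; rewrite xn_der; case: ifP => [_|al0]; first by rewrite linear0 orbT.
  rewrite orbF; have [be E] := vdec_in j' al; rewrite E xn_der -E.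
  suff -> : be i' = al i' :> nat by [].
  have := congr1 (fun f : vec => f i') E; rewrite /= !ffunE => <-.
  by rewrite (negPf ij') subn0.
elim/div_pow_ind: f => [k f f' IH IH'||al]; first by rewrite !linearP /= ?linearP /= IH IH'.
  by rewrite !linear0.
have ji : j != i by rewrite eq_sym.
rewrite !half // orbC; case: ifP => // _.
congr (xn _ _); apply/ffunP => k; rewrite !ffunE -!subnDA; congr (_ - _)%N.
by rewrite addnC.
Qed.

Lemma wact_linear (w : W) : linear (@wact K p n w).
Proof.
move=> k f g; rewrite /wact scaler_sumr -big_split; apply: eq_bigr => i _.
by rewrite /= !linearP.
Qed.

HB.instance Definition _ (w : W) :=
  GRing.isLinear.Build K O O *:%R (@wact K p n w) (wact_linear w).

Lemma wact_linearl k (w w' : W) (f : O) :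
  wact (k *: w + w') f = k *: wact w f + wact w' f.
Proof.
rewrite /wact scaler_sumr -big_split; apply: eq_bigr => i _ /=.
by rewrite !ffunE omulDl omulZl.
Qed.

(** The terms with second derivatives of f are symmetric in w and w', because
    products and partial derivatives commute, so that they cancel. *)
Lemma wact_brk (w w' : W) (f : O) :
  wact (wbrk w w') f = wact w (wact w' f) - wact w' (wact w f).
Proof.
pose T (u v : W) := \sum_i \sum_j omul (u i) (omul (v j) (oder i (oder j f))).
have TC u v : T u v = T v u.
  rewrite /T exchange_big; apply: eq_bigr => i _; apply: eq_bigr => j _ /=.
  by rewrite oder_comm !omulA (omulC (u j)).
have E u v : wact u (wact v f) = \sum_i omul (wact u (v i)) (oder i f) + T u v.
  transitivity (\sum_j \sum_i (omul (omul (u j) (oder j (v i))) (oder i f)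
      + omul (u j) (omul (v i) (oder j (oder i f))))).
    apply: eq_bigr => j _; rewrite {1}/wact (raddf_sum (oder j)) (raddf_sum (omul (u j))) /=.
    apply: eq_bigr => i _.
    by rewrite (omul_der hp) raddfD /= omulA.
  rewrite exchange_big /=; under eq_bigr => i _ do rewrite big_split /=.
  rewrite big_split /= [X in _ + X]exchange_big; congr (_ + _).
  apply: eq_bigr => i _; rewrite /wact.
  by rewrite (big_morph (fun g => omul g (oder i f)) (fun g h => omulDl g h _) (omul0l _)).
rewrite !E (TC w') opprD addrACA subrr addr0 -sumrB; apply: eq_bigr => i _.
by rewrite ffunE omulBl.
Qed.

Local Notation N := #|midx p n|.
(** Matrices carry the representation on O(n;1) over to any commutative
    K-algebra. *)
Definition opmx (F : O -> O) : 'M[K]_N :=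
  \matrix_(i, j) F (xpow K p (expo (enum_val j))) (enum_val i).

Lemma opmx_comp (F G : O -> O) : linear F ->
  opmx (F \o G) = opmx F *m opmx G.
Proof.
move=> Flin; have FS (c : midx p n -> K) (g : midx p n -> O) :
    F (\sum_al c al *: g al) = \sum_al c al *: F (g al).
  by rewrite (linear_fun_sum Flin); apply: eq_bigr => al _; rewrite (linear_funZ Flin).
apply/matrixP => i j; rewrite !mxE /= (div_pow_basis (G _)) FS sum_ffunE.
rewrite (reindex (@enum_val _ (mem (midx p n)))) /=.
  by apply: eq_bigr => k _; rewrite !mxE ffunE mulrC.
exact/onW_bij/enum_val_bij.
Qed.

Lemma opmx_id : opmx id = 1%:M.
Proof.
apply/matrixP => i j; rewrite !mxE ffunE (inj_eq (@expo_inj p n)).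
by rewrite (inj_eq enum_val_inj) eq_sym eq_sym.
Qed.

Lemma opmx_iter (F : O -> O) k : linear F -> opmx (iter k F) = opmx F ^+ k.
Proof.
move=> Flin; elim: k => [|k IH]; first exact: opmx_id.
by rewrite exprS -IH -[RHS](opmx_comp _ Flin).
Qed.

Lemma eq_opmx (F G : O -> O) :
  (forall al : midx p n, F (xpow K p (expo al)) = G (xpow K p (expo al))) ->
  opmx F = opmx G.
Proof. by move=> FG; apply/matrixP => i j; rewrite !mxE FG. Qed.

Lemma wact_wmon a i (f : O) : wact (wmon K p a i) f = omul (xpow K p a) (oder i f).
Proof.
rewrite /wact (bigD1 i) //= ffunE eqxx big1 ?addr0 // => j /negPf ji.
by rewrite ffunE ji omul0l.
Qed.

Lemma oder_xpow j (al : midx p n) :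
  oder j (xpow K p (expo al)) = xpow K p (expo al - eps j).
Proof.
rewrite expoE -[xpow _ _ _]/(xn K p (nvec al)) /oder (bigD1 al) //= xnE eqxx scale1r.
rewrite big1 => [|be ne]; last by rewrite xnE (negPf ne) scale0r.
by rewrite addr0 expoE.
Qed.

Lemma wact_wmon_xpow (al : midx p n) i (a : mexp n) :
  exists c : K, wact (wmon K p (expo al) i) (xpow K p a)
    = c *: xpow K p (a + (expo al - eps i)).
Proof.
rewrite wact_wmon; case: (xpow_in K p a) => [[be ->]|->]; last first.
  by exists 0; rewrite !linear0 scale0r.
rewrite oder_xpow; case: (xpow_in K p (expo be - eps i)) => [[ga E]|->]; last first.
  by exists 0; rewrite !linear0 scale0r.
rewrite E !expoE [omul _ _]xn_mul /xn zvecD -!expoE -E.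
by eexists; rewrite addrCA.
Qed.

(** x^(alpha) D_i shifts exponents by alpha - eps_i, and p times a nonzero shift
    leaves the range 0..p-1. *)
Lemma opmx_nil (al : midx p n) i : expo al <> eps i ->
  opmx (wact (wmon K p (expo al) i)) ^+ p = 0.
Proof.
move=> ne; rewrite -opmx_iter; last exact: wact_linear.
set F := wact _; pose d := expo al - eps i.
have itE k a : exists c : K, iter k F (xpow K p a) = c *: xpow K p (a + d *+ k).
  elim: k => [|k [c IH]]; first by exists 1; rewrite mulr0n addr0 scale1r.
  have [c' E] := wact_wmon_xpow al i (a + d *+ k).
  exists (c * c'); rewrite iterS IH [F _](linear_funZ (wact_linear _)) E scalerA.
  by rewrite -addrA -mulrSr.
have [k dk] : exists k, d k != 0.
  apply/existsP; rewrite -[X in is_true X]negbK negb_exists; apply/negP => /forallP h.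
  apply: ne; apply/eqP; rewrite -subr_eq0; apply/eqP/ffunP => k.
  by have := h k; rewrite negbK => /eqP; rewrite !ffunE.
apply/matrixP => x y; rewrite !mxE; have [c ->] := itE p (expo (enum_val y)).
rewrite (xpow_out _ (k := k)); first by rewrite scaler0 ffunE.
have -> : (expo (enum_val y) + d *+ p) k = (enum_val y k)%:Z + d k *+ p.
  by rewrite ffunE ffunMnE ffunE.
move: dk.
move: (enum_val y k) => [b /= bp]; move: (d k) => z z0.
case: z z0 => [[|m] //|m] _.
  by apply/orP; right; rewrite -mulr_natr natz -PoszM -PoszD lez_nat mulSn addnCA leq_addr.
apply/orP; left; rewrite NegzE mulNrn -mulr_natr natz -PoszM subr_lt0 ltz_nat.
by apply: (leq_trans bp); rewrite mulSn leq_addr.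
Qed.

Lemma toral_act (be : midx p n) i :
  omul (xpow K p (eps i)) (oder i (xpow K p (expo be)))
  = (be i)%:R *: xpow K p (expo be).
Proof.
rewrite oder_xpow; have [b0|b0] := eqVneq (be i : nat) 0%N.
  rewrite b0 scale0r [xpow K p (_ - _)](@xpow_out K p n _ i); first exact: linear0.
  by rewrite !ffunE b0 eqxx.
pose ei : vec := [ffun k => (k == i) : nat].
have -> : eps i = zvec ei by apply/ffunP => k; rewrite !ffunE.
have -> : expo be - zvec ei = zvec (vdec i (nvec be)).
  apply/ffunP => k; rewrite !ffunE.
  by case: eqP => [->|_]; rewrite ?subr0 ?subn0 // -subzn ?lt0n.
rewrite [omul _ _](xn_mul K p); congr (_%:R *: _).
  rewrite /vbin (bigD1 i) //= big1 => [|k /negPf ki].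
    by rewrite !ffunE eqxx muln1 add1n subn1 prednK ?lt0n // bin1.
  by rewrite !ffunE ki bin0.
rewrite /xn expoE; congr (xpow _ _ _); congr zvec; apply/ffunP => k.
rewrite vaddE !ffunE; case: eqP => [->|_]; rewrite ?subn0 //.
by rewrite subnKC ?lt0n.
Qed.

(** x_i D_i multiplies x^(beta) by beta_i, which Frobenius fixes. *)
Lemma opmx_toral (al : midx p n) i : expo al = eps i ->
  opmx (wact (wmon K p (expo al) i)) ^+ p = opmx (wact (wmon K p (expo al) i)).
Proof.
move=> E; rewrite -opmx_iter; last exact: wact_linear.
set F := wact _.
have FE (be : midx p n) : F (xpow K p (expo be)) = (be i)%:R *: xpow K p (expo be).
  by rewrite /F wact_wmon E toral_act.
apply: eq_opmx => be.
have itE k : iter k F (xpow K p (expo be)) = ((be i)%:R ^+ k) *: xpow K p (expo be).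
  elim: k => [|k IH]; first by rewrite expr0 scale1r.
  by rewrite iterS IH [F _](linear_funZ (wact_linear _)) -/F FE scalerA -exprSr.
by rewrite itE FE -(pFrobenius_autE hp) rmorph_nat.
Qed.

(** * Brackets in the Jacobson-Witt algebra *)

Lemma eps_in (k : 'I_n) : exists e : midx p n, eps k = expo e.
Proof.
have p1 := prime_gt1 (pchar_pr hp).
have h (j : 'I_n) : ((j == k) < p)%N by case: eqP => // _; apply: ltnW.
by exists [ffun j => Ordinal (h j)]; apply/ffunP => j; rewrite !ffunE.
Qed.

Lemma omul_xpow0 (a : mexp n) : omul (xpow K p a) (xpow K p 0) = xpow K p a.
Proof.
case: (xpow_in K p a) => [[be ->]|->]; last by rewrite omul0l.
have -> : (0 : mexp n) = zvec 0 by apply/ffunP => k; rewrite !ffunE.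
rewrite expoE [omul _ _](xn_mul K p) addr0 /vbin big1 ?scale1r // => k _.
by rewrite !ffunE addn0 binn.
Qed.

Lemma wmon_brk_toral k (a : mexp n) i :
  wbrk (hW K p k) (wmon K p a i) = ((a - eps i) k)%:~R *: wmon K p a i.
Proof.
apply/ffunP => j; rewrite !ffunE !wact_wmon.
have E1 : omul (xpow K p (eps k)) (oder k (if j == i then xpow K p a else 0))
    = (a k)%:~R *: (if j == i then xpow K p a else 0).
  case: eqP => _; last by rewrite !raddf0.
  case: (xpow_in K p a) => [[be ->]|->]; last by rewrite !raddf0.
  by rewrite toral_act ffunE.
have E2 : omul (xpow K p a) (oder i (if j == k then xpow K p (eps k) else 0))
    = (i == k)%:R *: (if j == i then xpow K p a else 0).
  have [jk|jk] := eqVneq j k; last first.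
    rewrite !raddf0; case: eqP => [->|_]; last by rewrite scale0r.
    by rewrite (negPf jk) raddf0.
  rewrite jk; have [e Ee] := eps_in k; rewrite Ee oder_xpow -Ee eq_sym.
  have [ki|ki] := eqVneq k i; last first.
    rewrite scale0r [xpow K p (_ - _)](@xpow_out K p n _ i) ?raddf0 //.
    by rewrite !ffunE eqxx eq_sym (negPf ki).
  by rewrite -ki subrr omul_xpow0 scale1r.
rewrite E1 E2 -scalerBl; congr (_ *: _).
by rewrite rmorphB /= eq_sym; case: eqP.
Qed.

Lemma wmon_brk_comm (a b : mexp n) k l :
  a l <= 0 -> b k <= 0 -> wbrk (wmon K p a k) (wmon K p b l) = 0.
Proof.
move=> al bk; apply/ffunP => j; rewrite !ffunE.
have z (c d : mexp n) i : d i <= 0 -> wact (wmon K p c i) (xpow K p d) = 0.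
  move=> di; rewrite wact_wmon; case: (xpow_in K p d) => [[be E]|->]; last by rewrite !linear0.
  rewrite E oder_xpow [xpow K p (_ - _)](@xpow_out K p n _ i); first exact: linear0.
  by rewrite -E !ffunE eqxx subr_lt0; apply/orP; left; apply: le_lt_trans di _.
have z' (c d : mexp n) i (b' : bool) : d i <= 0 ->
    wact (wmon K p c i) (if b' then xpow K p d else 0) = 0.
  by move=> di; case: b'; [exact: z | rewrite raddf0].
by rewrite !z' // subrr.
Qed.

End WittAction.

(** * The untwisted Hopf algebra *)

Section PrimitivelyGenerated.
Context {R : comNzRingType} (A : algType R) (X : Type) (gen : X -> A).
Hypothesis gen_ind : forall P : A -> Prop,
  P 1 -> (forall a b, P a -> P b -> P (a + b)) ->
  (forall (r : R) a, P a -> P (r *: a)) ->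
  (forall x a, P a -> P (gen x * a)) -> forall a, P a.

Variables (D : {lrmorphism A -> tens A A}) (e : {lrmorphism A -> R^o})
  (S : {linear A -> A}).
Hypothesis Dgen : forall x, D (gen x) = gen x \ox 1 + 1 \ox gen x.
Hypothesis egen : forall x, e (gen x) = 0.
Hypothesis Sgen : forall x, S (gen x) = - gen x.
Hypothesis S1 : S 1 = 1.
Hypothesis SM : forall x y, S (x * y) = S y * S x.

(** Both sides of each Hopf axiom are compatible with left multiplication by a
    primitive element, so that the axioms propagate from 1 to the whole algebra. *)
Theorem primitively_generated_hopf :
  exists H : hopf_structure A,
    [/\ forall a, coproduct H a = D a, forall a, counit H a = e a
      & forall a, antipode H a = S a].
Proof.
have coass a : tassoc (tmap D id (D a)) = tmap id D (D a).
  rewrite -[LHS]/(lext e D (D a)) -[RHS]/(rext e D (D a)).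
  have [l1 lM] := lextM e D; have [r1 rM] := rextM e D.
  elim/gen_ind: a => [|a b IHa IHb|r a IH|x a IH].
  - by rewrite !rmorph1 l1 r1.
  - by rewrite raddfD lextD rextD IHa IHb.
  - by rewrite linearZ /= lextZ rextZ; congr (_ *: _).
  rewrite rmorphM lM rM IH.
  suff -> : lext e D (D (gen x)) = rext e D (D (gen x)) by [].
  rewrite Dgen lextD rextD !lextE !rextE /= Dgen rmorph1.
  rewrite ptensDl (linear_funD (@tassoc_linear R A A A)) !tassocE -addrA; congr (_ + _).
  exact/esym/ptensDr.
have cl a : tlift (fun a b => e a *: b) (D a) = a.
  have bl := counitl_bilinear e; have bal := counitl_balanced e.
  have [m1 mM] := counitl_monoid_morphism e.
  elim/gen_ind: a => [|a b IHa IHb|r a IH|x a IH].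
  - by rewrite rmorph1 m1.
  - by rewrite raddfD tliftD // IHa IHb.
  - by rewrite linearZ /= (linear_funZ (tlift_linear bl)) IH.
  rewrite rmorphM /= mM IH Dgen tliftD // !tlift_ptens // egen rmorph1.
  by rewrite scale0r scale1r add0r.
have cr a : tlift (fun a b => e b *: a) (D a) = a.
  have bl := counitr_bilinear e; have bal := counitr_balanced e.
  have [m1 mM] := counitr_monoid_morphism e.
  elim/gen_ind: a => [|a b IHa IHb|r a IH|x a IH].
  - by rewrite rmorph1 m1.
  - by rewrite raddfD tliftD // IHa IHb.
  - by rewrite linearZ /= (linear_funZ (tlift_linear bl)) IH.
  rewrite rmorphM /= mM IH Dgen tliftD // !tlift_ptens // egen rmorph1.
  by rewrite scale0r scale1r addr0.
have bSl : @bilinear_map R A A A (fun a b => S a * b).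
  split=> [b r a a'|a r b b']; first by rewrite linearP mulrDl -scalerAl.
  by rewrite mulrDr -scalerAr.
have bSr : @bilinear_map R A A A (fun a b => a * S b).
  split=> [b r a a'|a r b b']; first by rewrite mulrDl -scalerAl.
  by rewrite linearP mulrDr -scalerAr.
have al a : tlift (fun a b => S a * b) (D a) = (e a)%:A.
  have bal := bilinear_balanced bSl.
  elim/gen_ind: a => [|a b IHa IHb|r a IH|x a IH].
  - by rewrite !rmorph1 tlift_ptens // S1 mulr1 scale1r.
  - by rewrite !raddfD tliftD // IHa IHb scalerDl.
  - by rewrite !linearZ /= (linear_funZ (tlift_linear bSl)) IH scalerA.
  rewrite !rmorphM /= egen mul0r scale0r Dgen.
  elim/(@tens_ind R A A): (D a) => [|b c|z z' IHz IHz'].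
  - by rewrite mulr0 tlift0.
  - rewrite mulrDl !ptensM !mul1r tliftD // !tlift_ptens // SM Sgen mulrN.
    by rewrite mulNr mulrA addNr.
  - by rewrite mulrDr tliftD // IHz IHz' addr0.
have ar a : tlift (fun a b => a * S b) (D a) = (e a)%:A.
  have bal := bilinear_balanced bSr.
  elim/gen_ind: a => [|a b IHa IHb|r a IH|x a IH].
  - by rewrite !rmorph1 tlift_ptens // S1 mulr1 scale1r.
  - by rewrite !raddfD tliftD // IHa IHb scalerDl.
  - by rewrite !linearZ /= (linear_funZ (tlift_linear bSr)) IH scalerA.
  have comm z : tlift (fun a b => a * S b) ((gen x \ox 1 + 1 \ox gen x) * z)
     = gen x * tlift (fun a b => a * S b) z - tlift (fun a b => a * S b) z * gen x.
    elim/(@tens_ind R A A): z => [|b c|z z' IHz IHz'].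
    - by rewrite mulr0 !tlift0 // mulr0 mul0r subrr.
    - rewrite mulrDl !ptensM !mul1r tliftD // !tlift_ptens // SM Sgen.
      by rewrite !mulrN !mulrA.
    - by rewrite mulrDr !tliftD // IHz IHz' mulrDr mulrDl opprD addrACA.
  rewrite !rmorphM /= egen mul0r scale0r Dgen comm IH.
  by rewrite -scalerAr -scalerAl mulr1 mul1r subrr.
by exists (@HopfStructure R A D e S coass cl cr al ar).
Qed.

End PrimitivelyGenerated.

(** The middle binomial coefficients are divisible by p. *)
Lemma exprDp_comm (B : pzRingType) (p : nat) (x y : B) :
  prime p -> p%:R = 0 :> B -> GRing.comm x y -> (x + y) ^+ p = x ^+ p + y ^+ p.
Proof.
case: p => // m pr_p p0 cxy.
rewrite exprDn_comm // big_ord_recl big_ord_recr /= subn0 expr0.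
rewrite big1 ?add0r => [|i _]; last first.
  rewrite /bump /= add1n; have /dvdnP[d ->] : (m.+1 %| 'C(m.+1, i.+1))%N.
    by apply: prime_dvd_bin => //=; rewrite ltnS ltn_ord.
  by rewrite -mulr_natr natrM p0 !mulr0.
by rewrite /bump /= add1n subnn expr0 mulr1 mul1r bin0 binn.
Qed.

Section TensorScalars.
Context {R : comNzRingType} (A : algType R).

Lemma tens_scalar_central : exists c : {rmorphism R -> tens A A},
  (forall r z, c r * z = z * c r) /\ forall r z, c r * z = r *: z.
Proof.
pose c (r : R) : tens A A := r *: ((1 : A) \ox (1 : A)).
have cM r z : c r * z = r *: z by rewrite -tens_scaleAl [X in _ *: X]mul1r.
have cB : zmod_morphism c by move=> r s; rewrite /c scalerBl.
have cm : monoid_morphism c.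
  by split=> [|r s]; rewrite ?cM /c ?scale1r // scalerA.
pose c' : {rmorphism R -> tens A A} := HB.pack c
  (GRing.isZmodMorphism.Build R (tens A A) c cB)
  (GRing.isMonoidMorphism.Build R (tens A A) c cm).
by exists c'; split=> r z //; rewrite [LHS]cM -tens_scaleAr mulr1.
Qed.

Lemma converse_scalar_central : exists c : {rmorphism R -> A^c},
  (forall r z, c r * z = z * c r) /\ forall r (z : A), c r * (z : A^c) = r *: z.
Proof.
pose c (r : R) : A^c := r%:A.
have cM r (z : A) : c r * (z : A^c) = r *: z by exact: (mulr_algr r z).
have cB : zmod_morphism c by move=> r s; rewrite /c scalerBl.
have cm : monoid_morphism c.
  by split=> [|r s]; rewrite ?cM /c ?scale1r // scalerA.
pose c' : {rmorphism R -> A^c} := HB.pack c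
  (GRing.isZmodMorphism.Build R A^c c cB)
  (GRing.isMonoidMorphism.Build R A^c c cm).
exists c'; split=> r z //; rewrite [LHS]cM; exact/esym/(mulr_algl r z).
Qed.

End TensorScalars.

Lemma primitive_brk {R : comNzRingType} (A : algType R) (x y z : A) :
  x * y - y * x = z ->
  (x \ox 1 + 1 \ox x) * (y \ox 1 + 1 \ox y)
  - (y \ox 1 + 1 \ox y) * (x \ox 1 + 1 \ox x) = z \ox 1 + 1 \ox z.
Proof.
have AC (V : zmodType) (a b c d a' d' : V) :
    a + b + (c + d) - (a' + c + (b + d')) = (a - a') + (d - d').
  have -> : a + b + (c + d) = a + d + (b + c) by rewrite [c + d]addrC addrACA.
  have -> : a' + c + (b + d') = b + c + (a' + d').
    by rewrite [b + d']addrC addrACA [c + b]addrC addrC.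
  by rewrite addrKA opprD addrACA.
move=> <-; rewrite !mulrDl !mulrDr !ptensM !mulr1 !mul1r ptensBr ptensBl.
exact: AC.
Qed.

Lemma converse_brk (A : pzRingType) (x y z : A) : x * y - y * x = z ->
  (- x : A^c) * (- y : A^c) - (- y : A^c) * (- x : A^c) = - z.
Proof. by move=> <-; rewrite !mulrNN opprB. Qed.

Lemma exprN_pchar (B : pzRingType) (p : nat) (x : B) :
  prime p -> p%:R = 0 :> B -> (- x) ^+ p = - x ^+ p.
Proof.
move=> pr_p p0; apply/eqP; rewrite -addr_eq0 -(exprDp_comm pr_p p0).
  by rewrite addNr expr0n eqn0Ngt prime_gt0.
by rewrite /GRing.comm mulNr mulrN.
Qed.

Section UtqHopf.
Context (K : fieldType) (p n : nat) (q : K).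
Hypothesis hp : p \in [pchar K].
Local Notation S := {poly %/ tpoly p q}.
Local Notation U := (utq p n q).
Local Notation g al i := (wu q (wmon K p (expo (al : midx p n)) i)).

Lemma S_pchar : p%:R = 0 :> S.
Proof.
by rewrite -(rmorph_nat (in_alg S)) (pcharf0 hp) rmorph0.
Qed.

Definition utq_gen (x : midx p n * 'I_n) : U := g x.1 x.2.

Lemma utq_gen_ind (P : U -> Prop) :
  P 1 -> (forall a b, P a -> P b -> P (a + b)) ->
  (forall (s : S) a, P a -> P (s *: a)) ->
  (forall x a, P a -> P (utq_gen x * a)) -> forall a, P a.
Proof. by move=> P1 PD PZ PM; apply: utq_ind => // al i a; apply: (PM (al, i)). Qed.

Lemma utq_counit : exists e : {lrmorphism U -> S^o}, forall w, e (wu q w) = 0.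
Proof.
have p_gt0 := prime_gt0 (pchar_pr hp).
have [|||||Phi [Phiw PhiZ]] := @utq_lift K p n q S idfun (fun=> 0).
- by move=> s b /=; rewrite mulrC.
- by move=> k w w'; rewrite mulr0 addr0.
- by move=> w w'; rewrite mul0r subrr.
- by move=> al i _; rewrite expr0n eqn0Ngt p_gt0.
- by move=> al i _; rewrite expr0n eqn0Ngt p_gt0.
have Plin : linear (Phi : U -> S^o) by move=> r x y; rewrite rmorphD PhiZ.
pose e : {lrmorphism U -> S^o} := HB.pack (Phi : U -> S^o)
  (GRing.isLinear.Build S U S^o *%R (Phi : U -> S^o) Plin)
  (GRing.isMonoidMorphism.Build U S^o (Phi : U -> S^o) (rmorph1 Phi, rmorphM Phi)).
by exists e.
Qed.

Lemma utq_coproduct : exists D : {lrmorphism U -> tens U U},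
  forall w, D (wu q w) = wu q w \ox 1 + 1 \ox wu q w.
Proof.
have p_gt0 := prime_gt0 (pchar_pr hp).
have [c [cC cZ]] := tens_scalar_central U.
pose L (w : witt K p n) : tens U U := wu q w \ox 1 + 1 \ox wu q w.
have Lpow w : L w ^+ p = wu q w ^+ p \ox 1 + 1 \ox wu q w ^+ p.
  rewrite (@exprDp_comm _ p _ _ (pchar_pr hp)).
  - by rewrite !ptensX !expr1n.
  - by rewrite -(rmorph_nat c) S_pchar rmorph0.
  - by rewrite /GRing.comm !ptensM !mulr1 !mul1r.
have [||||Phi [Phiw PhiZ]] := @utq_lift K p n q _ c L cC.
- move=> k w w'; rewrite cZ /L wuP.
  by rewrite ptensDl ptensDr ptensZl ptensZr scalerDr addrACA.
- by move=> w w'; apply/primitive_brk/wu_brk.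
- by move=> al i E; rewrite Lpow wu_toral.
- by move=> al i E; rewrite Lpow wu_nil // ptens0l ptens0r addr0.
have Plin : linear Phi by move=> r x y; rewrite rmorphD PhiZ cZ.
pose D : {lrmorphism U -> tens U U} := HB.pack (Phi : U -> tens U U)
  (GRing.isLinear.Build S U (tens U U) *:%R (Phi : U -> tens U U) Plin)
  (GRing.isMonoidMorphism.Build U (tens U U) (Phi : U -> tens U U) (rmorph1 Phi, rmorphM Phi)).
by exists D.
Qed.

Lemma utq_antipode : exists S : {linear U -> U},
  [/\ S 1 = 1, forall x y, S (x * y) = S y * S x & forall w, S (wu q w) = - wu q w].
Proof.
have [c [cC cZ]] := converse_scalar_central U.
pose L (w : witt K p n) : U^c := - wu q w.
have Np w : L w ^+ p = - wu q w ^+ p.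
  rewrite /L revrX exprN_pchar //; first exact: pchar_pr hp.
  by rewrite -(rmorph_nat (in_alg U)) S_pchar rmorph0.
have [||||Phi [Phiw PhiZ]] := @utq_lift K p n q _ c L cC.
- by move=> k w w'; rewrite cZ /L wuP opprD scalerN.
- by move=> w w'; apply/converse_brk/wu_brk.
- by move=> al i E; rewrite Np wu_toral.
- by move=> al i E; rewrite Np wu_nil // oppr0.
have Plin : linear (Phi : U -> U).
  by move=> r x y; rewrite rmorphD PhiZ cZ.
pose A : {linear U -> U} := HB.pack (Phi : U -> U)
  (GRing.isLinear.Build S U U *:%R (Phi : U -> U) Plin).
exists A; split=> //; first exact: (rmorph1 Phi).
by move=> x y; apply: (rmorphM Phi).
Qed.

(** By the universal property of utq it is enough that the defining relations
    hold for w (x) 1 + 1 (x) w in the tensor square, for 0 in S, and for - w in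
    the opposite algebra. *)
Theorem utq_hopf : exists H : hopf_structure U,
  [/\ forall w, coproduct H (wu q w) = wu q w \ox 1 + 1 \ox wu q w,
      forall w, counit H (wu q w) = 0,
      forall w, antipode H (wu q w) = - wu q w,
      antipode H 1 = 1
    & forall x y, antipode H (x * y) = antipode H y * antipode H x].
Proof.
have [e ew] := utq_counit; have [D Dw] := utq_coproduct.
have [A [A1 AM Aw]] := utq_antipode.
have [H [HD He HA]] := @primitively_generated_hopf _ U _ utq_gen utq_gen_ind D e A
  (fun=> Dw _) (fun=> ew _) (fun=> Aw _) A1 AM.
by exists H; split=> [w|w|w||x y]; rewrite ?HD ?He ?HA.
Qed.

End UtqHopf.

(** * Toral elements *)

Section PrimeField.
Context (p : nat) (B : pzRingType).
Hypotheses (pr_p : prime p) (p0 : p%:R = 0 :> B).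

Definition fp (j : 'F_p) : B := (j : nat)%:R.

Lemma natr_modp m : (m %% p)%:R = m%:R :> B.
Proof.
by rewrite {2}(divn_eq m p) natrD natrM p0 mulr0 add0r.
Qed.

Lemma fp_nat m : fp m%:R = m%:R.
Proof. by rewrite /fp val_Fp_nat ?natr_modp ?prime_gt1. Qed.

Lemma fpD i j : fp (i + j) = fp i + fp j.
Proof.
by rewrite -[i]natr_Zp -[j]natr_Zp -natrD !fp_nat natrD.
Qed.

Lemma fpM i j : fp (i * j) = fp i * fp j.
Proof.
by rewrite -[i]natr_Zp -[j]natr_Zp -natrM !fp_nat natrM.
Qed.

Lemma fp1 : fp 1 = 1. Proof. exact: (fp_nat 1). Qed.
Lemma fp0 : fp 0 = 0. Proof. exact: (fp_nat 0). Qed.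

Lemma fpB i j : fp (i - j) = fp i - fp j.
Proof. by apply: (addIr (fp j)); rewrite -fpD !subrK. Qed.

Lemma fpN i : fp (- i) = - fp i.
Proof. by rewrite -sub0r fpB fp0 sub0r. Qed.

Lemma fpX i k : fp (i ^+ k) = fp i ^+ k.
Proof. by elim: k => [|k IH]; rewrite ?fp1 // !exprS fpM IH. Qed.

Lemma Fp_fermat (x : 'F_p) : x ^+ p = x.
Proof. 
by rewrite -[x]natr_Zp -(pFrobenius_autE (pchar_Fp pr_p)) rmorph_nat.
Qed.

Lemma Fp_fermat1 (x : 'F_p) : x ^+ p.-1 = (x != 0)%:R.
Proof.
have [->|x0] := eqVneq x 0; last first.
  by apply: (mulfI x0); rewrite -exprS prednK ?prime_gt0 // Fp_fermat mulr1.
by rewrite expr0n -subn1 subn_eq0 leqNgt prime_gt1.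
Qed.

Variable x : B.

(** By Fermat 1 - (c - j) ^+ p.-1 is 1 for c = j and 0 for every other c in the
    prime field; so this is the projector on the eigenspace of x for j when
    x ^+ p = x. *)
Definition eigenproj (j : 'F_p) : B := 1 - (x - fp j) ^+ p.-1.

Lemma fp_comm j y : GRing.comm (fp j) y.
Proof. exact/commr_sym/commr_nat. Qed.

Lemma eigenproj_comm y j : GRing.comm x y -> GRing.comm y (eigenproj j).
Proof.
move=> xy; apply: commrB; first exact: commr1.
apply/commrX/commrB; first exact: commr_sym.
exact/commr_sym/fp_comm.
Qed.

Lemma eigenproj_act y (c i : 'F_p) : x * y = fp c * y ->
  eigenproj i * y = (i == c)%:R * y.
Proof.
move=> xy; have E k : (x - fp i) ^+ k * y = fp ((c - i) ^+ k) * y.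
  elim: k => [|k IH]; first by rewrite !expr0 fp1.
  rewrite exprSr -mulrA mulrBl xy -mulrBl -fpB mulrA -(fp_comm (c - i)).
  by rewrite -mulrA IH mulrA -fpM exprS.
rewrite /eigenproj mulrBl mul1r E Fp_fermat1 subr_eq0 eq_sym.
by case: eqP => _; rewrite ?fp0 ?fp1 ?mul0r ?mul1r ?subr0 ?subrr.
Qed.

Hypothesis xp : x ^+ p = x.

Lemma eigenprojP j : x * eigenproj j = fp j * eigenproj j.
Proof.
apply/eqP; rewrite -subr_eq0 -mulrBl mulrBr mulr1 -exprS prednK ?prime_gt0 //.
rewrite (exprDp_comm pr_p p0); last exact/commrN/commr_sym/fp_comm.
by rewrite exprN_pchar // -fpX Fp_fermat xp subrr.
Qed.

Lemma eigenprojM i j : eigenproj i * eigenproj j = (i == j)%:R * eigenproj j.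
Proof. exact/eigenproj_act/eigenprojP. Qed.

Lemma eigenproj_shift y (la j : 'F_p) : x * y = y * (x + fp la) ->
  y * eigenproj j = eigenproj (j + la) * y.
Proof.
move=> xy; rewrite /eigenproj mulrBr mulrBl mulr1 mul1r; congr (_ - _).
have key : y * (x - fp j) = (x - fp (j + la)) * y.
  rewrite mulrBr mulrBl xy (fp_comm (j + la)) fpD mulrDr mulrDr opprD.
  by rewrite [- (y * fp j) - _]addrC addrA addrK.
elim: p.-1 => [|k IH]; first by rewrite mulr1 mul1r.
by rewrite !exprS mulrA key -mulrA IH mulrA.
Qed.

End PrimeField.

Lemma rmorph_eigenproj (p : nat) (B C : pzRingType) (f : {rmorphism B -> C}) x
    (j : 'F_p) : f (eigenproj x j) = eigenproj (f x) j.
Proof. by rewrite /eigenproj rmorphB rmorph1 rmorphXn rmorphB rmorph_nat. Qed.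

(** The sign (-1) ^+ p.-1 is 1 in characteristic p, also for p = 2. *)
Lemma anti_eigenproj (p : nat) (B : pzRingType) (S : B -> B) x (j : 'F_p) :
  prime p -> p%:R = 0 :> B -> {morph S : y z / y - z} -> S 1 = 1 ->
  (forall y z, S (y * z) = S z * S y) -> S x = - x ->
  S (eigenproj x j) = eigenproj x (- j).
Proof.
move=> pr_p p0 SB S1 SM Sx.
have S0 : S 0 = 0 by rewrite -(subrr 1) SB S1.
have SD y z : S (y + z) = S y + S z.
  by rewrite -{1}[z]opprK SB -(sub0r z) SB S0 sub0r opprK.
have Sn m : S m%:R = m%:R by elim: m => [//|m IH]; rewrite mulrS SD S1 IH.
have SX y m : S (y ^+ m) = S y ^+ m.
  by elim: m => // m IH; rewrite exprS exprSr SM IH.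
rewrite /eigenproj SB S1 SX SB Sx Sn -opprD exprNn; congr (_ - _).
have -> : (-1) ^+ p.-1 = 1 :> B.
  by rewrite -(fp1 pr_p p0) -fpN // -fpX // Fp_fermat1 // oppr_eq0 oner_eq0.
by rewrite mul1r fpN // opprK.
Qed.

Section EigenprojSum.
Context (p : nat) (B : nzRingType).
Hypotheses (pr_p : prime p) (p0 : p%:R = 0 :> B).

(** The difference of both sides has degree below p and vanishes on the prime
    field. *)
Lemma sum_eigenproj_poly :
  \sum_(j : 'F_p) (1 - ('X - j%:P) ^+ p.-1) = 1 :> {poly 'F_p}.
Proof.
apply/eqP; rewrite -subr_eq0; apply/eqP; set Q := _ - 1.
have sQ : (size Q <= p)%N.
  rewrite (leq_trans (size_polyD _ _)) // size_polyN geq_max size_poly1 prime_gt0 // andbT.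
  rewrite (leq_trans (size_sum _ _ _)) //; apply/bigmax_leqP => j _.
  rewrite (leq_trans (size_polyD _ _)) // size_polyN geq_max size_poly1 prime_gt0 //=.
  by rewrite size_exp_XsubC prednK // prime_gt0.
apply/eqP/negPn/negP => Q0.
suff rQ : all (root Q) (enum 'F_p).
  by have := max_poly_roots Q0 rQ (enum_uniq _); rewrite -cardE card_Fp // ltnNge sQ.
apply/allP => c _; rewrite /root /Q hornerD hornerN hornerC horner_sum.
rewrite (bigD1 c) //= !hornerE subrr expr0n -subn1 subn_eq0 leqNgt prime_gt1 //=.
rewrite subr0 big1 ?addr0 ?subrr // => j jc; rewrite !hornerE.
by rewrite subn1 Fp_fermat1 // subr_eq0 eq_sym jc subrr.
Qed.

Lemma sum_eigenproj (x : B) : \sum_(j : 'F_p) eigenproj x j = 1.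
Proof.
have fB : zmod_morphism (@fp p B) by move=> i j; apply: fpB.
have fM : monoid_morphism (@fp p B) by split; [apply: fp1 | apply: fpM].
pose f : {rmorphism 'F_p -> B} := HB.pack (@fp p B)
  (GRing.isZmodMorphism.Build 'F_p B (@fp p B) fB)
  (GRing.isMonoidMorphism.Build 'F_p B (@fp p B) fM).
have cfx : commr_rmorph f x by move=> j; apply/commr_sym/fp_comm.
pose F : {rmorphism {poly 'F_p} -> B} := horner_morph cfx.
have := congr1 F sum_eigenproj_poly.
rewrite rmorph1 rmorph_sum => <-; apply: eq_bigr => j _.
rewrite (rmorphB F) rmorph1 (rmorphXn F) (rmorphB F).
by rewrite [F 'X](horner_morphX cfx) [F _](horner_morphC cfx).
Qed.

End EigenprojSum.

(** * Products of commuting families *)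

Section CommutingProducts.
Context (B : pzRingType) (I : Type).
Implicit Types (a b : I -> B) (r : seq I).

Lemma prod_anti (S : B -> B) a r : S 1 = 1 ->
  (forall x y, S (x * y) = S y * S x) ->
  (forall k l, GRing.comm (S (a k)) (S (a l))) ->
  S (\prod_(k <- r) a k) = \prod_(k <- r) S (a k).
Proof.
move=> S1 SM aC; elim: r => [|k r IH]; first by rewrite !big_nil.
by rewrite !big_cons SM IH; apply/esym/commr_prod.
Qed.

Lemma prod_bool (b : I -> bool) a r :
  \prod_(k <- r) ((b k)%:R * a k) = (all b r)%:R * \prod_(k <- r) a k.
Proof.
elim: r => [|k r IH]; first by rewrite !big_nil mul1r.
rewrite !big_cons IH /=; case: (b k); first by rewrite !mul1r -mulr_natl !mulr_natl mulrnAr.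
by rewrite !mul0r.
Qed.

End CommutingProducts.

Lemma all_ffun_eq (I : finType) (T : eqType) (f g : {ffun I -> T}) :
  all (fun k => f k == g k) (index_enum I) = (f == g).
Proof.
apply/allP/eqP => [fg|-> //]; apply/ffunP => k.
by apply/eqP/fg/mem_index_enum.
Qed.

Lemma prod_ptens {R : comNzRingType} (A B : algType R) (I : Type) (r : seq I)
    (a : I -> A) (b : I -> B) :
  \prod_(k <- r) (a k \ox b k) = (\prod_(k <- r) a k) \ox (\prod_(k <- r) b k).
Proof.
elim: r => [|k r IH]; first by rewrite !big_nil.
by rewrite !big_cons IH ptensM.
Qed.

Section ConverseAlgebra.
Context {R : comNzRingType} (A : algType R).

HB.instance Definition _ := GRing.Zmodule_isLmodule.Build R A^c
  (@scalerA R A) (@scale1r R A) (@scalerDr R A) (@scalerDl R A).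

Lemma converse_scalerAl (r : R) (x y : A^c) : r *: (x * y) = (r *: x) * y.
Proof. exact: (@scalerAr R A r y x). Qed.

HB.instance Definition _ := GRing.Lmodule_isLalgebra.Build R A^c converse_scalerAl.

Lemma converse_scalerAr (r : R) (x y : A^c) : r *: (x * y) = x * (r *: y).
Proof. exact: (@scalerAl R A r y x). Qed.

HB.instance Definition _ := GRing.Lalgebra_isAlgebra.Build R A^c converse_scalerAr.

End ConverseAlgebra.

(** * Moving an element across powers of the g_k *)

Section Expansion.
Context {R : comNzRingType} (A : algType R) (p n : nat) (e : 'I_n -> A) (t : R).
Hypothesis eC : forall k l, GRing.comm (e k) (e l).
Definition gfac k : A := 1 - t *: e k.
Local Notation g := gfac.

Definition ad k (y : A) : A := e k * y - y * e k.
Definition adI (l : 'I_n -> nat) : A -> A := \big[comp/id]_(k < n) iter (l k) (ad k).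

Lemma ad_linear k : linear (ad k).
Proof.
move=> r x y; rewrite /ad mulrDr mulrDl -scalerAr -scalerAl opprD addrACA.
by rewrite scalerBr.
Qed.

(* A (x) A^op acts on A by left and right multiplication, and in it right
   multiplication by g_k is the sum of the commuting elements that represent left
   multiplication by g_k and t ad e_k. *)
Local Notation T := (tens A A^c).

Definition lract (x : A) (z : T) : A := tlift (fun (a : A) (b : A^c) => a * x * (b : A)) z.

Lemma lract_bilinear x : @bilinear_map R A A^c A (fun a b => a * x * (b : A)).
Proof.
split=> [b r a a'|a r b b']; first by rewrite !mulrDl -!scalerAl.
by rewrite mulrDr -scalerAr.
Qed.

Lemma lractE x (a : A) (b : A^c) : lract x (a \ox b) = a * x * (b : A).
Proof. exact/tlift_ptens/bilinear_balanced/lract_bilinear. Qed.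

Lemma lract_linear x : linear (lract x).
Proof. exact/tlift_linear/lract_bilinear. Qed.

Lemma lractM x z z' : lract x (z * z') = lract (lract x z') z.
Proof.
have D y u v := linear_funD (lract_linear y) u v.
have Z y := linear_fun0 (lract_linear y).
elim/(@tens_ind R A A^c): z => [|a b|z1 z2 IH1 IH2].
- by rewrite mul0r !Z.
- elim/(@tens_ind R A A^c): z' => [|a' b'|z1 z2 IH1 IH2].
  + by rewrite mulr0 !Z lractE mulr0 mul0r.
  + rewrite ptensM !lractE.
    transitivity (a * a' * x * ((b' : A) * (b : A))); first by [].
    by rewrite !mulrA.
  + by rewrite mulrDr !D IH1 IH2 !lractE mulrDr mulrDl.
- by rewrite mulrDl !D IH1 IH2.
Qed.

Let u k : T := (1 : A) \ox (g k : A^c).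
Let v k : T := g k \ox (1 : A^c).
Let d k : T := t *: (e k \ox (1 : A^c) - (1 : A) \ox (e k : A^c)).

Lemma uvd k : u k = v k + d k.
Proof.
rewrite /u /v /d /gfac scalerBr ptensBl ptensZl.
rewrite addrA subrK -[(1 - t *: e k : A^c)]/((1 : A^c) - t *: (e k : A^c)).
by rewrite ptensBr ptensZr.
Qed.

Lemma g_e_comm k l : GRing.comm (g k) (e l).
Proof.
apply/commr_sym/commrB; first exact: commr1.
by rewrite /GRing.comm -scalerAl -scalerAr eC.
Qed.

Lemma gfac_comm k l : GRing.comm (g k) (g l).
Proof.
apply: commrB; first exact: commr1.
by rewrite /GRing.comm -scalerAl -scalerAr g_e_comm.
Qed.

Lemma vd_comm k l : GRing.comm (v k) (d l).
Proof.
rewrite /GRing.comm /v /d -tens_scaleAr -tens_scaleAl; congr (_ *: _).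
by rewrite mulrBr mulrBl !ptensM !mulr1 !mul1r g_e_comm.
Qed.

Lemma lract_u x (m : 'I_n -> nat) :
  lract x (\prod_k u k ^+ m k) = x * \prod_k g k ^+ m k.
Proof.
elim: (index_enum _) => [|k r IH].
  by rewrite !big_nil lractE mul1r.
rewrite !big_cons lractM IH /u ptensX expr1n lractE mul1r -mulrA; congr (_ * _).
rewrite [X in _ * X]revrX; apply/commr_sym/commr_prod => l _.
exact/commrX/commr_sym/commrX/gfac_comm.
Qed.

Lemma lract_v y (m : 'I_n -> nat) :
  lract y (\prod_k v k ^+ m k) = (\prod_k g k ^+ m k) * y.
Proof.
elim: (index_enum _) => [|k r IH]; first by rewrite !big_nil lractE mulr1.
by rewrite !big_cons lractM IH /v ptensX expr1n lractE mulr1 mulrA.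
Qed.

Lemma lract_d x (l : 'I_n -> nat) :
  lract x (\prod_k d k ^+ l k) = t ^+ (\sum_k l k) *: adI l x.
Proof.
rewrite /adI; elim: (index_enum _) => [|k r IH].
  by rewrite !big_nil expr0 scale1r lractE mul1r mulr1.
rewrite !big_cons lractM IH /= exprD -scalerA; move: (\big[_/_]_(j <- r) _) => f.
have dE y : lract y (d k) = t *: ad k y.
  rewrite /d (linear_funZ (lract_linear y)); congr (_ *: _).
  have D := linear_funD (lract_linear y); have Z := linear_funZ (lract_linear y).
  by rewrite -scaleN1r D Z scaleN1r !lractE mulr1 mul1r.
have adZ r' y : ad k (r' *: y) = r' *: ad k y by exact: (linear_funZ (ad_linear k)).
have dZ r' y z : lract (r' *: y) z = r' *: lract y z.
  have LD y' := linear_funD (lract_linear y').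
  elim/(@tens_ind R A A^c): z => [|a b|z1 z2 IH1 IH2].
  - by rewrite !(linear_fun0 (lract_linear _)) scaler0.
  - by rewrite !lractE -scalerAr -scalerAl.
  - by rewrite !LD IH1 IH2 scalerDr.
rewrite dZ scalerA mulrC -scalerA; congr (_ *: _).
elim: (l k) => [|m IHm]; first by rewrite !expr0 lractE mul1r mulr1 scale1r.
by rewrite exprS lractM IHm dE adZ scalerA -exprS.
Qed.

(** The binomial expansion of right multiplication by the g_k. *)
Lemma expand_right x (m : 'I_n -> nat) : (forall k, m k < p)%N ->
  x * \prod_k g k ^+ m k = \sum_(l : {ffun 'I_n -> 'I_p})
    (\prod_k 'C(m k, l k))%:R *:
      ((\prod_k g k ^+ (m k - l k)) * (t ^+ (\sum_k l k) *: adI (fun k => l k) x)).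
Proof.
move=> mp; rewrite -lract_u.
have E k : u k ^+ m k = \sum_(i < p) (v k ^+ (m k - i) * d k ^+ i) *+ 'C(m k, i).
  rewrite uvd exprDn_comm; last exact: vd_comm.
  rewrite (big_ord_widen p (fun i => (v k ^+ (m k - i) * d k ^+ i) *+ 'C(m k, i))) //.
  rewrite big_mkcond; apply: eq_bigr => i _; rewrite ltnS; case: leqP => // mi.
  by rewrite bin_small ?mulr0n.
under eq_bigr => k _ do rewrite E.
rewrite (bigA_distr_bigA (fun k (i : 'I_p) => (v k ^+ (m k - i) * d k ^+ i) *+ 'C(m k, i))).
rewrite (linear_fun_sum (lract_linear x)); apply: eq_bigr => l _.
have -> : \prod_k ((v k ^+ (m k - l k) * d k ^+ l k) *+ 'C(m k, l k))
   = (\prod_k 'C(m k, l k))%:R *: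
     ((\prod_k v k ^+ (m k - l k)) * \prod_k d k ^+ l k).
  rewrite -prodrM_comm; last first.
    by move=> i j _ _; apply/commrX/commr_sym/commrX/commr_sym/vd_comm.
  elim: (index_enum _) => [|k r IH]; first by rewrite !big_nil scale1r.
  rewrite !big_cons IH natrM -scalerA -[X in X * _]scaler_nat.
  by rewrite -tens_scaleAl -tens_scaleAr.
by rewrite (linear_funZ (lract_linear x)) lractM lract_v lract_d.
Qed.

End Expansion.

HB.instance Definition _ (aT : finType) (rT : finZmodType) :=
  GRing.Zmodule.on {ffun aT -> rT}.

(** * The twist attached to commuting copies of the affine Lie algebra *)

Section Cartan.
Context {R : comNzRingType} (A : algType R) (H : hopf_structure A).
Context (p n : nat) (h e : 'I_n -> A) (t : R).
Local Notation D := (coproduct H).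
Local Notation eps := (counit H).
Local Notation S := (antipode H).
Local Notation Gam := {ffun 'I_n -> 'F_p}.

Definition cartanP (j : Gam) : A := \prod_k eigenproj (h k) (j k).
Local Notation g := (gfac e t).
Definition cartanG (j : Gam) : A := \prod_k g k ^+ (j k : nat).
Definition weight (la : Gam) (x : A) :=
  forall k, h k * x = x * (h k + fp A (la k)).

Hypotheses (pr_p : prime p) (p0 : p%:R = 0 :> A).
Hypothesis S1 : S 1 = 1.
Hypothesis SM : forall x y, S (x * y) = S y * S x.
Hypothesis hC : forall k l, GRing.comm (h k) (h l).
Hypothesis eC : forall k l, GRing.comm (e k) (e l).
Hypothesis heC : forall k l, k != l -> GRing.comm (h k) (e l).
Hypothesis he : forall k, h k * e k = e k * (h k + 1).
Hypothesis hX : forall k, h k ^+ p = h k.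
Hypothesis eX : forall k, e k ^+ p = 0.
Hypothesis Dh : forall k, D (h k) = h k \ox 1 + 1 \ox h k.
Hypothesis De : forall k, D (e k) = e k \ox 1 + 1 \ox e k.
Hypothesis epsh : forall k, eps (h k) = 0.
Hypothesis epse : forall k, eps (e k) = 0.
Hypothesis Sh : forall k, S (h k) = - h k.
Hypothesis Se : forall k, S (e k) = - e k.

Lemma proj_comm k l (i j : 'F_p) :
  GRing.comm (eigenproj (h k) i) (eigenproj (h l) j).
Proof. by apply: eigenproj_comm; apply: eigenproj_comm. Qed.

Lemma cartanPM i j : cartanP i * cartanP j = (i == j)%:R *: cartanP j.
Proof.
rewrite /cartanP -prodrM_comm; last by move=> k l _ _; apply: proj_comm.
under eq_bigr => k _ do rewrite (eigenprojM pr_p p0 (hX k)).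
by rewrite (prod_bool (fun k => i k == j k)) all_ffun_eq mulr_natl scaler_nat.
Qed.

Lemma sum_cartanP : \sum_j cartanP j = 1.
Proof.
rewrite /cartanP -(bigA_distr_bigA (fun k (j : 'F_p) => eigenproj (h k) j)).
by rewrite big1 // => k _; rewrite sum_eigenproj.
Qed.

Lemma coproduct_eigenproj k (j : 'F_p) : D (eigenproj (h k) j)
  = \sum_(i : 'F_p) (eigenproj (h k) i \ox eigenproj (h k) (j - i)).
Proof.
have p0T : p%:R = 0 :> tens A A by rewrite -(rmorph_nat D) p0 raddf0.
rewrite rmorph_eigenproj /= Dh.
pose X : tens A A := h k \ox 1 + 1 \ox h k.
have XP (a b : 'F_p) :
    X * (eigenproj (h k) a \ox eigenproj (h k) b)
    = fp (tens A A) (a + b) * (eigenproj (h k) a \ox eigenproj (h k) b).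
  have natT m (u v : A) : m%:R * (u \ox v) = (m%:R * u) \ox v :> tens A A.
    by rewrite !mulr_natl -!scaler_nat ptensZl.
  have natTr m (u v : A) : m%:R * (u \ox v) = u \ox (m%:R * v) :> tens A A.
    by rewrite !mulr_natl -!scaler_nat ptensZr.
  rewrite /X mulrDl !ptensM !mul1r !(eigenprojP pr_p p0) // fpD // mulrDl.
  by rewrite natT natTr.
transitivity (\sum_(a : 'F_p) \sum_(b : 'F_p)
    (j == a + b)%:R * (eigenproj (h k) a \ox eigenproj (h k) b)).
  have E1 : 1 = \sum_(a : 'F_p) \sum_(b : 'F_p)
      (eigenproj (h k) a \ox eigenproj (h k) b) :> tens A A.
    transitivity ((\sum_(a : 'F_p) eigenproj (h k) a)
      \ox (\sum_(b : 'F_p) eigenproj (h k) b)); first by rewrite sum_eigenproj.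
    by rewrite ptens_suml; apply: eq_bigr => a _; rewrite ptens_sumr.
  rewrite -[LHS]mulr1 [X in _ * X = _]E1 mulr_sumr; apply: eq_bigr => a _.
  rewrite mulr_sumr; apply: eq_bigr => b _.
  by rewrite (eigenproj_act pr_p p0T _ (XP a b)).
apply: eq_bigr => a _; rewrite (bigD1 (j - a)) //= [a + _]addrC subrK eqxx mul1r.
rewrite big1 ?addr0 // => b; apply: contraNeq.
case: (j =P a + b) => [-> _|_]; last by rewrite mul0r eqxx.
by rewrite addrAC subrr add0r.
Qed.

Lemma coproduct_cartanP j : D (cartanP j) = \sum_i (cartanP i \ox cartanP (j - i)).
Proof.
rewrite /cartanP rmorph_prod /=.
under eq_bigr => k _ do rewrite coproduct_eigenproj.
rewrite (bigA_distr_bigA (fun k (i : 'F_p) =>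
  eigenproj (h k) i \ox eigenproj (h k) (j k - i) : tens A A)).
apply: eq_bigr => f _; rewrite prod_ptens; congr (_ \ox _).
by apply: eq_bigr => k _; rewrite !ffunE.
Qed.

Lemma counit_cartanP j : eps (cartanP j) = (j == 0)%:R.
Proof.
have p0R : p%:R = 0 :> R^o by rewrite -(rmorph_nat eps) p0 raddf0.
rewrite /cartanP rmorph_prod /=.
have E k : eps (eigenproj (h k) (j k)) = (j k == 0)%:R * 1.
  rewrite rmorph_eigenproj /= epsh -[LHS]mulr1.
  by rewrite (eigenproj_act pr_p p0R (c := 0)) ?mulr1 // fp0 ?mul0r.
under eq_bigr => k _ do rewrite E.
rewrite (prod_bool (fun k => j k == 0)) big1 // mulr1; congr ((nat_of_bool _)%:R).
by rewrite -all_ffun_eq; apply: eq_all => k; rewrite ffunE.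
Qed.

Lemma antipode_cartanP j : S (cartanP j) = cartanP (- j).
Proof.
have E k : S (eigenproj (h k) (j k)) = eigenproj (h k) (- j k).
  by apply: anti_eigenproj => //; apply: raddfB.
rewrite /cartanP (@prod_anti A _ S _ _ S1 SM) => [|k l]; last by rewrite !E; apply: proj_comm.
by apply: eq_bigr => k _; rewrite E ffunE.
Qed.

Lemma weight_cartanP la x j : weight la x -> x * cartanP j = cartanP (j + la) * x.
Proof.
move=> wx; rewrite /cartanP.
elim: (index_enum _) => [|k r IH]; first by rewrite !big_nil mulr1 mul1r.
rewrite !big_cons mulrA (eigenproj_shift pr_p p0 _ (wx k)) -mulrA IH mulrA.
by rewrite ffunE.
Qed.

(** Frobenius, since e_k ^+ p = 0. *)
Lemma gfacXp k : g k ^+ p = 1.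
Proof.
rewrite /gfac (exprDp_comm pr_p p0); last first.
  exact/commr_sym/commr1.
rewrite expr1n exprN_pchar //.
have -> m : (t *: e k) ^+ m = t ^+ m *: e k ^+ m by rewrite exprZn.
by rewrite eX scaler0 oppr0 addr0.
Qed.

Lemma gfac_modp k m : g k ^+ (m %% p) = g k ^+ m.
Proof.
by rewrite {2}(divn_eq m p) exprD mulnC exprM gfacXp expr1n mul1r.
Qed.

Lemma gfac_nat k m : g k ^+ (m%:R : 'F_p) = g k ^+ m.
Proof. by rewrite val_Fp_nat ?prime_gt1 // gfac_modp. Qed.

Lemma gfacD k (i j : 'F_p) : g k ^+ (i + j)%R = g k ^+ i * g k ^+ j.
Proof. by rewrite -exprD -[RHS]gfac_nat natrD !natr_Zp. Qed.

Lemma cartanGD i j : cartanG (i + j) = cartanG i * cartanG j.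
Proof.
rewrite /cartanG -prodrM_comm; last by move=> k l _ _; apply/commrX/commr_sym/commrX/gfac_comm.
by apply: eq_bigr => k _; rewrite ffunE gfacD.
Qed.

Lemma cartanG0 : cartanG 0 = 1.
Proof. by rewrite /cartanG big1 // => k _; rewrite ffunE expr0. Qed.

Lemma counit_cartanG j : eps (cartanG j) = 1.
Proof.
rewrite /cartanG rmorph_prod big1 // => k _.
rewrite rmorphXn /gfac /= rmorphB /= rmorph1 linearZ /= epse.
by rewrite scaler0 subr0 expr1n.
Qed.

Lemma cartanG_e k j : GRing.comm (e k) (cartanG j).
Proof.
apply/commr_prod => l _; apply/commrX/commrB; first exact: commr1.
by rewrite /GRing.comm -scalerAl -scalerAr eC.
Qed.

Definition gdelta (k : 'I_n) : Gam := [ffun l => (l == k)%:R].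

Lemma cartanG_delta k : cartanG (gdelta k) = g k.
Proof.
rewrite /cartanG (eq_bigr (fun l => if l == k then g k else 1)); last first.
  move=> l _; rewrite ffunE gfac_nat; case: eqP => [->|_]; last exact: expr0.
  exact: expr1.
elim: (index_enum _) (index_enum_uniq 'I_n) (mem_index_enum k).
  by [].
move=> l r IH /= /andP[lr ur]; rewrite in_cons big_cons.
have [kl|kl] := eqVneq k l.
  move=> _; rewrite big1_seq ?mulr1 // => m /= mr; case: eqP => // mk.
  by move: lr; rewrite -kl -mk mr.
by move=> /= kr; rewrite mul1r IH.
Qed.

Lemma weight_e k : weight (gdelta k) (e k).
Proof.
move=> l; rewrite ffunE; have [->|lk] := eqVneq l k; first by rewrite fp1.
by rewrite fp0 // addr0; apply: heC.
Qed.

Local Notation F := (twist cartanP cartanG).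

(** Moving an element of weight la across P_j shifts j by la, and the right leg
    compensates with G_la. *)
Lemma twist_weight_l la x : weight la x ->
  F * (x \ox 1) = (x \ox cartanG la) * F.
Proof.
move=> wx; rewrite /twist mulr_suml mulr_sumr.
rewrite [LHS](reindex_inj (addIr la)) /=; apply: eq_bigr => j _.
by rewrite !ptensM mulr1 (weight_cartanP _ wx) addrC cartanGD.
Qed.

Lemma twist_comm_r x : (forall j, GRing.comm x (cartanG j)) ->
  F * (1 \ox x) = (1 \ox x) * F.
Proof.
move=> xG; rewrite /twist mulr_suml mulr_sumr; apply: eq_bigr => j _.
by rewrite !ptensM mulr1 mul1r xG.
Qed.

(** As e_k has weight 1, the twist multiplies the right leg of e_k (x) 1 by g_k,
    and e_k (x) g_k + 1 (x) e_k is the skew-primitive form for which 1 - t e_k is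
    group-like. *)
Lemma grouplike_gfac k : F * D (g k) = (g k \ox g k) * F.
Proof.
rewrite /gfac rmorphB /= rmorph1 linearZ /= De -/(g k) mulrBr mulr1.
rewrite -tens_scaleAr mulrDr (twist_weight_l (@weight_e k)) cartanG_delta.
rewrite twist_comm_r; last exact: cartanG_e.
rewrite -mulrDl tens_scaleAl -[X in X - _]mul1r -mulrBl; congr (_ * _).
rewrite [in RHS]/gfac ptensBl ptensZl scalerDr opprD addrA addrAC.
by congr (_ - _); rewrite -ptensZr /gfac ptensBr.
Qed.

Lemma grouplike_cartanG j : F * D (cartanG j) = (cartanG j \ox cartanG j) * F.
Proof.
rewrite [cartanG j]/cartanG rmorph_prod /= -prod_ptens.
elim: (index_enum _) => [|k r IH]; first by rewrite !big_nil mulr1 mul1r.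
rewrite !big_cons mulrA; suff -> : F * D (g k ^+ j k) =
    (g k ^+ j k \ox g k ^+ j k) * F by rewrite -!mulrA IH.
elim: (j k : nat) => [|m IHm]; first by rewrite !expr0 rmorph1 mulr1 mul1r.
rewrite exprS rmorphM /= mulrA grouplike_gfac -mulrA IHm mulrA ptensM.
by rewrite -exprS.
Qed.

Theorem cartan_twist :
  exists H' : hopf_structure A,
    [/\ forall x, coproduct H' x = F * D x * twist_inv cartanP cartanG,
        forall x, antipode H' x = rconv H 1 F * S x * lconv H 1 (twist_inv cartanP cartanG) &
        forall x, counit H' x = eps x].
Proof.
apply: group_twist => //.
- exact: cartanPM.
- exact: sum_cartanP.
- exact: coproduct_cartanP.
- exact: counit_cartanP.
- exact: antipode_cartanP.
- exact: cartanGD.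
- exact: cartanG0.
- exact: counit_cartanG.
- exact: grouplike_cartanG.
Qed.

(** The relation g_k h_k = h_k g_k + t e_k, where g_k ^+ p.-1 is the inverse
    of g_k. *)
Lemma gfac_h k m : g k ^+ m * h k
  = h k * g k ^+ m + (m%:R * t) *: (e k * g k ^+ p.-1 * g k ^+ m).
Proof.
have gh : g k * h k = h k * g k + t *: e k.
  rewrite /gfac mulrBr mulrBl mulr1 mul1r -scalerAl -scalerAr he mulrDr mulr1.
  by rewrite scalerDr opprD addrA subrK.
have ge : g k * e k = e k * g k by exact: g_e_comm.
elim: m => [|m IH]; first by rewrite !expr0 mul1r mulr1 mul0r scale0r addr0.
rewrite exprS -mulrA IH mulrDr mulrA gh mulrDl -mulrA -scalerAl -scalerAr.
rewrite -addrA; congr (_ + _).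
have -> : g k * (e k * g k ^+ p.-1 * g k ^+ m) = e k * g k ^+ p.-1 * (g k * g k ^+ m).
  by rewrite !mulrA ge -!mulrA; congr (_ * _); rewrite !mulrA -exprS -exprSr.
have <- : e k * g k ^+ p.-1 * (g k * g k ^+ m) = e k * g k ^+ m.
  by rewrite -!mulrA [g k ^+ _ * _]mulrA -exprSr prednK ?prime_gt0 // gfacXp mul1r.
by rewrite -scalerDl; congr (_ *: _); rewrite mulrS mulrDl mul1r.
Qed.

(** Conjugating 1 (x) h_k by the twist adds a multiple of t e_k g_k^-1 that counts
    the eigenvalue of h_k on the left leg; the result is not symmetric. *)
Lemma twist_h k : F * D (h k) * twist_inv cartanP cartanG
  = h k \ox 1 + 1 \ox h k + t *: (h k \ox (e k * g k ^+ p.-1)).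
Proof.
have FK := twistK cartanPM sum_cartanP cartanGD cartanG0.
suff E : F * D (h k) = (h k \ox 1 + 1 \ox h k + t *: (h k \ox (e k * g k ^+ p.-1))) * F.
  by rewrite E -mulrA FK mulr1.
have hP j : h k * cartanP j = fp A (j k) * cartanP j.
  rewrite /cartanP; elim: (index_enum _) (mem_index_enum k) => // l r IH.
  rewrite in_cons !big_cons [LHS]mulrA => /predU1P[<-|kr].
    by rewrite (eigenprojP pr_p p0) // [RHS]mulrA.
  have hl : GRing.comm (h k) (eigenproj (h l) (j l)) by exact: eigenproj_comm.
  by rewrite hl -mulrA IH // [LHS]mulrA [RHS]mulrA (fp_comm (j k)).
have Ph j : cartanP j * h k = fp A (j k) * cartanP j.
  rewrite -hP; apply/commr_sym/commr_prod => l _; exact: eigenproj_comm.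
have Gh j : cartanG j * h k = h k * cartanG j
    + ((j k)%:R * t) *: (e k * g k ^+ p.-1 * cartanG j).
  have gE l (m : nat) : GRing.comm (g l ^+ m) (e k * g k ^+ p.-1).
    apply/commr_sym/commrX/commr_sym/commrM; first exact: g_e_comm.
    exact/commrX/gfac_comm.
  suff key (r : seq 'I_n) : uniq r -> (\prod_(l <- r) g l ^+ j l) * h k
      = h k * (\prod_(l <- r) g l ^+ j l) + (if k \in r then (j k)%:R * t else 0)
        *: (e k * g k ^+ p.-1 * \prod_(l <- r) g l ^+ j l).
    by rewrite /cartanG key ?index_enum_uniq // mem_index_enum.
  elim: r => [|l r IH] /=; first by rewrite !big_nil scale0r addr0 mul1r mulr1.
  case/andP=> lr ur; rewrite !big_cons in_cons; move: IH; set Q := \prod_(_ <- _) _.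
  move=> /(_ ur) IH; rewrite -mulrA IH mulrDr -scalerAr.
  have gQ : g l ^+ j l * (e k * g k ^+ p.-1 * Q) = e k * g k ^+ p.-1 * (g l ^+ j l * Q).
    by rewrite [LHS]mulrA gE [RHS]mulrA.
  have [kl|kl] := eqVneq k l; last first.
    rewrite gQ [X in X + _ = _]mulrA; congr (_ + _); rewrite [RHS]mulrA; congr (_ * _).
    apply/commr_sym/commrX/commrB; first exact: commr1.
    by rewrite /GRing.comm -scalerAl -scalerAr heC.
  move: gQ; rewrite -kl => gQ; move: lr; rewrite -kl => /negPf ->.
  rewrite scale0r addr0 [LHS]mulrA gfac_h mulrDl -scalerAl.
  by rewrite -[X in X + _]mulrA -[X in _ + _ *: X]mulrA.
rewrite Dh /twist mulr_suml mulr_sumr; apply: eq_bigr => j _ /=.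
rewrite mulrDr !mulrDl -tens_scaleAl !ptensM !mul1r !mulr1 Ph hP Gh ptensDr addrA.
congr (_ + _).
by rewrite !ptensZr mulrC -scalerA mulr_natl -[in RHS]scaler_nat ptensZl.
Qed.

(** ** The coproduct of a primitive element of weight la *)

Hypothesis p0R : p%:R = 0 :> R.
Variables (ifac : midx p n -> R) (la : Gam) (x : A).
Hypothesis ifacP : forall l, ifac l * (\prod_k (l k)`!)%:R = 1.
Hypothesis wx : weight la x.
Hypothesis Dx : D x = x \ox 1 + 1 \ox x.
Hypothesis Sx : S x = - x.

(** The divided power d^(l) of the adjoint action of the e_k, ifac l standing for
    the inverse of the product of the l_k!. *)
Definition divadA (l : midx p n) : A := ifac l *: adI e (fun k => l k) x.
(** The product of the rising factorials of h_k + a with l_k factors. *)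
Definition hrise (a : nat) (l : midx p n) : A :=
  \prod_k \prod_(i < l k) (h k + (a + i)%:R).
Definition degvec (l : midx p n) : Gam := [ffun k => (l k : nat)%:R].
Definition degree (l : midx p n) : nat := \sum_k l k.

Lemma adI_divadA (l : midx p n) : adI e (fun k => l k) x = (\prod_k (l k)`!)%:R *: divadA l.
Proof. by rewrite /divadA scalerA mulrC ifacP scale1r. Qed.

Lemma natr_ffact (B : pzRingType) m l : (m ^_ l)%:R = \prod_(i < l) (m%:R - i%:R) :> B.
Proof.
elim: l => [|l IH]; first by rewrite big_ord0.
rewrite ffactnSr big_ord_recr /= -IH natrM.
have [lm|ml] := leqP l m; first by rewrite natrB.
by rewrite ffact_small // !mul0r.
Qed.

(** Modulo p the falling factorial of - (j + a) is, up to sign, the rising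
    factorial of j + a. *)
Lemma binom_rising (a l : nat) (j : 'F_p) :
  ('C((- (j + a%:R) : 'F_p)%R, l) * l`!)%:R
    = (-1) ^+ l * (\prod_(i < l) (j + (a + i)))%:R :> R.
Proof.
rewrite bin_ffact natr_ffact.
transitivity (\prod_(i < l) - ((j + (a + i))%:R : R)).
  apply: eq_bigr => i _; rewrite -[_%:R in X in X - _]/(fp R (- (j + a%:R))).
  by rewrite fpN // fpD // fp_nat // -opprD -!natrD addnA.
by rewrite prodrN card_ord natr_prod.
Qed.

Definition risingN (a : nat) (l : midx p n) (j : Gam) : nat :=
  \prod_k \prod_(i < l k) (j k + (a + i)).

Lemma hrise_cartanP a l j : hrise a l * cartanP j = (risingN a l j)%:R *: cartanP j.
Proof.
have key k : (\prod_(i < l k) (h k + (a + i)%:R)) * eigenproj (h k) (j k)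
    = (\prod_(i < l k) (j k + (a + i)))%:R * eigenproj (h k) (j k).
  elim: (l k : nat) => [|m IH]; first by rewrite !big_ord0.
  rewrite !big_ord_recr /= -mulrA mulrDl (eigenprojP pr_p p0) // -mulrDl -natrD.
  by rewrite mulr_natl mulrnAr IH -mulrnAl -mulr_natr -natrM.
rewrite /hrise /cartanP -prodrM_comm; last first.
  move=> i k _ _; apply/commr_sym/commr_prod => m _.
  apply/commrD; last exact/commr_nat.
  by apply/commr_sym/eigenproj_comm/commr_sym.
rewrite (eq_bigr _ (fun k _ => key k)) scaler_nat /risingN.
elim: (index_enum _) => [|k r IH]; first by rewrite !big_nil.
rewrite !big_cons IH; set N := (\prod_(i < l k) _)%N; set N' := (\prod_(_ <- r) _)%N.
by rewrite mulr_natl mulrnAl mulrnAr -mulrnA mulnC.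
Qed.

Lemma hrise_sum a l : hrise a l = \sum_j (risingN a l j)%:R *: cartanP j.
Proof.
by rewrite -[LHS]mulr1 -sum_cartanP mulr_sumr; apply: eq_bigr => j _; apply: hrise_cartanP.
Qed.

Lemma Fp_lt (j : Gam) k : (j k < p)%N.
Proof. by rewrite -[X in (_ < X)%N](card_Fp pr_p) card_ord ltn_ord. Qed.

Lemma coef_rising a (l : midx p n) (j : Gam) :
  (\prod_k 'C((- (j k + a%:R) : 'F_p)%R, l k))%:R * (\prod_k (l k)`!)%:R
  = (-1) ^+ degree l * (risingN a l j)%:R :> R.
Proof.
rewrite -natrM -big_split natr_prod /= (eq_bigr _ (fun k _ => binom_rising a (l k) (j k))).
by rewrite big_split /= prodrXr -natr_prod.
Qed.

(** The binomial coefficient vanishes when i_k < l_k for some k, so that the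
    truncated subtraction does no harm. The parameter s is t for the coproduct and
    - t for the antipode, which maps g_k to 1 + t e_k. *)
Lemma expand_shift (s : R) (i j : Gam) (l : midx p n) (Z : A) :
  (forall k m, gfac e s k ^+ (m%:R : 'F_p) = gfac e s k ^+ m) ->
  (\prod_k 'C((i k : 'F_p), l k))%:R *:
    ((\prod_k gfac e s k ^+ (j k)) * ((\prod_k gfac e s k ^+ (i k - l k)) * Z))
  = (\prod_k 'C((i k : 'F_p), l k))%:R *:
    ((\prod_k gfac e s k ^+ ((i + j - degvec l)%R k)) * Z).
Proof.
move=> gn; have [/forallP li|] := boolP [forall k, l k <= i k]%N; last first.
  rewrite negb_forall => /existsP[k]; rewrite -ltnNge => ilk.
  have -> : (\prod_k 'C((i k : 'F_p), l k) = 0)%N.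
    by rewrite (bigD1 k) //= bin_small.
  by rewrite !scale0r.
congr (_ *: _); rewrite mulrA -prodrM_comm; last first.
  by move=> k m _ _; apply/commrX/commr_sym/commrX/gfac_comm.
congr (_ * _); apply: eq_bigr => k _; rewrite -exprD -gn -[RHS]gn.
congr (_ ^+ nat_of_ord _); rewrite natrD natrB // !natr_Zp !ffunE.
by rewrite addrCA addrA.
Qed.

Lemma cartanG_conj j : cartanG j * x * cartanG (- j) = \sum_(l : midx p n)
  ((-1) ^+ degree l * (risingN 0 l j)%:R) *:
     (t ^+ degree l *: (cartanG (- degvec l) * divadA l)).
Proof.
rewrite -mulrA /cartanG.
rewrite (@expand_right R A p n e t eC x (fun k => (- j)%R k : nat)); last exact: Fp_lt.
rewrite mulr_sumr; apply: eq_bigr => l _; rewrite -scalerAr.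
rewrite (expand_shift _ _ _ _ gfac_nat) addNr sub0r -coef_rising.
have -> : \prod_k 'C((- j)%R k, l k) = \prod_k 'C((- (j k + 0%:R) : 'F_p)%R, l k).
  by apply: eq_bigr => k _; rewrite ffunE addr0.
rewrite adI_divadA -!scalerAr !scalerA; congr (_ *: _).
by rewrite /degree; ring.
Qed.

(** On the range of P_j the element hrise 0 l is the scalar that the binomial
    expansion of G_j x G_(- j) produces. *)
Theorem twisted_coproduct : F * D x * twist_inv cartanP cartanG
  = x \ox cartanG la + \sum_(l : midx p n)
    (-1) ^+ degree l *:
      (hrise 0 l \ox (t ^+ degree l *: (cartanG (- degvec l) * divadA l))).
Proof.
have FK := twistK cartanPM sum_cartanP cartanGD cartanG0.
rewrite Dx mulrDr mulrDl (twist_weight_l wx) -mulrA FK mulr1; congr (_ + _).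
transitivity (\sum_j (cartanP j \ox (cartanG j * x * cartanG (- j)))).
  have -> : F * (1 \ox x) = \sum_j (cartanP j \ox (cartanG j * x)).
    by rewrite /twist mulr_suml; apply: eq_bigr => j _; rewrite ptensM mulr1.
  rewrite /twist_inv mulr_suml.
  under eq_bigr => i _ do rewrite mulr_sumr.
  under eq_bigr => i _ do under eq_bigr => j _ do rewrite ptensM.
  rewrite (sum_PP cartanPM (f := fun i j y => y \ox (cartanG i * x * cartanG (- j)))) //.
  by move=> i j r y z; rewrite ptensDl ptensZl.
under eq_bigr => j _ do rewrite cartanG_conj ptens_sumr.
rewrite exchange_big; apply: eq_bigr => l _ /=.
rewrite hrise_sum ptens_suml scaler_sumr; apply: eq_bigr => j _.
by rewrite ptensZr ptensZl scalerA.
Qed.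

(** ** The antipode of a primitive element of weight la *)

Local Notation v := (rconv H 1 F).
Local Notation vinv := (lconv H 1 (twist_inv cartanP cartanG)).
Local Notation gS := (gfac e (- t)).

Lemma antipode_gfac k : S (g k) = gS k.
Proof. by rewrite /gfac raddfB /= S1 linearZ /= Se scalerN scaleNr. Qed.

Lemma antipode_exp y m : S (y ^+ m) = S y ^+ m.
Proof. by elim: m => // m IH; rewrite exprS exprSr SM IH. Qed.

Lemma antipode_cartanG j : S (cartanG j) = \prod_k gS k ^+ (j k).
Proof.
rewrite /cartanG (@prod_anti A _ S _ _ S1 SM) => [|k l].
  by apply: eq_bigr => k _; rewrite antipode_exp antipode_gfac.
by rewrite !antipode_exp !antipode_gfac; apply/commrX/commr_sym/commrX/gfac_comm.
Qed.

Lemma gS_nat k m : gS k ^+ (m%:R : 'F_p) = gS k ^+ m.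
Proof. by rewrite -antipode_gfac -!antipode_exp gfac_nat. Qed.

(** Between the eigenprojectors for i and j only the power e_k ^+ s with
    s = i - j modulo p survives. For i <> j this s exceeds by one the exponent
    i - j - 1, so that the binomial expansion does not contain it. *)
Lemma proj_gS_proj k (i j : 'F_p) :
  eigenproj (h k) i * gS k ^+ (i - j - 1)%R * eigenproj (h k) j
  = (i == j)%:R * eigenproj (h k) j.
Proof.
have eP s (c : 'F_p) :
    e k ^+ s * eigenproj (h k) c = eigenproj (h k) (c + s%:R) * e k ^+ s.
  elim: s c => [|s IH] c; first by rewrite addr0 mul1r mulr1.
  rewrite exprSr -mulrA (eigenproj_shift (la := 1) pr_p p0); last first.
    by rewrite fp1.
  by rewrite mulrA IH -mulrA -exprSr mulrS addrA.
have Zn s : (t *: e k) ^+ s = t ^+ s *: e k ^+ s by rewrite exprZn.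
rewrite /gfac scaleNr opprK exprDn_comm; last exact/commr_sym/commr1.
set a := nat_of_ord _; have ap : (a < p)%N.
  by rewrite -[X in (_ < X)%N](card_Fp pr_p) card_ord ltn_ord.
have term (s : 'I_a.+1) :
    eigenproj (h k) i * ((1 ^+ (a - s) * (t *: e k) ^+ s) *+ 'C(a, s)) * eigenproj (h k) j
    = (t ^+ s *+ 'C(a, s)) *: ((i == j + s%:R)%:R * (eigenproj (h k) (j + s%:R) * e k ^+ s)).
  have E : eigenproj (h k) i * e k ^+ s * eigenproj (h k) j
      = (i == j + s%:R)%:R * (eigenproj (h k) (j + s%:R) * e k ^+ s).
    by rewrite -mulrA eP mulrA (eigenprojM pr_p p0 (hX k)) -mulrA.
  rewrite expr1n mul1r Zn -scaler_nat scalerA -!scalerAr -scalerAl E.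
  by rewrite mulr_natl.
rewrite mulr_sumr mulr_suml (eq_bigr _ (fun s _ => term s)).
have sE (s : 'I_a.+1) : (s%:R : 'F_p) = i - j -> s = (i - j)%R :> nat.
  move=> <-; rewrite val_Fp_nat ?prime_gt1 // modn_small //.
  by apply: leq_ltn_trans ap; rewrite -ltnS ltn_ord.
have [ij|ij] := eqVneq i j.
  rewrite (bigD1 ord0) //= ij mulr0n addr0 eqxx bin0 expr0 scale1r !mulr1.
  rewrite big1 ?addr0 // => s s0; case: eqP => [js|_]; last by rewrite mul0r scaler0.
  have sd : s%:R = i - j :> 'F_p.
    by rewrite ij subrr; apply: (addrI j); rewrite -js addr0.
  by move: s0; rewrite -val_eqE /= (sE s sd) ij subrr.
rewrite mul0r big1 // => s _; case: eqP => [js|_]; last by rewrite mul0r scaler0.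
have d0 : i - j != 0 by rewrite subr_eq0.
have sd : s%:R = i - j :> 'F_p by rewrite js addrAC subrr add0r.
have sv := sE s sd; have s_gt0 : (0 < s)%N.
  by rewrite lt0n; apply: contra d0 => /eqP s0; rewrite -sd s0.
have as1 : a = s.-1.
  have E : i - j - 1 = (s.-1)%:R by rewrite -sd -subn1 natrB.
  transitivity (nat_of_ord ((s.-1)%:R : 'F_p)); first by rewrite -E.
  rewrite val_Fp_nat ?prime_gt1 // modn_small // (leq_ltn_trans _ ap) //.
  by rewrite (leq_trans (leq_pred _)) // -ltnS.
by have := ltn_ord s; rewrite {2}as1 prednK // ltnn.
Qed.

Lemma prodM_neq (a b : 'I_n -> A) : (forall k l, k != l -> GRing.comm (b k) (a l)) ->
  \prod_k (a k * b k) = (\prod_k a k) * \prod_k b k.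
Proof.
move=> ba; elim: (index_enum _) (index_enum_uniq 'I_n) => [_|k r IH /= /andP[kr ur]].
  by rewrite !big_nil mulr1.
rewrite !big_cons IH // -!mulrA; congr (_ * _); rewrite !mulrA; congr (_ * _).
rewrite big_seq; apply: commr_prod => l lr; apply: ba.
by apply: contraNneq kr => ->.
Qed.

Lemma proj_gS_comm k l (j : 'F_p) m : k != l ->
  GRing.comm (eigenproj (h k) j) (gS l ^+ m).
Proof.
move=> kl; apply/commrX/commrB; first exact: commr1.
rewrite /GRing.comm -scalerAl -scalerAr; congr (_ *: _).
by apply/commr_sym; apply: eigenproj_comm; apply: heC.
Qed.

(** The inverse of v, with the idempotents on the right so that a weight vector
    can be moved across it. *)
Definition wsum : A := \sum_(j : Gam) S (cartanG (- j - [ffun=> 1])) * cartanP j.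

Lemma v_wsum : v * wsum = 1.
Proof.
have key i j : cartanP i * S (cartanG i) * (S (cartanG (- j - [ffun=> 1])) * cartanP j)
    = (i == j)%:R *: cartanP j.
  rewrite -mulrA [S _ * (_ * _)]mulrA -SM -cartanGD antipode_cartanG.
  rewrite mulrA /cartanP -prodM_neq; last first.
    by move=> k l kl; apply/commr_sym/proj_gS_comm; rewrite eq_sym.
  rewrite -prodM_neq; last first.
    move=> k l kl; apply: commrM; first exact: proj_comm.
    exact: proj_gS_comm.
  rewrite (eq_bigr (fun k => (i k == j k)%:R * eigenproj (h k) (j k))); last first.
    move=> k _; rewrite -proj_gS_proj !ffunE; congr (_ * _ ^+ nat_of_ord _ * _).
    by rewrite [LHS]addrC addrA.
  by rewrite (prod_bool (fun k => i k == j k)) all_ffun_eq mulr_natl scaler_nat.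
rewrite rconv_twist /wsum mulr_suml -[RHS]sum_cartanP; apply: eq_bigr => i _.
rewrite mulr_sumr (bigD1 i) //= key eqxx scale1r big1 ?addr0 // => j.
by rewrite eq_sym key => /negPf->; rewrite scale0r.
Qed.

Lemma vinvE : vinv = wsum.
Proof.
have vv : vinv * v = 1.
  apply: lconv_rconv => //; [exact: cartanPM | exact: sum_cartanP
    | exact: antipode_cartanP | exact: cartanGD | exact: cartanG0
    | exact: counit_cartanG | exact: grouplike_cartanG].
by rewrite -[LHS]mulr1 -[X in _ * X = _]v_wsum mulrA vv mul1r.
Qed.

Lemma vinv_cartanP j :
  vinv * cartanP j = S (cartanG (- j - [ffun=> 1])) * cartanP j.
Proof.
rewrite vinvE /wsum mulr_suml (bigD1 j) //= -mulrA cartanPM eqxx scale1r.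
rewrite big1 ?addr0 // => i /negPf ij.
by rewrite -mulrA cartanPM ij scale0r mulr0.
Qed.

Lemma weightM mu nu y z : weight mu y -> weight nu z -> weight (mu + nu) (y * z).
Proof.
move=> wy wz k; rewrite mulrA wy -mulrA mulrDl wz (fp_comm _ z) // ffunE fpD //.
by rewrite -mulrDr -addrA [fp _ _ + _]addrC mulrA.
Qed.

Lemma weight_ad mu k y : weight mu y -> weight (mu + gdelta k) (ad e k y).
Proof.
move=> wy l; rewrite /ad mulrBr mulrBl; congr (_ - _).
  by rewrite [mu + _]addrC (weightM (@weight_e k) wy).
by rewrite (weightM wy (@weight_e k)).
Qed.

Lemma weight_divadA l : weight (la + degvec l) (divadA l).
Proof.
suff w : weight (la + degvec l) (adI e (fun k => l k) x).
  by move=> k; rewrite /divadA -scalerAr w scalerAl.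
have -> : degvec l = \sum_k (gdelta k *+ l k).
  apply/ffunP => k; rewrite sum_ffunE ffunE (bigD1 k) //= ffunMnE ffunE eqxx.
  rewrite big1 ?addr0 // => m /negPf mk.
  by rewrite ffunMnE ffunE eq_sym mk mul0rn.
rewrite /adI; elim: (index_enum _) => [|k r IH]; first by rewrite !big_nil addr0.
rewrite !big_cons addrCA addrC /=.
elim: (l k : nat) => [|m IHm]; first by rewrite mulr0n addr0.
by rewrite mulrSr addrA; apply: weight_ad.
Qed.

Lemma cartanP_inj y z : (forall j, y * cartanP j = z * cartanP j) -> y = z.
Proof.
move=> yz; rewrite -[y]mulr1 -[z]mulr1 -sum_cartanP !mulr_sumr.
exact: eq_bigr.
Qed.

(** The scalars of the expansion of x S(G) on the range of P_j; the sign of - t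
    cancels the sign of the binomial coefficient. *)
Lemma antipode_coef (l : midx p n) (j : Gam) (y : A) :
  (\prod_k 'C((- j - [ffun=> 1])%R k : 'F_p, l k))%:R *:
    ((- t) ^+ degree l *: ((\prod_k (l k)`!)%:R *: y))
  = ((risingN 1 l j)%:R * t ^+ degree l) *: y.
Proof.
have -> : \prod_k 'C((- j - [ffun=> 1])%R k : 'F_p, l k)
    = \prod_k 'C((- (j k + 1%:R) : 'F_p)%R, l k).
  by apply: eq_bigr => k _; rewrite !ffunE opprD.
by rewrite !scalerA; congr (_ *: _); rewrite mulrAC coef_rising [(- t) ^+ _]exprNn [LHS]mulrACA -expr2 sqrr_sign mul1r.
Qed.

(** It is enough to compare x v^-1 with v^-1 times the right-hand side on the range
    of each P_j. There v^-1 acts as S (G (- j - 1)), and the shift by 1 in the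
    exponent becomes the shift by 1 in hrise 1 l. *)
Theorem twisted_antipode : v * S x * vinv
  = - (cartanG (- la) * \sum_(l : midx p n) t ^+ degree l *: (divadA l * hrise 1 l)).
Proof.
have vv : v * vinv = 1.
  apply: rconv_lconv => //; [exact: cartanPM | exact: sum_cartanP
    | exact: antipode_cartanP | exact: cartanGD | exact: cartanG0
    | exact: counit_cartanG | exact: grouplike_cartanG].
have SGv j : S (cartanG j) * vinv = vinv * cartanG (- j).
  apply: SG_lconv => //; [exact: cartanPM | exact: sum_cartanP
    | exact: cartanGD | exact: cartanG0
    | exact: counit_cartanG | exact: grouplike_cartanG].
have vP := vinv_cartanP; rewrite Sx.
move: vinv v vv SGv vP => V v vv SGv vP.
rewrite mulrN mulNr; congr (- _).
suff E : x * V = V * (cartanG (- la) *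
    \sum_(l : midx p n) t ^+ degree l *: (divadA l * hrise 1 l)).
  by rewrite -mulrA E [LHS]mulrA vv mul1r.
apply: cartanP_inj => j; rewrite -mulrA vP mulrA.
have -> : V * (cartanG (- la) * \sum_(l : midx p n) t ^+ degree l *: (divadA l * hrise 1 l))
    * cartanP j = (\sum_(l : midx p n) ((risingN 1 l j)%:R * t ^+ degree l) *:
      (S (cartanG (- j - [ffun=> 1] - degvec l)) * divadA l)) * cartanP j.
  rewrite mulrA mulr_sumr !mulr_suml; apply: eq_bigr => l _.
  have Yw : divadA l * cartanP j = cartanP (j + (la + degvec l)) * divadA l.
    exact/weight_cartanP/weight_divadA.
  have -> : V * cartanG (- la) * (t ^+ degree l *: (divadA l * hrise 1 l)) * cartanP j
      = ((risingN 1 l j)%:R * t ^+ degree l) *: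
        (V * cartanG (- la) * (divadA l * cartanP j)).
    rewrite -scalerAr -scalerAl -!mulrA hrise_cartanP -!scalerAr scalerA.
    by rewrite mulrC.
  rewrite -[RHS]scalerAl -[in RHS]mulrA Yw; congr (_ *: _).
  rewrite -SGv mulrA -[S _ * V * _]mulrA vP !mulrA -SM -cartanGD.
  congr (S (cartanG _) * _ * _); apply/ffunP => k; rewrite !ffunE.
  ring.
congr (_ * _); rewrite antipode_cartanG.
rewrite (@expand_right R A p n e (- t) eC x (fun k => (- j - [ffun=> 1])%R k : nat)); last exact: Fp_lt.
apply: eq_bigr => l _.
have := expand_shift (- j - [ffun=> 1]) 0 l
  ((- t) ^+ degree l *: adI e (fun k => l k) x) gS_nat.
have -> : \prod_k gS k ^+ ((0%R : Gam) k) = 1.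
  by rewrite big1 // => k _; rewrite ffunE expr0.
rewrite mul1r addr0 -antipode_cartanG => ->.
by rewrite adI_divadA -!scalerAr antipode_coef.
Qed.

End Cartan.

(** * A basis of ordered monomials *)

Section OrderedMonomials.
Context {R : comNzRingType} (A : algType R) (p : nat) (X : finType) (b : X -> A).

Definition word (s : seq X) : A := \prod_(x <- s) b x.

Lemma word_cons x s : word (x :: s) = b x * word s.
Proof. exact: big_cons. Qed.

Lemma word_cat s s' : word (s ++ s') = word s * word s'.
Proof. exact: big_cat. Qed.

(** The bound on the length is strict, so that filt 0 vanishes and the error terms
    attached to word s belong to filt (size s). *)
Inductive filt (d : nat) : A -> Prop :=
| filt0 : filt d 0
| filtP r y z : filt d y -> filt d z -> filt d (r *: y + z)
| filt_word s : (size s < d)%N -> filt d (word s).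

Lemma filtD d y z : filt d y -> filt d z -> filt d (y + z).
Proof. by move=> fy fz; rewrite -[y]scale1r; apply: filtP. Qed.

Lemma filtZ d r y : filt d y -> filt d (r *: y).
Proof. by move=> fy; rewrite -[_ *: y]addr0; apply/filtP/filt0. Qed.

Lemma filtS d d' y : (d <= d')%N -> filt d y -> filt d' y.
Proof.
move=> dd; elim=> [|r {}y z _ fy _ fz|s sd]; first exact: filt0.
  exact: filtP.
exact/filt_word/(leq_trans sd).
Qed.

Lemma filt_mull d x y : filt d y -> filt d.+1 (b x * y).
Proof.
elim=> [|r {}y z _ fy _ fz|s sd]; first by rewrite mulr0; apply: filt0.
  by rewrite mulrDr -scalerAr; apply: filtP.
by rewrite -word_cons; apply: filt_word.
Qed.

Lemma filt_word_mul s d y : filt d y -> filt (size s + d) (word s * y).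
Proof.
move=> fy; elim: s => [|x s IH]; first by rewrite /word big_nil mul1r.
by rewrite word_cons -mulrA; apply: filt_mull.
Qed.

Lemma filtM d d' y z : filt d.+1 y -> filt d' z -> filt (d + d') (y * z).
Proof.
move=> fy fz; elim: fy => [|r {}y y' _ fy _ fy'|s sd].
- by rewrite mul0r; apply: filt0.
- by rewrite mulrDl -scalerAl; apply: filtP.
- by apply: filtS (filt_word_mul s fz); rewrite leq_add2r.
Qed.

Hypothesis b_brk : forall x y, filt 2 (b x * b y - b y * b x).
Hypothesis b_pow : forall x, filt 2 (b x ^+ p).
Hypothesis p_gt1 : (1 < p)%N.

Lemma word_brk x s : filt (size s).+1 (b x * word s - word s * b x).
Proof.
elim: s => [|y s IH].
  by rewrite /word big_nil mul1r mulr1 subrr; apply: filt0.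
rewrite word_cons mulrA -[_ - _](subrKA (b y * b x * word s)) -mulrBl.
apply: filtD; first by apply: (filtM (b_brk x y)); apply: filt_word.
by rewrite -!mulrA -mulrBr; apply: filt_mull.
Qed.

(** Each exchange of two letters costs a commutator, which is a combination of
    shorter words. *)
Lemma word_perm s s' : perm_eq s s' -> filt (size s) (word s - word s').
Proof.
elim: s s' => [|x s IH] s' ss'.
  by move: (perm_size ss') => /esym/size0nil ->; rewrite subrr; apply: filt0.
have /splitPr xs' : x \in s' by rewrite -(perm_mem ss') mem_head.
case: {s'} xs' ss' => s1 s2.
rewrite perm_sym -cat1s perm_catCA perm_cons perm_sym => ss.
rewrite word_cons word_cat word_cons -[_ - _](subrKA (b x * word (s1 ++ s2))) -mulrBr.
apply: filtD; first exact/filt_mull/IH.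
rewrite word_cat !mulrA -mulrBl.
apply: (@filtS (size s1 + (size s2).+1)); last first.
  by apply: filtM (word_brk _ _) _; apply: filt_word.
by rewrite /= (perm_size ss) size_cat addnS.
Qed.

Local Notation M := {ffun X -> 'I_p}.
Definition mseq (m : M) : seq X := flatten [seq nseq (m x) x | x <- enum X].
Definition mon (m : M) : A := word (mseq m).
Definition mdeg (m : M) : nat := size (mseq m).

Lemma count_mseq_gen (f : X -> nat) (r : seq X) x : uniq r ->
  count_mem x (flatten [seq nseq (f y) y | y <- r]) = ((x \in r) * f x)%N.
Proof.
elim: r => [|y r IH] //= /andP[yr ur]; rewrite count_cat count_nseq IH // in_cons.
rewrite /= [y == x]eq_sym; have [->|xy] := eqVneq x y; last by rewrite mul0n.
by rewrite (negPf yr) mul1n addn0.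
Qed.

Lemma count_mseq m x : count_mem x (mseq m) = m x.
Proof. by rewrite count_mseq_gen ?enum_uniq // mem_enum mul1n. Qed.

Lemma perm_mseq s (m : M) : (forall x, count_mem x s = m x) -> perm_eq s (mseq m).
Proof. by move=> E; apply/allP => x _ /=; rewrite E count_mseq. Qed.

(** Reordering brings equal letters together. Then p equal letters collapse by
    b_pow, and a word without p equal letters is an ordered monomial. *)
Lemma filt_mon d y : filt d y ->
  exists c : M -> R, (forall m, (d <= mdeg m)%N -> c m = 0) /\ y = \sum_m c m *: mon m.
Proof.
elim: d y => [|d IHd] y; last first.
  have comb r (u v : A) : (exists c : M -> R, (forall m, (d < mdeg m)%N -> c m = 0)
      /\ u = \sum_m c m *: mon m) -> (exists c : M -> R, (forall m, (d < mdeg m)%N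
      -> c m = 0) /\ v = \sum_m c m *: mon m) -> exists c : M -> R,
      (forall m, (d < mdeg m)%N -> c m = 0) /\ r *: u + v = \sum_m c m *: mon m.
    move=> [c [c0 ->]] [c' [c0' ->]]; exists (fun m => r * c m + c' m); split.
      by move=> m dm; rewrite c0 // c0' // mulr0 addr0.
    by rewrite scaler_sumr -big_split; apply: eq_bigr => m _; rewrite scalerDl scalerA.
  have up u : filt d u -> exists c : M -> R, (forall m, (d < mdeg m)%N -> c m = 0)
      /\ u = \sum_m c m *: mon m.
    by move=> /IHd[c [c0 ->]]; exists c; split=> // m dm; apply/c0/ltnW.
  elim=> [|r u v _ fu _ fv|s].
  - by apply/up/filt0.
  - exact: comb.
  rewrite ltnS => sd; have [/forallP sp|] := boolP [forall x, count_mem x s < p]%N.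
    pose m : M := [ffun x => Ordinal (sp x)].
    have pm : perm_eq s (mseq m) by apply: perm_mseq => x; rewrite ffunE.
    rewrite -(subrK (mon m) (word s)) -[_ - _]scale1r; apply: comb.
      exact/up/(filtS sd)/word_perm.
    exists (fun m' => (m' == m)%:R); split=> [m' dm'|].
      case: eqP dm' => // ->; rewrite /mdeg -(perm_size pm) ltnNge sd //.
    rewrite (bigD1 m) //= eqxx scale1r big1 ?addr0 // => m' /negPf ->.
    by rewrite scale0r.
  rewrite negb_forall => /existsP[x]; rewrite -leqNgt => px.
  pose s' := nseq (count_mem x s - p) x ++ filter (predC1 x) s.
  have ps : perm_eq s (nseq p x ++ s').
    rewrite catA -nseqD subnKC //.
    have <- : filter (pred1 x) s = nseq (count_mem x s) x.
      by rewrite -size_filter; apply/all_pred1P/filter_all.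
    by rewrite perm_sym perm_filterC.
  apply: up; rewrite -(subrK (word (nseq p x ++ s')) (word s)); apply: filtD.
    exact/(filtS sd)/word_perm.
  have szs : size s = (p + size s')%N by rewrite (perm_size ps) size_cat size_nseq.
  rewrite word_cat /word big_nseq iter_mulr_1.
  apply: (@filtS (1 + (size s').+1)); last first.
    by apply: filtM (b_pow x) _; apply: filt_word.
  by apply: leq_trans sd; rewrite szs add1n -addn2 addnC leq_add2r.
suff E u : filt 0 u -> u = 0.
  move=> /E ->; exists (fun=> 0); split=> // .
  by rewrite big1 // => m _; rewrite scale0r.
by elim=> [//|r {}y z _ -> _ ->|//]; rewrite scaler0 addr0.
Qed.

(** ** Linear independence *)

Context (H : hopf_structure A) (phi : X -> A -> R^o).
Local Notation D := (coproduct H).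
Hypothesis Db : forall x, D (b x) = b x \ox 1 + 1 \ox b x.
Hypothesis epsb : forall x, counit H (b x) = 0.
Hypothesis b_gen : forall P : A -> Prop, P 1 ->
  (forall y z, P y -> P z -> P (y + z)) -> (forall (r : R) y, P y -> P (r *: y)) ->
  (forall x y, P y -> P (b x * y)) -> forall y, P y.
Hypothesis phi_lin : forall x, linear (phi x).
Hypothesis phi1 : forall x, phi x 1 = 0.
Hypothesis phib : forall x y, phi x (b y) = (x == y)%:R.
Hypothesis small_reg : forall (m : 'I_p) (r : R), (0 < m)%N -> r * m%:R = 0 -> r = 0.

(** The map psi (x) id. *)
Definition slice (psi : A -> R^o) (z : tens A A) : A :=
  tlift (fun y y' : A => (psi y : R) *: y') z.

Lemma slice_bilinear (psi : A -> R^o) : linear psi ->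
  bilinear_map (fun y y' : A => (psi y : R) *: y').
Proof.
move=> lin; split=> [y' r u v|y r u v].
  by rewrite (linear_funD lin) (linear_funZ lin) scalerDl scalerA.
by rewrite scalerDr !scalerA mulrC.
Qed.

Lemma sliceE (psi : A -> R^o) : linear psi -> forall y y', slice psi (y \ox y') = (psi y : R) *: y'.
Proof. by move=> /slice_bilinear/bilinear_balanced/tlift_ptens. Qed.

Lemma slice_linear (psi : A -> R^o) : linear psi -> linear (slice psi).
Proof. by move=> lin; apply/tlift_linear/slice_bilinear. Qed.

Lemma shift_linear (psi : A -> R^o) x : linear psi -> linear (fun y => psi (b x * y)).
Proof. by move=> lin r u v; rewrite mulrDr -scalerAr lin. Qed.

Lemma slice_gen (psi : A -> R^o) : linear psi -> forall x y,
  slice psi (D (b x * y)) = b x * slice psi (D y) + slice (fun u => psi (b x * u)) (D y).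
Proof.
move=> lin x y; rewrite rmorphM /= Db.
have LD f (lf : linear f) := linear_funD (slice_linear lf).
have L0 f (lf : linear f) := linear_fun0 (slice_linear lf).
have lin' := shift_linear x lin.
elim/(@tens_ind R A A): (D y) => [|u v|u v IHu IHv].
- by rewrite mulr0 !L0 // mulr0 addr0.
- by rewrite mulrDl !ptensM !mul1r LD // !sliceE // -scalerAr addrC.
- by rewrite mulrDr !LD // IHu IHv mulrDr addrACA.
Qed.

Lemma slice1 (psi : A -> R^o) : linear psi -> slice psi (D 1) = (psi 1 : R) *: 1.
Proof. by move=> lin; rewrite rmorph1 sliceE. Qed.

Lemma slice_word (psi : A -> R^o) s : linear psi ->
  filt (size s) (slice psi (D (word s)) - (psi 1 : R) *: word s).
Proof.
elim: s psi => [|y s IH] psi lin.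
  by rewrite /word big_nil slice1 // subrr; apply: filt0.
rewrite word_cons slice_gen // addrAC scalerAr -mulrBr.
apply: filtD; first exact/filt_mull/IH.
rewrite -[slice _ _](subrK ((psi (b y * 1) : R) *: word s)).
apply: filtD; last exact/filtZ/filt_word.
by apply: filtS (leqnSn _) _; apply: (IH _ (shift_linear y lin)).
Qed.

(** Since the letters are primitive, slicing the coproduct of a word removes sets
    of letters: the empty set contributes nothing as phi x 1 = 0, single letters
    give the partial derivative with respect to b x, and larger sets leave words
    that are shorter still. *)
Lemma slice_dual_word x s : filt (size s).-1
  (slice (phi x) (D (word s)) - (count_mem x s)%:R *: word (rem x s)).
Proof.
have lin := phi_lin x; elim: s => [|y s IH].
  by rewrite /word big_nil slice1 // phi1 !scale0r subrr; apply: filt0.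
have shiftE : filt (size s)
    (slice (fun u => phi x (b y * u)) (D (word s)) - (x == y)%:R *: word s).
  have := slice_word s (shift_linear y lin); rewrite mulr1 phib.
  exact.
have up u : filt (size s).-1 u -> (s = [::] -> u = 0) -> filt (size s) (b y * u).
  case: (s) => [|z s'] fu u0; last exact: filt_mull.
  by rewrite u0 // mulr0; apply: filt0.
have {up}IH' : filt (size s)
    (b y * (slice (phi x) (D (word s)) - (count_mem x s)%:R *: word (rem x s))).
  apply: up => // s0; rewrite s0 /word big_nil slice1 //.
  by rewrite phi1 !scale0r subrr.
rewrite word_cons slice_gen //=.
rewrite mulrBr in IH'; have := filtD IH' shiftE; rewrite addrACA -opprD.
move=> fs; have [xy|xy] := eqVneq x y; last first.
  move: fs; rewrite (negPf xy) scale0r addr0 add0n.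
  by rewrite word_cons -scalerAr.
move: fs; rewrite xy eqxx scale1r add1n => fs.
have [ys|ys] := boolP (y \in s); last first.
  move: fs; rewrite -xy (count_memPn _) ?xy // scale0r mulr0 add0r.
  by rewrite scale1r.
rewrite -[_ - _](subrKA (b y * ((count_mem y s)%:R *: word (rem y s)) + word s)).
apply: filtD => //; rewrite mulrSr scalerDl scale1r opprD addrACA subrr addr0.
rewrite -scalerAr -scalerBr -word_cons; apply: filtZ.
by rewrite -opprB -scaleN1r; apply/filtZ/word_perm/perm_to_rem.
Qed.

Definition mdec (x : X) (m : M) : M :=
  [ffun y => if y == x
    then Ordinal (leq_ltn_trans (leq_pred (m x)) (ltn_ord (m x))) else m y].

Lemma mseq_mdec x (m : M) : (0 < m x)%N ->
  perm_eq (rem x (mseq m)) (mseq (mdec x m)).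
Proof.
move=> mx; have xm : x \in mseq m by rewrite -has_pred1 has_count count_mseq.
apply: perm_mseq => y; rewrite count_rem count_mseq xm ffunE /= eq_sym.
by have [->|_] := eqVneq y x; rewrite ?subn1 ?subn0.
Qed.

Lemma mdeg_mdec x (m : M) : (0 < m x)%N -> mdeg (mdec x m) = (mdeg m).-1.
Proof.
move=> mx; have xm : x \in mseq m by rewrite -has_pred1 has_count count_mseq.
by rewrite /mdeg -(perm_size (mseq_mdec mx)) size_rem.
Qed.

Lemma mdec_inj x (m m' : M) : (0 < m x)%N -> (0 < m' x)%N ->
  mdec x m = mdec x m' -> m = m'.
Proof.
move=> mx m'x /ffunP E; apply/ffunP => y; have := E y; rewrite !ffunE.
have [->|//] := eqVneq y x; move=> /(congr1 val) /= E'.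
by apply: val_inj; rewrite /= -(prednK mx) -(prednK m'x) E'.
Qed.

Lemma slice_mon x (m : M) : exists r : M -> R,
  (forall m', ((mdeg m).-1 <= mdeg m')%N -> r m' = 0) /\
  slice (phi x) (D (mon m)) = (m x)%:R *: mon (mdec x m) + \sum_m' r m' *: mon m'.
Proof.
suff : filt (mdeg m).-1 (slice (phi x) (D (mon m)) - (m x)%:R *: mon (mdec x m)).
  by move=> /filt_mon[r [r0 E]]; exists r; split=> //; rewrite -E addrC subrK.
have := slice_dual_word x (mseq m); rewrite count_mseq -/(mon m) -/(mdeg m) => fs.
have [m0|m0] := posnP (m x); first by move: fs; rewrite m0 !scale0r.
rewrite -[_ - _](subrKA ((m x)%:R *: word (rem x (mseq m)))) -scalerBr.
apply: filtD fs _; apply: filtZ.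
have pm := mseq_mdec m0; have := word_perm pm.
by rewrite (perm_size pm) -/(mdeg (mdec x m)) mdeg_mdec.
Qed.

(** Slicing at a generator that occurs in a monomial of top degree lowers the
    degree and multiplies its coefficient by an exponent between 1 and p - 1,
    which is regular. *)
Lemma mon_free_deg d (c : M -> R) : (forall m, (d <= mdeg m)%N -> c m = 0) ->
  \sum_m c m *: mon m = 0 -> forall m, c m = 0.
Proof.
elim: d c => [|d IHd] c c0 E; first by move=> m; apply: c0.
apply: (IHd) (E) => m; rewrite leq_eqVlt => /predU1P[dm|]; last exact: c0.
have [/eqP s0|[x mx]] : (mdeg m == 0)%N \/ exists x, (0 < m x)%N.
  have := count_mseq m; rewrite /mdeg; case: (mseq m) => [|x s] /= cm; first by left.
  by right; exists x; rewrite -cm eqxx.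
- have m_nil m' : (mdeg m' == 0)%N -> m' = m.
    move=> /eqP/size0nil sm'; apply/ffunP => y; apply: val_inj.
    by rewrite /= -!count_mseq sm' (size0nil s0).
  have := congr1 (counit H) E; rewrite raddf0 raddf_sum (bigD1 m) //= big1 ?addr0.
    by rewrite linearZ /= /mon (size0nil s0) /word big_nil rmorph1 [LHS]mulr1.
  move=> m' m'm; rewrite linearZ /= /mon.
  have : mseq m' != [::] by apply: contraNneq m'm => s; apply/eqP/m_nil; rewrite /mdeg s.
  by case: (mseq m') => // y s _; rewrite word_cons rmorphM /= epsb mul0r; apply: mulr0.
apply: (small_reg mx).
pose r m' := projT1 (boolp.cid (slice_mon x m')).
have rP m' : (forall m'', ((mdeg m').-1 <= mdeg m'')%N -> r m' m'' = 0) /\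
  slice (phi x) (D (mon m')) = (m' x)%:R *: mon (mdec x m') + \sum_m'' r m' m'' *: mon m''.
  by rewrite /r; case: (boolp.cid _).
pose c' m'' := \sum_m' c m' * ((m' x)%:R * (mdec x m' == m'')%:R + r m' m'').
have sl := slice_linear (phi_lin x).
have c'E : \sum_m'' c' m'' *: mon m'' = 0.
  have := congr1 (slice (phi x) \o D) E; rewrite /= raddf_sum (linear_fun_sum sl).
  rewrite !raddf0 (linear_fun0 sl) => E'; rewrite -[RHS]E'.
  under eq_bigr => m'' _ do rewrite scaler_suml.
  rewrite exchange_big; apply: eq_bigr => m' _ /=.
  rewrite linearZ /= (linear_funZ sl) (rP m').2 scalerDr scaler_sumr.
  under eq_bigr => m'' _ do rewrite mulrDr scalerDl.
  rewrite big_split /=; congr (_ + _); last first.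
    by apply: eq_bigr => m'' _; rewrite scalerA.
  rewrite (bigD1 (mdec x m')) //= eqxx mulr1 scalerA big1 ?addr0 // => m'' /negPf ne.
  by rewrite eq_sym ne !mulr0 scale0r.
have c'0 m'' : (d <= mdeg m'')%N -> c' m'' = 0.
  move=> dm''; rewrite /c' big1 // => m' _.
  have [dm'|dm'] := leqP d.+1 (mdeg m'); first by rewrite c0 // mul0r.
  rewrite (rP m').1 ?addr0; last first.
    by apply: leq_trans dm''; rewrite (leq_trans (leq_pred _)).
  have [->|m'x] := posnP (m' x); first by rewrite mul0r mulr0.
  case: eqP => [E'|_]; last by rewrite !mulr0.
  move: dm''; rewrite -E' mdeg_mdec //; move: dm'; rewrite ltnS.
  have : (0 < mdeg m')%N.
    rewrite /mdeg; have := count_mseq m' x; case: (mseq m') => //= m'0.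
    by rewrite -m'0 in m'x.
  by case: (mdeg m') => // k _ kd; rewrite leqNgt kd.
have := IHd c' c'0 c'E (mdec x m); rewrite /c' (bigD1 m) //= eqxx mulr1.
rewrite (rP m).1 ?addr0 ?mdeg_mdec // big1 ?addr0 // => m' m'm.
have [dm'|dm'] := leqP d.+1 (mdeg m'); first by rewrite c0 // mul0r.
rewrite (rP m').1 ?addr0; last first.
  by rewrite mdeg_mdec // -dm -!subn1 leq_sub2r.
have [->|m'x] := posnP (m' x); first by rewrite mul0r mulr0.
case: eqP => [E'|_]; last by rewrite !mulr0.
by move/eqP: m'm; case; apply: mdec_inj E'.
Qed.

Lemma mon_free (c : M -> R) : \sum_m c m *: mon m = 0 -> forall m, c m = 0.
Proof.
apply: (@mon_free_deg (\max_m (mdeg m)).+1) => m.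
by rewrite ltnNge leq_bigmax.
Qed.

Lemma mon_span y : exists c : M -> R, y = \sum_m c m *: mon m.
Proof.
suff [d fy] : exists d, filt d y by have [c [_ ->]] := filt_mon fy; exists c.
elim/b_gen: y => [|y z [d fy] [d' fz]|r y [d fy]|x y [d fy]].
- exists 1%N; have -> : 1 = word [::] by rewrite /word big_nil.
  exact: filt_word.
- exists (maxn d d'); apply: filtD.
    by apply: filtS fy; apply: leq_maxl.
  by apply: filtS fz; apply: leq_maxr.
- by exists d; apply: filtZ.
- by exists d.+1; apply: filt_mull.
Qed.

End OrderedMonomials.

(** * The dimension of the restricted enveloping algebra *)

Lemma has_dim_ffun (K : fieldType) (V : lmodType K) (I : finType) (vT : vectType K)
    (g : {ffun I -> vT} -> V) : linear g -> injective g ->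
  (forall y, exists c, y = g c) -> has_dim V (#|I| * dim vT).
Proof.
move=> glin ginj gsurj; have [r rlin rbij] := ffun_vect_iso I vT.
pose c y := projT1 (boolp.cid (gsurj y)).
have gc y : g (c y) = y by rewrite /c; case: (boolp.cid _).
have cg x : c (g x) = x by apply: ginj; rewrite gc.
have flin : linear (r \o c).
  move=> k y z /=; rewrite -[y in LHS]gc -[z in LHS]gc -glin cg.
  by rewrite rlin.2 rlin.1.
pose f : {linear V -> 'rV[K]_(#|I| * dim vT)} := HB.pack (r \o c)
  (GRing.isLinear.Build K V _ *:%R (r \o c) flin).
exists f; apply: (@bij_comp _ _ _ r c) => //.
by exists g.
Qed.

Section UtqBasis.
Context (K : fieldType) (p n : nat) (q : K).
Hypothesis hp : p \in [pchar K].
Local Notation S := {poly %/ tpoly p q}.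
Local Notation U := (utq p n q).
Local Notation gen := (@utq_gen K p n q).
Local Notation N := #|midx p n|.

Lemma size_tpoly : size (tpoly p q) = p.+1.
Proof.
rewrite /tpoly size_polyDl size_polyXn // size_polyN.
rewrite (leq_ltn_trans (size_scale_leq _ _)) // size_polyX ltnS.
exact: prime_gt1 (pchar_pr hp).
Qed.

Lemma mk_monic_tpoly : mk_monic (tpoly p q) = tpoly p q.
Proof.
have p1 := prime_gt1 (pchar_pr hp).
rewrite /mk_monic size_tpoly ltnS prime_gt0 ?(pchar_pr hp) //.
suff -> : tpoly p q \is monic by [].
rewrite monicE lead_coefE size_tpoly /tpoly coefB coefXn eqxx coefZ coefX.
by rewrite eqn_leq (leqNgt p) p1 mulr0 subr0.
Qed.

Lemma dim_S : dim S = p.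
Proof. by rewrite /dim /= mk_monic_tpoly size_tpoly. Qed.

Lemma tq_neq0 : tq p q != 0.
Proof.
apply/eqP => /(congr1 (fun y : S => (y : {poly K})`_1)).
have p1 := prime_gt1 (pchar_pr hp).
rewrite /tq /qpolyX in_qpoly_small ?mk_monic_tpoly ?size_tpoly ?size_polyX ?ltnS //.
by rewrite coefX coef0 => /eqP; rewrite oner_eq0.
Qed.

Lemma S_nat_reg (m : 'I_p) (s : S) : (0 < m)%N -> s * m%:R = 0 -> s = 0.
Proof.
move=> m0; have mK : m%:R != 0 :> K.
  by rewrite -(dvdn_pcharf hp) gtnNdvd // ltn_ord.
move=> /(congr1 (fun y : S => (m%:R : K)^-1 *: y)); rewrite scaler0.
by rewrite mulr_natr -scaler_nat scalerA mulVf // scale1r.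
Qed.

(** The entry of the natural action on O(n;1) in the row of x^(alpha) and the column
    of x_i detects x^(alpha) D_i, because D_j x_i is 0 or 1. A multiple of the
    counit is subtracted to annihilate 1. *)
Lemma utq_functional (x : midx p n * 'I_n) : exists phi : U -> S^o,
  [/\ linear phi, phi 1 = 0, forall y, phi (gen y) = (x == y)%:R
    & forall w w', phi (wu q w * wu q w')
        = (wact w (wact w' (xpow K p (eps x.2))) x.1)%:A].
Proof.
pose L (w : witt K p n) : 'M[S]_N := map_mx (in_alg S) (opmx (wact w)).
pose c : {rmorphism S -> 'M[S]_N} := @scalar_mx S N.
have cM s (y : 'M[S]_N) : c s * y = s *: y by exact: mul_scalar_mx.
have opmxP k (w w' : witt K p n) :
    opmx (wact (k *: w + w')) = k *: opmx (wact w) + opmx (wact w').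
  by apply/matrixP => i j; rewrite !mxE wact_linearl !ffunE.
have LX w k : L w ^+ k = map_mx (in_alg S) (opmx (wact w) ^+ k).
  by rewrite /L (rmorphXn (map_mx (in_alg S))).
have [|||||Phi [Phiw PhiZ]] := @utq_lift K p n q 'M[S]_N c L _ _ _ _ _.
- by move=> s y; exact/esym/scalar_mxC.
- move=> k w w'; rewrite /L opmxP map_mxD; congr (_ + _).
  by rewrite cM; apply/matrixP => i j; rewrite !mxE; apply: (rmorphM (in_alg S)).
- move=> w w'; rewrite /L -[_ * _]map_mxM -[X in _ - X]map_mxM -map_mxB.
  congr (map_mx _ _); rewrite -!opmx_comp; try exact: wact_linear.
  by apply/matrixP => i j; rewrite !mxE (wact_brk hp) !ffunE.
- by move=> al i E; rewrite LX opmx_toral.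
- by move=> al i E; rewrite LX opmx_nil // map_mx0.
have [eps_ epsw] := utq_counit n q hp.
case: x => al i; have [ei Ei] := eps_in hp i.
pose phi (y : U) : S^o :=
  Phi y (enum_rank al) (enum_rank ei) - eps_ y * (al == ei)%:R.
exists phi; split.
- move=> r y z; rewrite /phi rmorphD PhiZ cM !mxE.
  rewrite [eps_ _]linearP /= mulrDl opprD addrACA scalerBr; congr (_ - _ + _).
  by rewrite -scalerAl.
- rewrite /phi !rmorph1 mul1r mxE (inj_eq enum_rank_inj).
  by rewrite subrr.
- case=> be j; rewrite /phi epsw mul0r subr0 Phiw !mxE !enum_rankK -Ei.
  rewrite wact_wmon xpair_eqE andbC.
  have -> : oder j (xpow K p (eps i)) = if i == j then xpow K p 0 else 0.
    rewrite Ei oder_xpow -Ei; case: eqP => [->|ij]; first by rewrite subrr.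
    apply: (@xpow_out K p n _ j); rewrite !ffunE eqxx.
    by rewrite eq_sym; case: eqP ij.
  case: eqP => _; last by rewrite linear0 ffunE rmorph0.
  rewrite omul_xpow0 xpowE (inj_eq (@expo_inj p n)).
  by case: eqP => _; rewrite ?rmorph1 ?rmorph0.
- move=> w w'; rewrite /phi.
  have -> : eps_ (wu q w * wu q w') = 0.
    apply: (etrans (rmorphM eps_ _ _)).
    exact: etrans (f_equal2 *%R (epsw w) (epsw w')) (mul0r _).
  have -> : Phi (wu q w * wu q w') = L w * L w'.
    exact: etrans (rmorphM Phi _ _) (f_equal2 *%R (Phiw w) (Phiw w')).
  rewrite mul0r subr0 /L -[_ * _]map_mxM -opmx_comp; last exact: wact_linear.
  by rewrite !mxE !enum_rankK -Ei.
Qed.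

Lemma witt_ind (P : witt K p n -> Prop) : P 0 ->
  (forall k w w', P w -> P w' -> P (k *: w + w')) ->
  (forall (al : midx p n) i, P (wmon K p (expo al) i)) -> forall w, P w.
Proof.
move=> P0 PP Pm w; rewrite (witt_decomp w) pair_bigA.
by elim/big_rec: _ => // x w' _ Pw'; apply: PP.
Qed.

Lemma wu0 : wu q (0 : witt K p n) = 0.
Proof.
have := @wuP K p n q (-1) 0 0; rewrite scaler0 addr0 => ->.
by rewrite !scaleN1r addNr.
Qed.

Lemma wu_filt (w : witt K p n) : filt gen 2 (wu q w).
Proof.
elim/witt_ind: w => [|k w w' fw fw'|al i].
- by rewrite wu0; apply: filt0.
- by rewrite wuP; apply: filtP.
- have -> : wu q (wmon K p (expo al) i) = word gen [:: (al, i)].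
    by rewrite word_cons /word big_nil mulr1.
  exact: filt_word.
Qed.

(** The basis is given by the ordered monomials in the x^(alpha) D_i with exponents
    below p. *)
Theorem utq_free : exists g : {ffun {ffun midx p n * 'I_n -> 'I_p} -> S^o} -> U,
  [/\ linear g, injective g & forall y, exists c, y = g c].
Proof.
have [H [DH epsH _ _ _]] := utq_hopf n q hp.
pose phi x := projT1 (boolp.cid (utq_functional x)).
have phiP x : [/\ linear (phi x), phi x 1 = 0 & forall y, phi x (gen y) = (x == y)%:R].
  by rewrite /phi; case: (boolp.cid _) => ? [].
have brk x y : filt gen 2 (gen x * gen y - gen y * gen x).
  by rewrite /utq_gen wu_brk; apply: wu_filt.
have pow x : filt gen 2 (gen x ^+ p).
  case: x => al i; rewrite /utq_gen /=; have [E|E] := eqVneq (expo al) (eps i).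
    by rewrite wu_toral //; apply: wu_filt.
  by rewrite wu_nil; [apply: filt0 | apply/eqP].
have p1 := prime_gt1 (pchar_pr hp).
have gen_ind := @utq_gen_ind K p n q.
pose g (c : {ffun {ffun midx p n * 'I_n -> 'I_p} -> S^o}) : U := \sum_m c m *: mon gen m.
have glin : linear g.
  move=> r c c'; rewrite /g scaler_sumr -big_split; apply: eq_bigr => m _.
  by rewrite /= !ffunE scalerDl scalerA.
exists g; split=> //; last first.
  move=> y; have [c ->] := mon_span brk pow p1 gen_ind y.
  by exists [ffun m => c m : S^o]; apply: eq_bigr => m _; rewrite ffunE.
move=> c c' E; apply/ffunP => m; apply/eqP; rewrite -subr_eq0; apply/eqP.
have := @mon_free S U p _ gen brk pow p1 H phi (fun x => DH _) (fun x => epsH _)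
  (fun x => let: And3 h _ _ := phiP x in h) (fun x => let: And3 _ h _ := phiP x in h)
  (fun x => let: And3 _ _ h := phiP x in h) S_nat_reg (fun m => c m - c' m).
apply; under eq_bigr => m' _ do rewrite scalerBl.
by rewrite sumrB -[X in X - _]/(g c) E subrr.
Qed.

Lemma utq_scaleK (k : K) (y : tens (restr_env K p n) S) :
  k *: y = ((k%:A : S) *: (y : U)) :> U.
Proof.
elim/(@tens_ind K (restr_env K p n) S): y => [|a s|y z IHy IHz].
- by rewrite !scaler0.
- by rewrite -ptensZr -(mulr_algl k s) [(_ *: _ : U)]ptensM mul1r.
- by rewrite !scalerDr IHy IHz.
Qed.

Theorem utq_dim : has_dim (tens (restr_env K p n) S) (p ^ (1 + n * p ^ n)).
Proof.
have [g [glin ginj gsurj]] := utq_free.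
have -> : (p ^ (1 + n * p ^ n) = #|{ffun midx p n * 'I_n -> 'I_p}| * dim S)%N.
  by rewrite dim_S !card_ffun card_prod !card_ffun !card_ord expnD expn1 !(mulnC _ p) (mulnC n).
apply: (@has_dim_ffun K (tens (restr_env K p n) S) _ S g) => // k c c'.
pose F := {ffun {ffun midx p n * 'I_n -> 'I_p} -> S^o}.
rewrite utq_scaleK -[RHS](glin (k%:A : S) (c : F) (c' : F)); congr (g _).
by apply/ffunP => m; rewrite !ffunE; congr (_ + _); rewrite -[LHS]mulr_algl.
Qed.

End UtqBasis.

Lemma fp_int (p : nat) (B : pzRingType) (z : int) : prime p -> p%:R = 0 :> B ->
  fp B (z%:~R : 'F_p) = z%:~R.
Proof.
move=> pr_p p0; case: z => m; first exact: fp_nat.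
by rewrite NegzE !mulrNz fpN // fp_nat.
Qed.

(** * The Cartan data of the Jacobson-Witt algebra *)

Section WittCartan.
Context (K : fieldType) (p n : nat).
Hypothesis hp : p \in [pchar K].
Context (R : comNzRingType) (A : unitAlgType R) (kap : {rmorphism K -> R}).
Context (W : witt K p n -> A) (eta : {ffun 'I_n -> bool}) (t : R).
Hypothesis WP : forall k w w', W (k *: w + w') = kap k *: W w + W w'.
Hypothesis Wbrk : forall w w', W w * W w' - W w' * W w = W (wbrk w w').
Hypothesis Wtoral : forall (al : midx p n) i, expo al = eps i ->
  W (wmon K p (expo al) i) ^+ p = W (wmon K p (expo al) i).
Hypothesis Wnil : forall (al : midx p n) i, expo al <> eps i ->
  W (wmon K p (expo al) i) ^+ p = 0.

Definition witt_h k : A := W (hW K p k).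
(** Replacing e_k by 0 when eta_k = 0 removes the k-th factor from the twist. *)
Definition witt_e k : A := if eta k then W (eW K p k) else 0.
Local Notation E k := (W (wmon K p (eps k *+ 2) k)).
Local Notation pr_p := (pchar_pr hp).

Lemma p0R : p%:R = 0 :> R.
Proof. by rewrite -(rmorph_nat kap) (pcharf0 hp) rmorph0. Qed.

Lemma p0A : p%:R = 0 :> A.
Proof. by rewrite -(rmorph_nat (in_alg A)) p0R rmorph0. Qed.

Lemma W0 : W 0 = 0.
Proof.
by have := WP (-1) 0 0; rewrite scaler0 addr0 rmorphN1 scaleN1r addNr.
Qed.

Lemma WZ k w : W (k *: w) = kap k *: W w.
Proof. by rewrite -[X in W X]addr0 WP W0 addr0. Qed.

Lemma W_comm w w' : wbrk w w' = 0 -> GRing.comm (W w) (W w').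
Proof. by move=> ww; apply/eqP; rewrite -subr_eq0 Wbrk ww W0. Qed.

Lemma W_eW k : W (eW K p k) = kap 2%:R *: E k.
Proof. exact: WZ. Qed.

Lemma eps_le0 (k l : 'I_n) : k != l -> eps k l <= 0.
Proof. by move=> kl; rewrite ffunE eq_sym (negPf kl). Qed.

Lemma eps2_le0 (k l : 'I_n) : k != l -> (eps k *+ 2) l <= 0.
Proof. by move=> kl; rewrite ffunMnE ffunE eq_sym (negPf kl) mul0rn. Qed.

Lemma comm_witt_e k (y : A) : GRing.comm (E k) y -> GRing.comm (witt_e k) y.
Proof.
rewrite /witt_e W_eW; case: (eta k) => Ey; last exact/commr_sym/commr0.
by rewrite /GRing.comm -scalerAl -scalerAr Ey.
Qed.

Lemma witt_hC k l : GRing.comm (witt_h k) (witt_h l).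
Proof.
have [->//|kl] := eqVneq k l; apply/W_comm/wmon_brk_comm; apply: eps_le0 => //.
by rewrite eq_sym.
Qed.

Lemma witt_eC k l : GRing.comm (witt_e k) (witt_e l).
Proof.
have [->//|kl] := eqVneq k l.
apply/comm_witt_e/commr_sym/comm_witt_e/W_comm/wmon_brk_comm; apply: eps2_le0 => //.
by rewrite eq_sym.
Qed.

Lemma witt_heC k l : k != l -> GRing.comm (witt_h k) (witt_e l).
Proof.
move=> kl; apply/commr_sym/comm_witt_e/W_comm/wmon_brk_comm.
  by apply: eps2_le0; rewrite eq_sym.
exact: eps_le0.
Qed.

Lemma witt_weight (a : mexp n) i :
  weight witt_h [ffun k => ((a - eps i) k)%:~R : 'F_p] (W (wmon K p a i)).
Proof.
move=> k; have := Wbrk (hW K p k) (wmon K p a i).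
rewrite (wmon_brk_toral hp) WZ => /(canRL (subrK _)) ->.
rewrite mulrDr addrC [in fp _ _]ffunE fp_int //; [|exact: pr_p|exact: p0A].
by rewrite rmorph_int scaler_int mulrzr.
Qed.

Lemma witt_he k : witt_h k * witt_e k = witt_e k * (witt_h k + 1).
Proof.
have := @witt_weight (eps k *+ 2) k k; rewrite !ffunE eqxx /=.
rewrite -[X in fp A X]/(1 : 'F_p) fp1; last exact: p0A; last exact: pr_p.
rewrite /witt_e W_eW; case: (eta k) => hE; last by rewrite mulr0 mul0r.
by rewrite -scalerAr -scalerAl hE.
Qed.

Lemma witt_hX k : witt_h k ^+ p = witt_h k.
Proof. by have [ek Ek] := eps_in hp k; rewrite /witt_h /hW Ek Wtoral. Qed.

Lemma witt_eX k : witt_e k ^+ p = 0.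
Proof.
have p_gt0 := prime_gt0 pr_p.
rewrite /witt_e W_eW; case: (eta k); last by rewrite expr0n eqn0Ngt p_gt0.
rewrite exprZn; suff -> : E k ^+ p = 0 by rewrite scaler0.
have [[al Eal]|x0] := xpow_in K p (eps k *+ 2).
  rewrite Eal Wnil // -Eal => /ffunP/(_ k).
  by rewrite ffunMnE ffunE eqxx.
have -> : wmon K p (eps k *+ 2) k = 0.
  by apply/ffunP => j; rewrite ffunE x0 ffunE; case: eqP.
by rewrite W0 expr0n eqn0Ngt p_gt0.
Qed.

Definition witt_ifac (l : midx p n) : R := kap ((\prod_k (l k)`!)%:R)^-1.

Lemma fact_neq0 (m : 'I_p) : (m`!)%:R != 0 :> K.
Proof.
rewrite -(dvdn_pcharf hp); have := ltn_ord m; move: (m : nat) => k.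
elim: k => [|k IH] kp; first by rewrite fact0 dvdn1 neq_ltn prime_gt1 ?orbT ?pr_p.
rewrite factS Euclid_dvdM ?pr_p // negb_or gtnNdvd //=.
exact/IH/ltnW.
Qed.

Lemma witt_ifacP l : witt_ifac l * (\prod_k (l k)`!)%:R = 1.
Proof.
rewrite -(rmorph_nat kap) -rmorphM mulVf ?rmorph1 // natr_prod.
by apply/prodf_neq0 => k _; apply: fact_neq0.
Qed.

Local Notation adE := (ad witt_e).

Lemma ad_iterZ k s (r : R) y : iter s (adE k) (r *: y) = r *: iter s (adE k) y.
Proof.
by elim: s => //= s ->; apply: (linear_funZ (ad_linear witt_e k)).
Qed.

Lemma W_iter_brk k s w : (0 < s)%N ==> eta k ->
  W (iter s (wbrk (eW K p k)) w) = iter s (adE k) (W w).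
Proof.
rewrite implybE -eqn0Ngt => /orP[/eqP -> //|ek]; elim: s => //= s IH.
by rewrite -Wbrk IH /ad /witt_e ek.
Qed.

(** On the exponents allowed by eta, the operators d_I of W(n;1) are the iterated
    commutators with the e_k; all the others vanish. *)
Lemma W_divadI (m : midx p n) w : eta_below eta m ->
  W (divadI m w) = divadA witt_e witt_ifac (W w) m.
Proof.
move=> /forallP em; have ek k : (0 < m k)%N ==> eta k.
  by have := em k; case: (eta k) => //; rewrite ?implybT // mul0n leqn0 => /eqP ->.
rewrite /divadA /witt_ifac natr_prod /divadI /adI.
elim: (index_enum _) => [|k r IH].
  by rewrite !big_nil invr1 rmorph1 scale1r.
rewrite !big_cons /= /divad WZ W_iter_brk // IH ad_iterZ scalerA; congr (_ *: _).
by rewrite invfM rmorphM.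
Qed.

Lemma divadA_out (m : midx p n) y : ~~ eta_below eta m ->
  divadA witt_e witt_ifac y m = 0.
Proof.
rewrite negb_forall => /existsP[k]; rewrite -ltnNge.
have [ek|ek] := boolP (eta k).
  by rewrite mul1n ltnNge -ltnS prednK ?prime_gt0 ?pr_p // ltn_ord.
rewrite mul0n => mk; rewrite /divadA; suff -> : adI witt_e (fun k => m k) y = 0.
  by rewrite scaler0.
have ad0 l s : iter s (adE l) 0 = 0.
  by have := ad_iterZ l s 0 0; rewrite !scale0r.
rewrite /adI; elim: (index_enum _) (mem_index_enum k) => // l r IH.
rewrite in_cons big_cons /= => /predU1P[<-|/IH ->] //.
case: (m k : nat) mk => // s _; rewrite iterSr [X in iter _ _ X](_ : _ = 0) ?ad0 //.
by rewrite /ad /witt_e (negPf ek) mul0r mulr0 subrr.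
Qed.

Local Notation g := (gfac witt_e t).
Local Notation G a := (\prod_(k < n) (1 - t *: W (eW K p k)) ^ (eta_mul eta a k)).

Lemma G_cartanG (a : mexp n) : G a = cartanG witt_e t [ffun k => (a k)%:~R : 'F_p].
Proof.
apply: eq_bigr => k _; rewrite !ffunE.
have gn m := gfac_nat t pr_p p0A witt_eX k m.
have gD i j := gfacD t pr_p p0A witt_eX k i j.
move: gn gD; rewrite /gfac /witt_e; case: (eta k) => gn gD; last first.
  by rewrite mul0r expr0z scaler0 subr0 expr1n.
rewrite mul1r; case: (a k) => m; first exact/esym/gn.
rewrite NegzE -exprnN mulrNz.
move: (1 - _) gn gD => x gn gD; set u : 'F_p := m.+1%:~R.
have e1 : x ^+ (- u)%R * x ^+ m.+1 = 1.
  by rewrite -(gn m.+1) -gD addNr.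
have e2 : x ^+ m.+1 * x ^+ (- u)%R = 1.
  by rewrite -(gn m.+1) -gD addrN.
have ux : x ^+ m.+1 \is a GRing.unit by apply/unitrP; exists (x ^+ (- u)%R).
by apply: (mulIr ux); rewrite mulVr.
Qed.

Lemma eta_mul_below (m : midx p n) : eta_below eta m ->
  - expo m = eta_mul eta (- expo m).
Proof.
move=> /forallP em; apply/ffunP => k; rewrite !ffunE; have := em k.
by case: (eta k); rewrite ?mul1r // mul0n leqn0 => /eqP ->; rewrite mul0r.
Qed.

Section TwistedHopf.
Context (H : hopf_structure A).
Hypothesis DW : forall w, coproduct H (W w) = W w \ox 1 + 1 \ox W w.
Hypothesis epsW : forall w, counit H (W w) = 0.
Hypothesis SW : forall w, antipode H (W w) = - W w.
Hypothesis S1 : antipode H 1 = 1.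
Hypothesis SM : forall y z, antipode H (y * z) = antipode H z * antipode H y.

Lemma witt_eE k : exists w, witt_e k = W w.
Proof.
by rewrite /witt_e; case: (eta k); [exists (eW K p k) | exists 0; rewrite W0].
Qed.

Lemma coproduct_e k : coproduct H (witt_e k) = witt_e k \ox 1 + 1 \ox witt_e k.
Proof. by have [w ->] := witt_eE k. Qed.

Lemma counit_e k : counit H (witt_e k) = 0.
Proof. by have [w ->] := witt_eE k. Qed.

Lemma antipode_e k : antipode H (witt_e k) = - witt_e k.
Proof. by have [w ->] := witt_eE k. Qed.

Local Notation ghE a m := (\prod_(k < n) \prod_(j < m k) (witt_h k + (a + j)%:R)).
Local Notation gE a := (\prod_(k < n) (1 - t *: W (eW K p k)) ^ (a k)).

(** The exponents excluded by eta contribute nothing. On the others the integral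
    powers of 1 - t e_k agree with the powers of g_k indexed by residues, as
    g_k ^+ p = 1. *)
Theorem witt_twist : exists H' : hopf_structure A,
  (forall (al : midx p n) i, let x := wmon K p (expo al) i in
    [/\ coproduct H' (W x) = W x \ox gE (eta_mul eta (expo al - eps i))
          + \sum_(m : midx p n | eta_below eta m) (-1) ^+ mnorm m *:
              (ghE 0%N m \ox (t ^+ mnorm m *: (gE (- expo m) * W (divadI m x)))),
        antipode H' (W x) = - (gE (- eta_mul eta (expo al - eps i))
          * \sum_(m : midx p n | eta_below eta m)
              t ^+ mnorm m *: (W (divadI m x) * ghE 1%N m))
      & counit H' (W x) = 0])
  /\ forall k, coproduct H' (witt_h k) = witt_h k \ox 1 + 1 \ox witt_h k
       + t *: (witt_h k \ox (witt_e k * g k ^+ p.-1)).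
Proof.
have [H' [H'D H'S H'eps]] := cartan_twist t pr_p p0A S1 SM witt_hC witt_eC witt_heC
  witt_he witt_hX witt_eX (fun k => DW _) coproduct_e (fun k => epsW _) counit_e
  (fun k => SW _).
have mE (m : midx p n) : eta_below eta m ->
    gE (- expo m) = cartanG witt_e t (- degvec m).
  move=> em; rewrite (eta_mul_below em) G_cartanG; congr (cartanG _ _ _).
  by apply/ffunP => k; rewrite !ffunE mulrNz.
exists H'; split=> [al i x|k].
  pose la : {ffun 'I_n -> 'F_p} := [ffun k => ((expo al - eps i) k)%:~R].
  have wx : weight witt_h la (W x) by apply: witt_weight.
  have laE : cartanG witt_e t (- la) = gE (- eta_mul eta (expo al - eps i)).
    have -> : - eta_mul eta (expo al - eps i) = eta_mul eta (- (expo al - eps i)).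
      by apply/ffunP => k; rewrite !ffunE mulrN.
    by rewrite G_cartanG; congr (cartanG _ _ _); apply/ffunP => k; rewrite !ffunE mulrNz.
  split; last by rewrite H'eps.
  - rewrite H'D (twisted_coproduct t pr_p p0A witt_hC witt_eC witt_hX witt_eX p0R
      witt_ifacP wx (DW _)) -G_cartanG; congr (_ + _).
    rewrite [RHS]big_mkcond; apply: eq_bigr => m _; case: ifPn => em.
      by rewrite W_divadI // -mE.
    by rewrite divadA_out // mulr0 scaler0 ptens0r scaler0.
  - rewrite H'S (twisted_antipode t pr_p p0A S1 SM witt_hC witt_eC witt_heC witt_he
      witt_hX witt_eX coproduct_e counit_e (fun k => SW _) antipode_e p0R
      witt_ifacP wx (SW _)) laE; congr (- (_ * _)).
    rewrite [RHS]big_mkcond; apply: eq_bigr => m _; case: ifPn => em.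
      by rewrite W_divadI.
    by rewrite divadA_out // mul0r scaler0.
by rewrite H'D (twist_h t pr_p p0A witt_hC witt_eC witt_heC witt_he witt_hX witt_eX (fun k => DW _)).
Qed.

(** Symmetry would give h_k (x) t e_k g_k^-1 = t e_k g_k^-1 (x) h_k. After
    multiplication by g_k (x) g_k, the functional ph (x) pe turns this into
    2 t = 0. *)
Lemma twist_not_cocommutative (H' : hopf_structure A) k (ph pe : A -> R^o) :
  eta k -> t != 0 -> (2%:R : K) != 0 ->
  coproduct H' (witt_h k) = witt_h k \ox 1 + 1 \ox witt_h k
       + t *: (witt_h k \ox (witt_e k * g k ^+ p.-1)) ->
  linear ph -> linear pe ->
  ph (witt_h k) = 1 -> ph (E k) = 0 -> ph (witt_h k * W (eW K p k)) = 0 ->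
  pe (E k) = 1 -> ~ cocommutative H'.
Proof.
move=> ek t0 two0 H'h phl pel phh phe phhe pee /(_ (witt_h k)).
rewrite H'h; set y := witt_e k * _; rewrite -ptensZr !tswapD !tswapE.
rewrite [_ + witt_h k \ox 1]addrC => /addrI.
have yg : y * g k = witt_e k.
  by rewrite /y -mulrA -exprSr prednK ?prime_gt0 ?pr_p // (gfacXp t pr_p p0A witt_eX) mulr1.
have bl : @bilinear_map R A A R^o (fun a b => ph a * pe b).
  split=> [b r a a'|a r b b']; first by rewrite phl mulrDl scalerAl.
  by rewrite pel mulrDr scalerAr.
move=> /(congr1 (fun z => z * (g k \ox g k))) /=; rewrite !ptensM -scalerAl yg.
move=> /(congr1 (tlift (fun a b => ph a * pe b))).
rewrite !(tlift_ptens (bilinear_balanced bl)).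
have ekE : witt_e k = kap 2%:R *: E k by rewrite /witt_e ek W_eW.
have hg : ph (witt_h k * g k) = 1.
  rewrite /gfac mulrBr mulr1 -scalerAr -scaleN1r addrC phl.
  by rewrite (linear_funZ phl) /witt_e ek phhe scaler0 scaler0 add0r.
rewrite hg ekE !(linear_funZ phl, linear_funZ pel) phe pee !scaler0 mul0r mul1r.
move=> /(congr1 (fun r : R => r * kap (2%:R)^-1)); rewrite mul0r.
have -> : t *: (kap 2%:R *: (1 : R^o)) * kap (2%:R)^-1 = t * (kap 2%:R * kap (2%:R)^-1) :> R.
  by rewrite -mulrA; congr (_ * (_ * _)); apply: mulr1.
by rewrite -rmorphM mulfV // rmorph1 mulr1 => /esym/eqP; rewrite (negPf t0).
Qed.

End TwistedHopf.

Lemma W_not_commutative k (a : mexp n) i : W (wmon K p a i) <> 0 ->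
  (a - eps i) k = -1 -> ~ commutative (@GRing.mul A).
Proof.
move=> x0 ak C; apply: x0; have := Wbrk (hW K p k) (wmon K p a i).
rewrite (wmon_brk_toral hp) ak C subrr WZ rmorphN1 scaleN1r => /esym/eqP.
by rewrite oppr_eq0 => /eqP.
Qed.

End WittCartan.

(** * The quantization *)

Section Separation.
Context (K : fieldType) (p n : nat) (q : K).
Hypothesis hp : p \in [pchar K].
Local Notation S := {poly %/ tpoly p q}.
Local Notation U := (utq p n q).
Local Notation x2 k := (xpow K p (eps k *+ 2)).

Lemma midx_eps2 (k : 'I_n) : (2 < p)%N ->
  exists2 e2 : midx p n, expo e2 = eps k *+ 2 & e2 k = 2 :> nat.
Proof.
move=> p2; have h (j : 'I_n) : ((j == k) * 2 < p)%N by case: eqP => // _; apply: ltnW (ltnW p2).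
exists [ffun j => Ordinal (h j)]; last by rewrite ffunE /= eqxx.
apply/ffunP => j; rewrite ffunMnE !ffunE /=.
by case: eqP.
Qed.

(** The functionals attached to h_k and x^(2 eps_k) D_k. The first one vanishes on
    h_k e_k, which maps x_k to a multiple of x^(2 eps_k). *)
Lemma utq_he_functionals (k : 'I_n) : (2 < p)%N -> exists ph pe : U -> S^o,
  [/\ linear ph /\ linear pe, ph (wu q (hW K p k)) = 1,
      ph (wu q (wmon K p (eps k *+ 2) k)) = 0,
      ph (wu q (hW K p k) * wu q (eW K p k)) = 0
    & pe (wu q (wmon K p (eps k *+ 2) k)) = 1].
Proof.
move=> p2; have [e1 E1] := eps_in hp k; have [e2 E2 e2k] := midx_eps2 k p2.
have e12 : e1 != e2.
  apply: contraTneq (erefl true) => e12; move: E2; rewrite -e12 -E1 => /ffunP/(_ k).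
  by rewrite ffunMnE ffunE eqxx.
have [ph [phl _ phg phM]] := @utq_functional K p n q hp (e1, k).
have [pe [pel _ peg _]] := @utq_functional K p n q hp (e2, k).
exists ph, pe; split=> //.
- by have := phg (e1, k); rewrite eqxx /utq_gen /= -E1.
- by have := phg (e2, k); rewrite /utq_gen /= E2 xpair_eqE (negPf e12).
- have eE : wact (eW K p k) (xpow K p (eps k)) = 2%:R *: x2 k.
    rewrite /eW -[X in wact X]addr0 wact_linearl wact_wmon {2}E1 oder_xpow -E1 subrr.
    rewrite omul_xpow0 [wact 0 _]big1 ?addr0 // => j _.
    by rewrite ffunE omul0l.
  rewrite phM /= eE (linear_funZ (@wact_linear K p n _)) wact_wmon -E2 toral_act.
  rewrite !ffunE (inj_eq (@expo_inj p n)) (negPf e12).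
  by rewrite scaler0 scaler0 scale0r.
- by have := peg (e2, k); rewrite eqxx /utq_gen /= E2.
Qed.

End Separation.

(** D_1 is a nonzero eigenvector of ad h_1 for the eigenvalue - 1, which excludes
    commutativity. *)
Theorem theorem3p7 (K : fieldType) (p : nat) (hp : p \in [pchar K]) (q : K)
    (n : nat) (hn : (0 < n)%N) (eta : {ffun 'I_n -> bool}) :
  (exists H : hopf_structure (utq p n q),
     [/\ ~ commutative (@GRing.mul (utq p n q)),
         (2 < p)%N -> (exists k, eta k) -> ~ cocommutative H &
         forall (alpha : midx p n) (i : 'I_n),
           [/\ coproduct H (wu q (wmon K p (expo alpha) i))
                 = coproduct_formula q eta alpha i,
               antipode H (wu q (wmon K p (expo alpha) i))
                 = antipode_formula q eta alpha i &
               counit H (wu q (wmon K p (expo alpha) i)) = 0]])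
  /\ has_dim (tens (restr_env K p n) {poly %/ tpoly p q}) (p ^ (1 + n * p ^ n)).
Proof.
split; last exact: utq_dim.
have [H [HD Heps HS HS1 HSM]] := utq_hopf n q hp.
have WP := @wuP K p n q; have Wb := @wu_brk K p n q.
have Wt := @wu_toral K p n q; have Wn := @wu_nil K p n q.
have [H' [H'f H'h]] := @witt_twist K p n hp {poly %/ tpoly p q} (utq p n q)
  (in_alg _) (wu q) eta (tq p q) WP Wb Wt Wn H HD Heps HS HS1 HSM.
exists H'; split.
- have p_gt0 := prime_gt0 (pchar_pr hp).
  pose i0 := Ordinal hn; pose a0 : midx p n := [ffun=> Ordinal p_gt0].
  apply: (@W_not_commutative K p n hp _ (utq p n q) (in_alg _) (wu q) WP Wb i0 (expo a0) i0).
    have [ph [phl _ phg _]] := @utq_functional K p n q hp (a0, i0).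
    move=> x0; have := phg (a0, i0); rewrite eqxx /utq_gen /= x0 (linear_fun0 phl).
    by move/esym/eqP; rewrite oner_eq0.
  by rewrite !ffunE eqxx.
- move=> p2 [k ek]; have [ph [pe [[phl pel] ph1 ph2 ph3 pe1]]] := @utq_he_functionals K p n q hp k p2.
  apply: (@twist_not_cocommutative K p n hp _ (utq p n q) (in_alg _) (wu q) eta (tq p q)
    WP Wn H' k ph pe ek (tq_neq0 q hp) _ (H'h k) phl pel ph1 ph2 ph3 pe1).
  by rewrite -(dvdn_pcharf hp) gtnNdvd.
- exact: H'f.
Qed.
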